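(* There is an absolute constant $C>0$ such that the following holds. Let $I^n\subseteq\mathbb R^n$ be a compact cube ($I$ a compact interval). Let $\mu=(\mu_j)_{j\ge1}$ be an admissible weight, $M_0>0$, and $M_2=M_0\mu_1\mu_2\ge b_2>0$. Assume that $(\mu_{+2},M_2+\tfrac{b_2}2,\sqrt n\,|I|,\tfrac{b_2}2)$ is admissible and let $\mathbf N=\mathbf N(\mu_{+2},M_2+\tfrac{b_2}2,\sqrt n\,|I|,\tfrac{b_2}2)$. Let $f:I^n\to\mathbb R$ be a $(\mu^{|\mathbf N+2},M_0)$-smooth function. Assume that, for some $1\le i_0\le n$, we have $\|\partial_{i_0}^2f\|_\ell\ge b_2$ for each line segment $\ell$ in $I^n$ with direction $e_{i_0}$ (i.e. each segment $\ell=I^n\cap(x+\mathbb Re_{i_0})$, $x\in I^n$). Let $g:I^n\to\mathbb C$ belong to $C^1(I^n)$. Then $$\Big|\int_{I^n}e^{i\lambda f(x)}g(x)\,dx\Big|\le B\,\lambda^{-\frac1{\mathbf N+2}},\qquad\text{if }\lambda\ge\Big(\frac2{b_2}\Big)^{1+\frac2{\mathbf N}},$$ where $$B=\frac{\mathbf C_{\mathbf N}^{1/\mathbf N}\,n\,|I|^n\,\|g\|_{I^n}}{\|\partial_{i_0}^2f\|_{I^n}^{1/\mathbf N}}+2C(\mathbf N+1)\big(|I|^{n-1}\|g\|_{I^n}+\|\partial_{i_0}g\|_{L^1(I^n)}\big).$$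
   Context: $|I|$ is the length of $I$; $\|h\|_E:=\sup_{x\in E}|h(x)|$; $e_1,\dots,e_n$ is the standard basis. Weights and smoothness. An admissible weight is a sequence $\mu=(\mu_j)_{j\ge1}$ of reals with $0<\mu_1\le\mu_2\le\cdots$. The shifted weight is $\mu_{+2}:=(\mu_{j+2})_{j\ge1}$. Given $M_0>0$ put $M_j=M_0\mu_1\cdots\mu_j$, $j\ge1$. For $N\in\mathbb N_{\ge1}\cup\{\infty\}$ and nonempty compact $L\subseteq\mathbb R^n$, a function $f:L\to\mathbb R$ is $(\mu^{|N},M_0)$-smooth if it is of class $C^N$ in some open neighborhood of $L$ and $\sup_{x\in L}\sum_{|\alpha|=j}\frac{j!}{\alpha!}|\partial^\alpha f(x)|\le M_j$ for all integers $0\le j<N+1$. Degree. For an admissible weight $\lambda$ and $A,a,b>0$ let $j_0$ be the smallest nonnegative integer $\ge\log(A/b)$. The tuple $(\lambda,A,a,b)$ is admissible if $\sum_{j=j_0+1}^\infty 1/\lambda_j>a\,e$; then $\mathbf N(\lambda,A,a,b):=2\sup\{k\in\mathbb N:\sum_{j=j_0+1}^k\frac1{a\lambda_j}<e\}$ (empty sums are $0$). The constant $\mathbf C_{\mathbf N}$ is formed with the shifted weight $\mu_{+2}$: fix an increasing continuous, (piecewise) $C^1$ function $\tilde\mu:[1,\infty)\to(0,\infty)$ with $\tilde\mu(j)=\mu_{j+2}$ for integers $j\ge1$ (left derivatives are used at points of nondifferentiability), put $\gamma_{\tilde\mu}(k):=\sup_{1\le s\le k}\frac{s\tilde\mu'(s)}{\tilde\mu(s)}$,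 and $\mathbf C_{\mathbf N}:=(4e^{4+\gamma_{\tilde\mu}(\mathbf N)})^{\mathbf N}$. *)

(* Defs.v *)
From HB Require Import structures.
From mathcomp Require Import all_boot all_order all_algebra.
From mathcomp Require Import all_classical all_reals all_analysis.
From mathcomp Require Import complex.

Set Implicit Arguments.
Unset Strict Implicit.
Unset Printing Implicit Defensive.
Import Order.TTheory GRing.Theory Num.Theory.
Import numFieldNormedType.Exports.

Local Open Scope classical_set_scope.
Local Open Scope ring_scope.

Section lebesgue_n.
Variable R : realType.
Local Notation mR := (measurableTypeR R).

Definition tcons n (p : mR * n.-tuple mR) : n.+1.-tuple mR :=
  [the n.+1.-tuple mR of p.1 :: p.2].

Lemma measurable_tcons n : measurable_fun [set: mR * n.-tuple mR] (@tcons n).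
Proof. exact: measurable_cons. Qed.

Section step.
Variable n : nat.
Variable mu : {sigma_finite_measure set (n.-tuple mR) -> \bar R}.

Definition lebesgue_step : set (n.+1.-tuple mR) -> \bar R :=
  pushforward (lebesgue_measure \x mu)%E (@tcons n).

Let step0 : lebesgue_step set0 = 0%E.
Proof. by rewrite /lebesgue_step /pushforward preimage_set0 measure0. Qed.

Let step_ge0 A : (0 <= lebesgue_step A)%E.
Proof. by rewrite /lebesgue_step /pushforward; exact: measure_ge0. Qed.

Let step_sigma_additive : semi_sigma_additive lebesgue_step.
Proof.
move=> F mF tF mUF; rewrite /lebesgue_step /pushforward preimage_bigcup.
apply: measure_semi_sigma_additive.
- by move=> k; rewrite -[X in measurable X]setTI; exact: measurable_tcons.
- apply/trivIsetP => /= i j _ _ ij; rewrite -preimage_setI.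
  by move/trivIsetP : tF => /(_ _ _ _ _ ij) ->//; rewrite preimage_set0.
- rewrite -preimage_bigcup -[X in measurable X]setTI.
  exact: measurable_tcons.
Qed.

HB.instance Definition _ := isMeasure.Build _ _ _ lebesgue_step
  step0 step_ge0 step_sigma_additive.

Let step_sigma_finite : sigma_finite setT lebesgue_step.
Proof.
have /sigma_finiteP[F [TF ndF Foo]] := sigma_finiteT (@lebesgue_measure R).
have /sigma_finiteP[G [TG ndG Goo]] := sigma_finiteT mu.
pose hd (t : n.+1.-tuple mR) : mR := thead t.
pose tl (t : n.+1.-tuple mR) : n.-tuple mR := [tuple of behead t].
have mE k : measurable (hd @^-1` F k `&` tl @^-1` G k).
  have [? _] := Foo k; have [? _] := Goo k.
  apply: measurableI; rewrite -[X in measurable X]setTI.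
    exact: measurable_tnth.
  exact: measurable_behead.
exists (fun k => hd @^-1` F k `&` tl @^-1` G k).
  rewrite predeqE => t; split=> // _.
  have [i _ Fi] : (\bigcup_i F i) (hd t) by rewrite -TF.
  have [j _ Gj] : (\bigcup_i G i) (tl t) by rewrite -TG.
  exists (maxn i j) => //; split.
  - by have /subsetPset FS := ndF _ _ (leq_maxl i j); exact: FS.
  - by have /subsetPset GS := ndG _ _ (leq_maxr i j); exact: GS.
move=> k; split; first exact: mE.
have [mF ltF] := Foo k; have [mG ltG] := Goo k.
rewrite /lebesgue_step /pushforward.
have tlE (p : mR * n.-tuple mR) : tl (tcons p) = p.2 by exact: val_inj.
rewrite (_ : _ @^-1` _ = F k `*` G k); last first.
  by apply/seteqP; split=> p /=; rewrite tlE.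
by rewrite product_measure1E// lte_mul_pinfty// ge0_fin_numE.
Qed.

HB.instance Definition _ := Measure_isSigmaFinite.Build _ _ _ lebesgue_step
  step_sigma_finite.

End step.

Fixpoint lebesgue_n n : {sigma_finite_measure set (n.-tuple mR) -> \bar R} :=
  match n with
  | 0 => \d_([tuple] : 0.-tuple mR)
  | n'.+1 => lebesgue_step (lebesgue_n n')
  end.

End lebesgue_n.

Section defs.
Variable R : realType.

Definition rowt n (t : n.-tuple (measurableTypeR R)) : 'rV[R]_n :=
  \row_i tnth t i.

(* Points of R^n are row vectors, but the measurable structure and the measure
   live on tuples. *)
Definition int_Rn n (E : set 'rV[R]_n) (h : 'rV[R]_n -> R) : R :=
  (\int[lebesgue_n R n]_(t in @rowt n @^-1` E) h (rowt t))%R.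

Definition int_Cn n (E : set 'rV[R]_n) (h : 'rV[R]_n -> R[i]) : R[i] :=
  Complex (int_Rn E (fun x => complex.Re (h x))) (int_Rn E (fun x => complex.Im (h x))).

Definition expi (t : R) : R[i] := Complex (cos t) (sin t).

Definition cmod (z : R[i]) : R := Normc.normc z.

Definition supnorm (T : Type) (E : set T) (h : T -> R) : R :=
  sup [set `|h x| | x in E].

Definition stdvec n (i : 'I_n) : 'rV[R]_n := delta_mx 0 i.

Definition cube n (c d : R) : set 'rV[R]_n :=
  [set x | forall i, c <= x 0 i <= d].

Definition cube_line n (c d : R) (i : 'I_n) (x : 'rV[R]_n) : set 'rV[R]_n :=
  cube c d `&` [set x + t *: stdvec i | t in [set: R]].

(* A weight is indexed from 1: the value at 0 is never used. *)
Definition admissible_weight (mu : nat -> R) : Prop :=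
  0 < mu 1%N /\ forall j, (1 <= j)%N -> mu j <= mu j.+1.

Definition shift2 (mu : nat -> R) : nat -> R := fun j => mu j.+2.

Definition weightM (mu : nat -> R) (M0 : R) (j : nat) : R :=
  M0 * \prod_(1 <= i < j.+1) mu i.

Fixpoint partials n (s : seq 'I_n) (f : 'rV[R]_n -> R) : 'rV[R]_n -> R :=
  match s with
  | [::] => f
  | i :: s' => fun x => 'D_(stdvec i) (partials s' f) x
  end.

Definition partial_multi n (al : 'I_n -> nat) (f : 'rV[R]_n -> R) :=
  partials (flatten [seq nseq (al i) i | i <- enum 'I_n]) f.

Definition Ck_on n (k : nat) (U : set 'rV[R]_n) (f : 'rV[R]_n -> R) : Prop :=
  forall s : seq 'I_n, (size s <= k)%N ->
    (forall x, U x -> {for x, continuous (partials s f)}) /\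
    ((size s < k)%N ->
       forall i x, U x -> derivable (partials s f) x (stdvec i)).

(* The sum ranges over all multi-indices al with |al| = j; such an al has
   entries at most j. *)
Definition jet_norm n (j : nat) (f : 'rV[R]_n -> R) (x : 'rV[R]_n) : R :=
  \sum_(al : {ffun 'I_n -> 'I_j.+1} | (\sum_i al i)%N == j)
    (j`!%:R / (\prod_i (al i)`!)%:R) *
    `|partial_multi (fun i => al i : nat) f x|.

(* (mu^{|N}, M0)-smooth on L, for finite N.  f is a total function, whose
   values matter only near L. *)
Definition mu_smooth n (mu : nat -> R) (N : nat) (M0 : R)
    (L : set 'rV[R]_n) (f : 'rV[R]_n -> R) : Prop :=
  (exists U : set 'rV[R]_n, [/\ open U, L `<=` U & Ck_on N U f]) /\
  forall j, (j < N.+1)%N -> forall x, L x -> jet_norm j f x <= weightM mu M0 j.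

(* In nat the infimum of a nonempty set is its minimum and the supremum of a
   bounded nonempty set its maximum.  The set in degreeN is bounded when
   admissible_tuple holds; otherwise degreeN has a junk value. *)
Definition degree_j0 (A b : R) : nat :=
  infimum 0%N [set j : nat | ln (A / b) <= j%:R].

Definition admissible_tuple (lam : nat -> R) (A a b : R) : Prop :=
  [/\ admissible_weight lam, 0 < A, 0 < a, 0 < b &
      ((a * expR 1)%:E
         < \sum_((degree_j0 A b).+1 <= j <oo) ((lam j)^-1)%:E)%E].

Definition degreeN (lam : nat -> R) (A a b : R) : nat :=
  (2 * supremum 0 [set k : nat |
     (\sum_((degree_j0 A b).+1 <= j < k.+1) (a * lam j)^-1 < expR 1 :> R)%R])%N.

(* The breakpoints are locally finite; on each closed piece h is the restriction
   of a C^1 function, so that C^1 functions on [1, +oo[ are included. *)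
Definition piecewise_C1 (h : R -> R) : Prop :=
  exists t : nat -> R,
    [/\ t 0%N = 1, (forall i, t i < t i.+1), t @ \oo --> +oo &
        forall i, exists k : R -> R,
          [/\ forall x, derivable k x 1, continuous (derive1 k) &
              {in `[t i, t i.+1], h =1 k}]].

Definition weight_interpolation (mu : nat -> R) (h : R -> R) : Prop :=
  [/\ {in `[1, +oo[ &, {homo h : x y / x <= y}},
      {within [set` `[1, +oo[], continuous h},
      piecewise_C1 h,
      (forall s, 1 <= s -> 0 < h s) &
      (forall j : nat, (1 <= j)%N -> h j%:R = mu j)].

(* Derivative on [1, +oo[ : the left derivative at s > 1 (which is the
   derivative wherever the latter exists), the one-sided derivative at 1. *)
Definition deriv1oo (h : R -> R) (s : R) : R :=
  if 1 < s then lim ((fun u => u^-1 * (h (s + u) - h s)) @ 0^'-)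
  else lim ((fun u => u^-1 * (h (s + u) - h s)) @ 0^'+).

Definition gamma_weight (h : R -> R) (k : R) : R :=
  sup [set s * deriv1oo h s / h s | s in `[1, k]].

Definition constC (h : R -> R) (N : nat) : R :=
  (4 * expR (4 + gamma_weight h N%:R)) ^+ N.

(* Difference quotients use only increments that stay in E, so on a cube the
   partial derivatives are one-sided at the faces: C1_within is C^1 up to the
   boundary, and values outside E are irrelevant. *)
Definition has_dpartial n (E : set 'rV[R]_n) (i : 'I_n) (h : 'rV[R]_n -> R)
    (x : 'rV[R]_n) :=
  cvg ((fun u : R => u^-1 * (h (x + u *: stdvec i) - h x)) @
         within [set u | E (x + u *: stdvec i)] 0^').

Definition dpartial n (E : set 'rV[R]_n) (i : 'I_n) (h : 'rV[R]_n -> R)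
    (x : 'rV[R]_n) : R :=
  lim ((fun u : R => u^-1 * (h (x + u *: stdvec i) - h x)) @
         within [set u | E (x + u *: stdvec i)] 0^').

Definition C1_within n (E : set 'rV[R]_n) (h : 'rV[R]_n -> R) : Prop :=
  {within E, continuous h} /\
  forall i, (forall x, E x -> has_dpartial E i h x) /\
            {within E, continuous (dpartial E i h)}.

Definition C1_withinC n (E : set 'rV[R]_n) (g : 'rV[R]_n -> R[i]) : Prop :=
  C1_within E (fun x => complex.Re (g x)) /\ C1_within E (fun x => complex.Im (g x)).

Definition dpartialC n (E : set 'rV[R]_n) (i : 'I_n) (g : 'rV[R]_n -> R[i])
    (x : 'rV[R]_n) : R[i] :=
  Complex (dpartial E i (fun y => complex.Re (g y)) x)
          (dpartial E i (fun y => complex.Im (g y)) x).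

(* Here f2 stands for the second partial derivative of f in direction i0. *)
Definition boundB n (C CN : R) (N : nat) (c d : R) (i0 : 'I_n)
    (f2 : 'rV[R]_n -> R) (g : 'rV[R]_n -> R[i]) : R :=
  let E := cube c d in
  let gsup := supnorm E (fun x => cmod (g x)) in
  CN `^ (N%:R^-1) * n%:R * (d - c) ^+ n * gsup
    / (supnorm E f2 `^ (N%:R^-1))
  + 2 * C * (N%:R + 1) *
    ((d - c) ^+ n.-1 * gsup + int_Rn E (fun x => cmod (dpartialC E i0 g x))).

End defs.

(* Main.v *)
Require Import Defs.
From mathcomp Require Import all_boot all_order all_algebra.
From mathcomp Require Import all_classical all_reals all_analysis.
From mathcomp Require Import measurable_realfun complex ring lra zify.
Import Order.TTheory GRing.Theory Num.Theory.
Import numFieldNormedType.Exports.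
Local Open Scope classical_set_scope.
Local Open Scope ring_scope.

(* Everything takes place on lines in the direction [i0].  Put [L = lam^(-1/(N+2))]
   and let [h] be the second derivative of [f] on such a line.

   Bang's theorem: if [h] and its derivatives have zeros (or are small enough)
   at [p] successive points, and the interval is no longer than the sum of
   [1 / (e mu_{j+2})] over [j0 < j <= p], then [|h|] is at most [e^-j0 M_2] at
   the endpoint.  As [h] reaches almost [b2 > e^-j0 M_2] on every line, this gives
   a bound on the number of solutions of [h = v], by Rolle's theorem, and, applied
   to [h] minus an interpolation polynomial at well separated points of the set,
   a Remez type bound on the measure of the sublevel set [|h| <= L^N / 2].

   Off the sublevel set, the line splits into at most [2N + 1] pieces where
   [|lam h| >= 1 / (2 L^2)], and van der Corput's second derivative test bounds
   the integral over each piece by a constant times [L].  Tonelli's theorem then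
   integrates the estimate over all lines. *)

Set Implicit Arguments.
Unset Strict Implicit.

(** The exponent comes from a balance. A sublevel set [|h| <= eps] has measure of order
    [eps ^ (1/N)], and the second derivative test off it gives [(lam eps) ^ (-1/2)]; with
    [lam = L ^ -(N + 2)], the choice [eps = L ^ N / 2] makes both of order [L].

    Bang's theorem controls one endpoint of an interval only. So on every line a point [x] with
    [|h x|] large is chosen first, and the two sides of [x] are treated separately, the left one by
    reflection. Each side carries at most [n] solutions of [h = v], hence at most [N = 2 n] on the
    line.

    The lines are cut at the levels [v = eps] and [v = - eps]. The surplus [b2 / 2] in [M2 + b2 / 2]
    makes room for the passage from [h] to [h - v], and the lower bound on [lam] is what keeps [eps]
    below [b2 / 4].

    The constant gamma enters where the interpolation error is compared with products of weights: if
    the last weight is large compared with [N / |I|], the early weights need a lower bound in terms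
    of the last one, lest their products be too small. *)

Lemma expR_ge1 {R : realType} (x : R) : (1 <= expR x) = (0 <= x).
Proof. by rewrite leNgt expR_lt1 -leNgt. Qed.

(** * One-variable calculus *)

Lemma is_derive_continuous {R : realType} {F : R -> R} {x l : R} :
  is_derive x 1 F l -> {for x, continuous F}.
Proof. by move=> [dF _]; exact/differentiable_continuous/derivable1_diffP. Qed.

Lemma is_derive_within {R : realType} {F f : R -> R} {a b : R} :
  (forall x, a <= x <= b -> is_derive x 1 F (f x)) ->
  {within `[a, b], continuous F}.
Proof.
move=> dF; apply: continuous_in_subspaceT => x; rewrite inE/= in_itv/= => xab.
exact: is_derive_continuous (dF _ xab).
Qed.

Lemma ler_derive {R : realType} (F f : R -> R) (a b : R) :
  a <= b ->
  (forall x, a < x < b -> is_derive x 1 F (f x)) ->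
  (forall x, a < x < b -> 0 <= f x) ->
  {within `[a, b], continuous F} -> F a <= F b.
Proof.
rewrite le_eqVlt => /predU1P[->//|ab] dF f0 cF.
have dF' x : x \in `]a, b[ -> is_derive x 1 F (f x) by rewrite in_itv/=; exact: dF.
have [x xab E] := MVT ab dF' cF.
rewrite in_itv/= in xab.
by rewrite -subr_ge0 E mulr_ge0 ?f0// subr_ge0 ltW.
Qed.

(** Both [H - F] and [H + F] are nondecreasing. In this form increments of antiderivatives do the
    work of integrals. *)
Lemma derive_dominated {R : realType} (F H f h : R -> R) (a b : R) :
  a <= b ->
  (forall x, a < x < b -> is_derive x 1 F (f x)) ->
  (forall x, a < x < b -> is_derive x 1 H (h x)) ->
  (forall x, a < x < b -> `|f x| <= h x) ->
  {within `[a, b], continuous F} -> {within `[a, b], continuous H} ->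
  `|F b - F a| <= H b - H a.
Proof.
move=> ab dF dH fh cF cH.
have dB x : a < x < b -> is_derive x 1 (H \- F) (h x - f x).
  by move=> xab; apply: is_deriveB; [exact: dH|exact: dF].
have dD x : a < x < b -> is_derive x 1 (H \+ F) (h x + f x).
  by move=> xab; apply: is_deriveD; [exact: dH|exact: dF].
have hD : (H \+ F) a <= (H \+ F) b.
  apply: (@ler_derive R (H \+ F) (fun x => h x + f x) a b ab dD) => [x xab|x].
    by have := fh _ xab; rewrite ler_norml => /andP[? ?]; lra.
  by apply: continuousD; [exact: cH|exact: cF].
have hB : (H \- F) a <= (H \- F) b.
  apply: (@ler_derive R (H \- F) (fun x => h x - f x) a b ab dB) => [x xab|x].
    by have := fh _ xab; rewrite ler_norml => /andP[? ?]; lra.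
  by apply: continuousB; [exact: cH|exact: cF].
rewrite /= in hD hB; rewrite ler_norml; apply/andP; split; lra.
Qed.

(** * Bang's theorem *)

Section bang.
Variables (R : realType) (h : nat -> R -> R) (w z : nat -> R) (M0 al be : R).
Variables (p : nat).
Hypothesis M0_gt0 : 0 < M0.
Hypothesis w_gt0 : forall j, (1 <= j <= p)%N -> 0 < w j.
Hypothesis w_le : forall i j, (1 <= i)%N -> (i <= j <= p)%N -> w i <= w j.
Hypothesis dh : forall j t, (j < p)%N -> al <= t <= be ->
  is_derive t 1 (h j) (h j.+1 t).
Hypothesis hM : forall j t, (j <= p)%N -> al <= t <= be ->
  `|h j t| <= weightM w M0 j.
Hypothesis z_itv : forall j, (j < p)%N -> al <= z j <= be.
Hypothesis z_le : forall j, (j.+1 < p)%N -> z j <= z j.+1.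
Hypothesis hz : forall j, (j < p)%N ->
  `|h j (z j)| <= expR (j%:R - p%:R) * weightM w M0 j.

Local Notation M := (weightM w M0).

Lemma weightMS j : weightM w M0 j.+1 = M j * w j.+1.
Proof. by rewrite /weightM big_nat_recr//= mulrA. Qed.

Lemma weightM_gt0 j : (j <= p)%N -> 0 < M j.
Proof.
elim: j => [|j IH jp]; first by rewrite /weightM big_geq// mulr1.
by rewrite weightMS mulr_gt0 ?w_gt0// IH// ltnW.
Qed.

(* The majorant of Bang's norm drops from [e^-(k-1)] to [e^-k] between
   [bk k.-1] and [bk k]. *)
Let bk k := be - \sum_(k.+1 <= i < p.+1) (expR 1 * w i)^-1.

Let bkS k : (k < p)%N -> bk k.+1 = bk k + (expR 1 * w k.+1)^-1.
Proof. by move=> kp; rewrite /bk [in RHS]big_ltn//; lra. Qed.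

(** Downward induction on [j] from [k + 1], where [hM] suffices. For smaller [l], the derivative
    [h l.+1] is integrated leftwards from [x]: since [w l.+1 <= w k.+1], its bound is at most the
    derivative of [- c * E], so the same exponential reappears. The bounds hold only to the left of
    [z j], which is where the order of the [z j] enters. *)
Let inner k j : (k < p)%N -> (j <= k.+1)%N ->
  (forall j y, (j < p)%N -> al <= y <= z j -> bk k.+1 <= y ->
    `|h j y| <= expR (j%:R - k.+1%:R) * M j) ->
  forall y, al <= y <= be -> ((j < k.+1)%N -> y <= z j) -> bk k <= y <= bk k.+1 ->
    `|h j y| <= expR (j%:R - k.+1%:R) *
       expR (expR 1 * w k.+1 * (bk k.+1 - y)) * M j.
Proof.
move=> kp jk Rk; have w0 : 0 < w k.+1 by rewrite w_gt0.
have E0 := @expR_gt0 R 1.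
have -> : j = (k.+1 - (k.+1 - j))%N by rewrite subKn.
elim: (k.+1 - j)%N => [|i IH] y /andP[y1 y2] yz /andP[y3 y4].
  rewrite subn0 subrr expR0 mul1r (le_trans (hM _ _)) ?y1//.
  rewrite ler_peMl ?(ltW (weightM_gt0 _))// expR_ge1.
  by rewrite mulr_ge0 ?subr_ge0// mulr_ge0 ?ltW.
have [ik|ik] := leqP k.+1 i.
  move: (IH y); rewrite (_ : k.+1 - i = k.+1 - i.+1)%N; last first.
    by lia.
  by apply; rewrite ?y1 ?y3.
set l := (k.+1 - i.+1)%N in yz *.
have lE : (k.+1 - i = l.+1)%N by rewrite /l subnS prednK// subn_gt0.
have lk : (l < k.+1)%N by rewrite -lE leq_subr.
have lp : (l < p)%N by rewrite (leq_trans lk).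
rewrite lE in IH; have {}yz := yz lk.
have /andP[zl1 zl2] := z_itv lp.
(* At [x] the bound [c] is available: from [hz] if [z l] comes first, otherwise from what is already
   known beyond [bk k.+1]. *)
pose x := Num.min (z l) (bk k.+1).
have yx : y <= x by rewrite le_min yz y4.
have xz : x <= z l by rewrite ge_min lexx.
have xb : x <= bk k.+1 by rewrite ge_min lexx orbT.
have Ml := weightM_gt0 (ltnW lp).
pose c := expR (l%:R - k.+1%:R) * M l.
have c0 : 0 < c by rewrite mulr_gt0 ?expR_gt0.
pose E s := expR (expR 1 * w k.+1 * (bk k.+1 - s)).
have hx : `|h l x| <= c * E x.
  apply: (@le_trans _ _ c); last first.
    rewrite ler_peMr ?(ltW c0)// /E expR_ge1 mulr_ge0 ?subr_ge0// mulr_ge0//; exact: ltW.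
  rewrite /c /x; case: (leP (z l)) => zb; last by apply: Rk => //; lra.
  by rewrite (le_trans (hz lp))// ler_pM2r// ler_expR lerD2l lerN2 ler_nat.
have dE (s : R) : is_derive s 1 (fun s => - c * E s) (c * (expR 1 * w k.+1 * E s)).
  have -> : c * (expR 1 * w k.+1 * E s) = - c * (E s * - (expR 1 * w k.+1)) by ring.
  apply: is_deriveZ.
  apply: is_derive1_comp; rewrite -[X in is_derive _ _ _ X]mulrN1.
  apply: is_deriveZ.
  rewrite -[X in is_derive _ _ _ X]add0r; apply: is_deriveB.
have H : `|h l x - h l y| <= - c * E x - - c * E y.
  have cE : {within `[y, x], continuous (fun s => - c * E s)}.
    by apply: is_derive_within => s _; exact: dE.
  have dl (s : R) : y <= s <= x -> is_derive s 1 (h l) (h l.+1 s).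
    by move=> ss; apply: dh => //; lra.
  apply: (derive_dominated yx _ (fun s _ => dE s) _ (is_derive_within dl) cE).
    by move=> s ss; apply: dl; lra.
  move=> s /andP[s1 s2]; apply: (le_trans (IH s _ _ _)).
  - by lra.
  - move=> lk1; rewrite (le_trans (ltW s2))// (le_trans xz)// z_le//.
    by rewrite (leq_trans lk1).
  - by lra.
  rewrite weightMS -natr1 (_ : l%:R + 1 - k.+1%:R = l%:R - k.+1%:R + 1); last by ring.
  rewrite (expRD (l%:R - _)).
  rewrite [leLHS](_ : _ = c * (expR 1 * w l.+1 * E s)); last by rewrite /c /E; ring.
  rewrite ler_pM2l// ler_pM2r ?expR_gt0// ler_pM2l//.
  by rewrite w_le// lk.
have {H} : `|h l y| <= `|h l x| + (- c * E x - - c * E y).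
  by rewrite -[in leLHS](subrK (h l x) (h l y)) addrC (le_trans (ler_normD _ _))// lerD2l distrC.
by move=> H; rewrite [leRHS](_ : _ = c * E y); [lra|rewrite /c /E; ring].
Qed.

(** Downward induction on [k] from [p] to [j0]. At [k = p] only [y = z j = be] remains, and [hz]
    applies. Over a step of length [(expR 1 * w k.+1)^-1] the exponential in [inner] grows by at
    most a factor [e], which is the loss of one index; orders [j > k] are covered by [hM] because
    [expR (j - k) >= 1]. *)
Lemma bang j0 : (j0 <= p)%N -> (0 < p)%N ->
  be - al <= \sum_(j0.+1 <= i < p.+1) (expR 1 * w i)^-1 ->
  al <= be ->
  `|h 0 al| <= expR (- j0%:R) * M0.
Proof.
move=> j0p p0 len ab.
suff H : forall j y, (j < p)%N -> al <= y <= z j -> bk j0 <= y ->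
    `|h j y| <= expR (j%:R - j0%:R) * M j.
  have := H 0%N al p0; rewrite add0r /weightM big_geq// mulr1; apply.
    by rewrite lexx; have /andP[] := z_itv p0.
  by rewrite /bk; lra.
rewrite -(subKn j0p); elim: (p - j0)%N => [|i IH] j y jp yz by_.
  rewrite subn0 in by_ *; move: (z_itv jp) by_ => /andP[? ?].
  rewrite /bk big_geq// subr0 => bey.
  have -> : y = z j by apply/eqP; rewrite eq_le; lra.
  exact: hz.
have [pi|pi] := leqP p i.
  move: (IH j y); rewrite (_ : p - i = p - i.+1)%N; last first.
    by lia.
  exact.
set k := (p - i.+1)%N in by_ *.
have kE : (p - i = k.+1)%N by rewrite /k subnS prednK// subn_gt0.
have kp : (k < p)%N by rewrite -kE leq_subr.
rewrite kE in IH.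
have Mj := weightM_gt0 (ltnW jp).
have /andP[zj1 zj2] := z_itv jp.
have [b1|b1] := leP (bk k.+1) y.
  rewrite (le_trans (IH _ _ jp yz b1))// ler_pM2r// ler_expR lerD2l lerN2 ler_nat.
  exact: leqnSn.
have [kj|jk] := ltnP k j.
  apply: (le_trans (hM (ltnW jp) _)); first by lra.
  by rewrite ler_peMl ?(ltW Mj)// expR_ge1 subr_ge0 ler_nat ltnW.
apply: (le_trans (inner kp (leqW jk) IH _ _ _)).
- by lra.
- by move=> _; lra.
- by lra.
rewrite ler_pM2r// -expRD ler_expR -natr1.
have := bkS kp; have w0 : 0 < expR 1 * w k.+1 by rewrite mulr_gt0 ?expR_gt0 ?w_gt0.
move=> bE; have : expR 1 * w k.+1 * (bk k.+1 - y) <= 1.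
  by rewrite -ler_pdivlMl// mulr1; lra.
lra.
Qed.

End bang.

(** * Interpolation *)

Lemma is_derive_horner {R : realType} (P : {poly R}) (x : R) :
  is_derive x 1 (horner P) P^`().[x].
Proof.
apply: DeriveDef; first exact: derivable_horner.
by rewrite -derive1E -derivE.
Qed.

(** [z 0] is the first node. Rolle's theorem gives zeros of [r 1] between successive nodes, and the
    induction hypothesis for these yields the other [z j]. The lower bound [y 0] is carried along so
    that the chain comes out nondecreasing. *)
Lemma rolle_chain {R : realType} (p : nat) (r : nat -> R -> R) (y : nat -> R)
    (al be : R) : (0 < p)%N ->
  (forall j t, (j.+1 < p)%N -> al <= t <= be -> is_derive t 1 (r j) (r j.+1 t)) ->
  (forall i, (i.+1 < p)%N -> y i < y i.+1) ->
  (forall i, (i < p)%N -> al <= y i <= be /\ r 0%N (y i) = 0) ->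
  exists z : nat -> R,
    (forall j, (j < p)%N -> y 0%N <= z j <= be /\ r j (z j) = 0) /\
    (forall j, (j.+1 < p)%N -> z j <= z j.+1).
Proof.
case: p => // p _; elim: p r y => [|p IH] r y dr yy ry.
  exists (fun=> y 0%N); split=> // -[|//] _.
  by have [/andP[_ yb] r0] := ry 0%N isT; rewrite lexx yb.
have /choice[y' Hy'] : forall i, exists x, (i.+1 < p.+2)%N ->
    y i < x < y i.+1 /\ r 1%N x = 0.
  move=> i; have [ip|] := boolP (i.+1 < p.+2)%N; last by exists 0.
  have [/andP[a1 b1] r1] := ry i (ltnW ip); have [/andP[a2 b2] r2] := ry _ ip.
  have dri t : y i <= t <= y i.+1 -> is_derive t 1 (r 0%N) (r 1%N t).
    by move=> ti; apply: dr => //; lra.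
  have [|||x xi [dx x0]] := @Rolle R (r 0%N) (y i) (y i.+1) (yy _ ip).
  - by move=> t; rewrite in_itv/= => ti; have [] := dri t; [lra|].
  - exact: is_derive_within dri.
  - by rewrite r1 r2.
  rewrite in_itv/= in xi.
  exists x => _; split => //.
  by have [|_ <-//] := dri x; lra.
have [||i ip|z [Hz zz]] := IH (fun j => r j.+1) y'.
- by move=> j t jp tab; exact: dr.
- move=> i ip; have [|/andP[_ h1] _] := Hy' i; first by rewrite ltnW.
  by have [|/andP[h2 _] _] := Hy' i.+1; [|lra].
- have [|/andP[h1 h2] ->] := Hy' i; first by [].
  have [/andP[h3 _] _] := ry i (ltnW ip); have [/andP[_ h4] _] := ry i.+1 ip.
  by split=> //; lra.
exists (fun j => if j is j'.+1 then z j' else y 0%N); split.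
- case=> [_|j jp]; first by have [/andP[_ yb] r0] := ry 0%N isT; rewrite lexx yb.
  have [/andP[z1 z2] z0] := Hz j jp; split=> //.
  by have [|/andP[h1 h2] _] := Hy' 0%N; [|lra].
- case=> [_|j jp]; last exact: zz.
  have [/andP[z1 _] _] := Hz 0%N isT.
  by have [|/andP[h1 h2] _] := Hy' 0%N; [|lra].
Qed.

Lemma derivn_mulXsubC {R : comRingType} (a : R) (Q : {poly R}) j :
  (('X - a%:P) * Q)^`(j.+1) = ('X - a%:P) * Q^`(j.+1) + Q^`(j) *+ j.+1.
Proof.
elim: j => [|j IH].
  by rewrite !derivn1 derivM derivB derivX derivC subr0 mul1r addrC mulr1n.
rewrite derivnS IH derivD derivM derivB derivX derivC subr0 mul1r derivMn -!derivnS.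
by rewrite [in RHS]mulrS addrA [X in X + _]addrC.
Qed.

(** By Leibniz' rule the derivative is a sum of [size s ^_ j] products, each of the [size s - j]
    remaining linear factors. The induction mirrors the recursion of the falling factorial. *)
Lemma derivn_prod_XsubC_le {R : realFieldType} (s : seq R) (x L : R) j :
  {in s, forall a, `|x - a| <= L} -> 0 <= L ->
  `|(\prod_(a <- s) ('X - a%:P))^`(j).[x]| <= (size s ^_ j)%:R * L ^+ (size s - j).
Proof.
move=> + L0; elim: s j => [|a s IH] j xs.
  rewrite big_nil/=; case: j => [|j]; first by rewrite derivn0 hornerC normr1 ffactn0 mul1r.
  by rewrite -[1]/(1%:P) derivnC hornerC normr0 ffact0n/= mul0r.
have {}IH j' := IH j' (fun b bs => xs b (mem_behead (bs : b \in behead (a :: s)))).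
have xa : `|x - a| <= L by apply: xs; rewrite mem_head.
rewrite big_cons; case: j => [|j].
  rewrite derivn0 hornerM hornerXsubC normrM ffactn0 mul1r subn0/= exprS.
  by rewrite ler_pM//; have := IH 0%N; rewrite derivn0 ffactn0 mul1r subn0.
rewrite derivn_mulXsubC hornerD hornerM hornerXsubC hornerMn/= subSS ffactSS.
apply: (le_trans (ler_normD _ _)); rewrite normrM normrMn.
set k := size s.
have -> : (k.+1 * k ^_ j)%N = (k ^_ j.+1 + j.+1 * k ^_ j)%N.
  have [jk|jk] := leqP j k; last by rewrite !ffact_small ?ltnS ?muln0// ltnW.
  by rewrite ffactnSr [(_ * (_ - _))%N]mulnC -mulnDl; congr muln; lia.
rewrite natrD mulrDl; apply: lerD; last first.
  by rewrite natrM -mulrA mulr_natl lerMn2r IH orbT.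
apply: (@le_trans _ _ (L * ((k ^_ j.+1)%:R * L ^+ (k - j.+1)))).
  by apply: ler_pM => //; exact: (IH j.+1).
have [jk|jk] := ltnP j k; last by rewrite ffact_small// !mul0r mulr0.
by rewrite mulrCA -exprS subnSK.
Qed.

(** Nodes with indices [i] and [l] are at least [s * |i - l|] apart; the products over [l < i] and
    [l > i] give the two factorials. *)
Lemma prod_dist_ge {R : realFieldType} (k : nat) (y : nat -> R) (s : R) :
  0 < s -> (forall i, (i < k)%N -> y i + s <= y i.+1) ->
  forall i, (i <= k)%N ->
  s ^+ k * (i`! * (k - i)`!)%:R <=
    `|\prod_(l <- index_iota 0 i ++ index_iota i.+1 k.+1) (y i - y l)|.
Proof.
move=> s0 yy i ik.
have dist a b : (a <= b <= k)%N -> s * (b - a)%:R <= y b - y a.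
  move=> /andP[ab bk]; rewrite -(subnKC ab) addKn; move: bk; rewrite -{1}(subnKC ab).
  elim: (b - a)%N => [|m IH] mk; first by rewrite addn0 subrr mulr0.
  rewrite addnS in mk *; have := yy _ mk; have := IH (ltnW mk); rewrite -natr1; lra.
rewrite big_cat/= normrM !normr_prod.
rewrite -{1}(subnKC ik) exprD natrM mulrACA.
apply: ler_pM; rewrite ?mulr_ge0 ?exprn_ge0 ?(ltW s0)//.
- rewrite fact_prod big_add1/= big_nat_rev/= add0n.
  rewrite natr_prod -{1}(subn0 i) -prodr_const_nat -big_split/=.
  rewrite big_seq [leRHS]big_seq; apply: ler_prod => l; rewrite mem_index_iota/= => li.
  rewrite mulr_ge0 ?(ltW s0)//=.
  apply: le_trans (ler_norm _); rewrite -subSn//=.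
  by rewrite subSS; apply: dist; rewrite (ltnW li).
- rewrite fact_prod big_add1/=.
  rewrite natr_prod -{1}(subn0 (k - i)%N) -prodr_const_nat -big_split/=.
  rewrite -[X in \big[_/_]_(X <= _ < _) `|_|](add0n i.+1) big_addn subSS.
  rewrite big_mkord [leRHS]big_mkord; apply: ler_prod => l _.
  rewrite mulr_ge0 ?(ltW s0)//= distrC; apply: le_trans (ler_norm _).
  have -> : l.+1 = (l + i.+1 - i)%N by lia.
  by apply: dist; have := ltn_ord l; lia.
Qed.

(** Lagrange's formula, with [derivn_prod_XsubC_le] for the numerators and [prod_dist_ge] for the
    denominators. The sum of [1 / (i! (k - i)!)] is [2 ^ k / k!] by the binomial theorem, and
    [k ^_ j / k! = 1 / (k - j)!]. *)
Lemma lagrange_interpolation {R : realFieldType} (k : nat) (y v : nat -> R) (dl s : R) :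
  0 < s -> (forall i, (i < k)%N -> y i + s <= y i.+1) ->
  (forall i, (i <= k)%N -> `|v i| <= dl) ->
  exists P : {poly R}, (forall i, (i <= k)%N -> P.[y i] = v i) /\
    forall j x L, (j <= k)%N -> 0 <= L -> (forall i, (i <= k)%N -> `|x - y i| <= L) ->
      `|P^`(j).[x]| <= dl * (2 / s) ^+ k * L ^+ (k - j) / (k - j)`!%:R.
Proof.
move=> s0 yy vd.
have ge := prod_dist_ge s0 yy.
pose I i := index_iota 0 i ++ index_iota i.+1 k.+1.
have II i l : (i <= k)%N -> (l \in I i) = (l <= k)%N && (l != i).
  by move=> ik; rewrite mem_cat !mem_index_iota; apply/idP/idP; lia.
pose D i := \prod_(l <- I i) (y i - y l).
have D0 i : (i <= k)%N -> D i != 0.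
  move=> ik; rewrite -normr_gt0; apply: lt_le_trans (ge i ik).
  by rewrite mulr_gt0 ?exprn_gt0// ltr0n muln_gt0 !fact_gt0.
exists (\sum_(i < k.+1) (v i / D i) *: \prod_(l <- I i) ('X - (y l)%:P)); split.
  move=> i ik; rewrite horner_sum (bigD1 (inord i : 'I_k.+1))//= inordK//.
  rewrite [X in _ + X]big1 ?addr0; last first.
    move=> m mi; rewrite hornerZ horner_prod.
    rewrite (big_rem i)/= ?hornerXsubC ?subrr ?mul0r ?mulr0//.
    rewrite II ?leq_ord// ik/=; apply: contra mi => /eqP ->.
    by apply/eqP/val_inj; rewrite /= inordK.
  rewrite hornerZ horner_prod (_ : \prod_(_ <- _) _ = D i); last first.
    by apply: eq_bigr => l _; rewrite hornerXsubC.
  by rewrite divfK// D0.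
move=> j x L jk L0 xL.
rewrite linear_sum/= horner_sum (le_trans (ler_norm_sum _ _ _))//.
apply: (@le_trans _ _ (\sum_(i < k.+1) (dl / (s ^+ k * (i`! * (k - i)`!)%:R)) *
    ((k ^_ j)%:R * L ^+ (k - j)))).
  apply: ler_sum => -[i ik] _ /=; rewrite ltnS in ik.
  rewrite linearZ hornerZ normrM; apply: ler_pM => //.
    rewrite normrM normfV; apply: ler_pM => //; first exact: vd.
    rewrite lef_pV2 ?posrE ?normr_gt0 ?D0//; first exact: ge.
    by rewrite mulr_gt0 ?exprn_gt0// ltr0n muln_gt0 !fact_gt0.
  have -> : \prod_(l <- I i) ('X - (y l)%:P) = \prod_(a <- map y (I i)) ('X - a%:P).
    by rewrite big_map.
  have sz : size (map y (I i)) = k by rewrite size_map size_cat !size_iota; lia.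
  rewrite -[in leRHS]sz; apply: derivn_prod_XsubC_le => // a /mapP[l].
  by rewrite II// => /andP[lk _] ->; exact: xL.
rewrite -mulr_suml -mulrA; under eq_bigr do rewrite invfM mulrA.
rewrite -mulr_sumr.
have -> : \sum_(i < k.+1) (((i`! * (k - i)`!)%:R : R)^-1) = 2 ^+ k / k`!%:R.
  rewrite -natrX; have := expnDn 1 1 k; rewrite addn1 => ->.
  rewrite natr_sum mulr_suml; apply: eq_bigr => -[i ik] _ /=; rewrite ltnS in ik.
  rewrite !exp1n !muln1 -(bin_fact ik) [('C(k, i) * _)%:R]natrM [in RHS]invfM mulrA.
  rewrite divff ?mul1r//.
  by rewrite pnatr_eq0 -lt0n bin_gt0.
rewrite -(ffact_fact jk) natrM.
have f0 m : (m`!%:R : R) != 0 by rewrite pnatr_eq0 -lt0n fact_gt0.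
have g0 : ((k ^_ j)%:R : R) != 0 by rewrite pnatr_eq0 -lt0n ffact_gt0.
have sk : s ^+ k != 0 by rewrite expf_neq0// gt_eqF.
rewrite expr_div_n le_eqVlt; apply/orP; left; apply/eqP; field.
by rewrite sk f0 g0.
Qed.

(** * Separated points in a set of given measure *)

Lemma lebesgue_measure_itvcc {R : realType} (a b : R) : a <= b ->
  (@lebesgue_measure R) `[a, b] = (b - a)%:E.
Proof.
rewrite lebesgue_measure_itv/= lte_fin le_eqVlt => /predU1P[->|->//].
by rewrite ltxx subrr.
Qed.

Lemma lebesgue_measure_subset_itv {R : realType} (E : set R) (al be : R) :
  measurable (E : set (measurableTypeR R)) -> E `<=` `[al, be] -> al <= be ->
  (@lebesgue_measure R E <= (be - al)%:E)%E.
Proof.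
move=> mE Eab ab; rewrite -lebesgue_measure_itvcc//.
by apply: le_measure; rewrite ?inE//; exact: measurable_itv.
Qed.

Lemma separated_points {R : realType} (k : nat) (E : set R) (al be s : R) :
  measurable (E : set (measurableTypeR R)) -> E `<=` `[al, be] -> 0 <= s ->
  ((k%:R * s)%:E < (@lebesgue_measure R) E)%E ->
  exists y : nat -> R, (forall i, (i <= k)%N -> E (y i)) /\
    forall i, (i < k)%N -> y i + s <= y i.+1.
Proof.
elim: k E => [|k IH] E mE Eab s0 kE.
  have /set0P[x Ex] : E != set0.
    by apply/eqP => E0; move: kE; rewrite E0 measure0 mul0r ltxx.
  by exists (fun=> x).
have /set0P E0 : E != set0.
  apply/eqP => E0; move: kE; rewrite E0 measure0 lte_fin ltNge.
  by rewrite mulr_ge0.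
have infE : has_inf E.
  by split => //; exists al => x /Eab; rewrite /= in_itv/= => /andP[].
have [x Ex] := E0; have := Eab _ Ex; rewrite /= in_itv/= => /andP[x1 x2].
have Efin := lebesgue_measure_subset_itv mE Eab (le_trans x1 x2).
have /fineK mEE : lebesgue_measure E \is a fin_num.
  by rewrite ge0_fin_numE// (le_lt_trans Efin)// ltry.
set m := fine _ in mEE; rewrite -mEE lte_fin in kE.
(* [eta] is the spare measure: cutting off [[inf E, y0 + s]] costs less than [s + eta], so the rest
   still has measure above [k * s] and the induction hypothesis applies to it. *)
pose eta := m - k.+1%:R * s; have eta0 : 0 < eta by rewrite subr_gt0.
have [y0 Ey0 y0E] := inf_adherent eta0 infE.
pose I : set R := [set` `[inf E, y0 + s]]; pose E' := E `&` [set` `[y0 + s, be]].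
have mE' : measurable (E' : set (measurableTypeR R)).
  by apply: measurableI => //; exact: measurable_itv.
have EE' : E `<=` I `|` E'.
  move=> t Et; have [ts|ts] := leP (y0 + s) t.
    by right; split => //=; have := Eab _ Et; rewrite /= !in_itv/= ts => /andP[].
  left; rewrite /I /= in_itv/= (ltW ts) andbT; apply: ge_inf => //; exact: infE.2.
have inf0 : inf E <= y0 by apply: ge_inf => //; exact: infE.2.
have kE' : ((k%:R * s)%:E < lebesgue_measure E')%E.
  rewrite ltNge; apply/negP => le'.
  suff : (lebesgue_measure E < m%:E)%E by rewrite -mEE ltxx.
  apply: (@le_lt_trans _ _ (lebesgue_measure (I `|` E'))).
    by apply: le_measure; rewrite ?inE//; apply: measurableU => //; exact: measurable_itv.
  apply: (le_lt_trans (measureU2 _ _ _)) => //; first exact: measurable_itv.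
  apply: (@le_lt_trans _ _ ((y0 + s - inf E)%:E + (k%:R * s)%:E)%E).
    apply: leeD => //.
    by have -> : (y0 + s - inf E)%:E = lebesgue_measure I by rewrite lebesgue_measure_itvcc//; lra.
  by rewrite -EFinD lte_fin; move: y0E; rewrite /eta -natr1; lra.
have [|y [Ey yy]] := IH _ mE' _ s0 kE'; first by move=> t [/Eab].
exists (fun i => if i is i'.+1 then y i' else y0); split.
  by case=> // i ik; have [] := Ey i ik.
case=> [_|i ik]; last exact: yy.
by have [_] := Ey 0%N isT; rewrite /= in_itv/= => /andP[].
Qed.

Lemma exp_ge_monomial {R : realType} (x : R) m : 0 <= x ->
  x ^+ m / m`!%:R <= 4 ^+ m * expR (x / 4).
Proof.
move=> x0; have x4 : 0 <= x / 4 by rewrite divr_ge0.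
rewrite -{1}(divfK (_ : 4 != 0) x)// exprMn mulrAC mulrC ler_pM2l ?exprn_gt0//.
case: m => [|m]; first by rewrite expr0 fact0 divr1 expR_ge1.
by apply: le_trans (expR_ge1Dxn m x4); rewrite lerDr.
Qed.

(** * Bang's theorem from values at nodes *)

Section nodes.
Variables (R : realType) (h : nat -> R -> R) (w y : nat -> R) (M0 al be : R).
Variables (k j0 : nat).
Hypothesis M0_gt0 : 0 < M0.
Hypothesis w_gt0 : forall j, (1 <= j <= k.+1)%N -> 0 < w j.
Hypothesis w_le : forall i j, (1 <= i)%N -> (i <= j <= k.+1)%N -> w i <= w j.
Hypothesis dh : forall j t, (j < k.+1)%N -> al <= t <= be ->
  is_derive t 1 (h j) (h j.+1 t).
Hypothesis hM : forall j t, (j <= k.+1)%N -> al <= t <= be ->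
  `|h j t| <= weightM w M0 j.
Hypothesis j0k : (j0 <= k.+1)%N.
Hypothesis y_itv : forall i, (i <= k)%N -> al <= y i <= be.
Hypothesis len : be - al <= \sum_(j0.+1 <= i < k.+2) (expR 1 * w i)^-1.

(** Let [P] interpolate [h] at the nodes. Rolle's theorem is applied to [h - P], but Bang's theorem
    to [h] itself: at the points [z j] the derivatives of [h] and [P] agree, and the bound for those
    of [P] is within the tolerance that [bang] allows. *)
Lemma bang_nodes (dl s : R) : 0 < s ->
  (forall i, (i < k)%N -> y i + s <= y i.+1) ->
  (forall i, (i <= k)%N -> `|h 0%N (y i)| <= dl) ->
  (forall j, (j <= k)%N ->
    dl * (2 / s) ^+ k * (be - al) ^+ (k - j) / (k - j)`!%:R
      <= expR (j%:R - k.+1%:R) * weightM w M0 j) ->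
  `|h 0%N al| <= expR (- j0%:R) * M0.
Proof.
move=> s0 yy hd dlM.
have ab : al <= be by have /andP[] := y_itv (leq0n k); exact: le_trans.
have [P [Py PM]] := lagrange_interpolation (v := fun i => h 0%N (y i)) s0 yy hd.
pose r j t := h j t - P^`(j).[t].
have [||||z [zy zz]] := @rolle_chain R k.+1 r y al be.
- by [].
- move=> j t jk tab; rewrite /r derivnS.
  have d1 := dh (ltnW jk) tab; have d2 := is_derive_horner P^`(j) t.
  exact: is_deriveB.
- by move=> i ik; have := yy i ik; lra.
- by move=> i ik; split; [exact: y_itv|rewrite /r derivn0 Py// subrr].
have /andP[y0a _] := y_itv (leq0n k).
have zab j : (j < k.+1)%N -> al <= z j <= be.
  by move=> jk; have [/andP[z1 z2] _] := zy j jk; lra.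
apply: (bang (z := z) (p := k.+1) M0_gt0 w_gt0 w_le dh hM) => // j jk.
have [/andP[z1 z2] /eqP] := zy j jk; rewrite subr_eq0 => /eqP ->.
apply: le_trans (dlM _ jk); apply: PM => //; first by rewrite subr_ge0.
move=> i ik; have := y_itv ik; have := zab j jk.
by rewrite ler_norml => /andP[? ?] /andP[? ?]; lra.
Qed.

(** The same with [P = 0]: here the [z j] are zeros of the derivatives of [h], and any tolerance is
    met. *)
Lemma bang_zeros :
  (forall i, (i < k)%N -> y i < y i.+1) ->
  (forall i, (i <= k)%N -> h 0%N (y i) = 0) ->
  `|h 0%N al| <= expR (- j0%:R) * M0.
Proof.
move=> yy h0.
have ab : al <= be by have /andP[] := y_itv (leq0n k); exact: le_trans.
have [||||z [zy zz]] := @rolle_chain R k.+1 h y al be.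
- by [].
- by move=> j t jk tab; exact: dh (ltnW jk) tab.
- exact: yy.
- by move=> i ik; split; [exact: y_itv|exact: h0].
have /andP[y0a _] := y_itv (leq0n k).
apply: (bang (z := z) (p := k.+1) M0_gt0 w_gt0 w_le dh hM) => // j jk.
- by have [/andP[z1 z2] _] := zy j jk; lra.
- have [_ ->] := zy j jk; rewrite normr0 mulr_ge0 ?expR_ge0 ?ltW//.
  by apply: (@weightM_gt0 _ w M0 k.+1) => //; exact: ltnW.
Qed.

End nodes.

(** * Numerical form of the smallness condition *)

Lemma powR_invnK {R : realType} (x : R) n : (0 < n)%N -> 0 <= x ->
  (x `^ (n%:R^-1)) ^+ n = x.
Proof.
move=> n0 x0; rewrite -powR_mulrn ?powR_ge0// -powRrM mulVf ?powRr1//.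
by rewrite pnatr_eq0 -lt0n.
Qed.

Lemma weightM_cst {R : realType} (tau M0 : R) j :
  weightM (fun=> tau) M0 j = M0 * tau ^+ j.
Proof. by rewrite /weightM prodr_const_nat subn1. Qed.

Lemma weightM_le {R : realType} (w w' : nat -> R) (M0 : R) j : 0 <= M0 ->
  (forall i, (1 <= i <= j)%N -> 0 <= w i <= w' i) ->
  weightM w M0 j <= weightM w' M0 j.
Proof.
move=> M0_ge0 ww'; rewrite /weightM ler_wpM2l// big_nat [leRHS]big_nat.
by apply: ler_prod => i ij; exact: ww'.
Qed.

(* Both sides have order [k - j] in [L]; the factorial is absorbed by
   [x ^ m / m! <= 4 ^ m * exp (x / 4)] at [x = 2 k]. *)
Lemma node_bound {R : realType} (dl th L : R) (k N j : nat) : 0 <= dl ->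
  0 < th <= 1 -> 0 < L -> (0 < k <= N)%N -> (j <= k)%N ->
  dl * (2 / (th * L / k%:R)) ^+ k * L ^+ (k - j) / (k - j)`!%:R <=
  dl / th ^+ N * (2 * k%:R / L) ^+ j * (4 ^+ (k - j) * expR (k%:R / 2)).
Proof.
move=> dl0 /andP[th0 th1] L0 /andP[k0 kN] jk.
have kR : 0 < k%:R :> R by rewrite ltr0n.
have f0 : ((k - j)`!%:R : R) != 0 by rewrite pnatr_eq0 -lt0n fact_gt0.
have -> : dl * (2 / (th * L / k%:R)) ^+ k * L ^+ (k - j) / (k - j)`!%:R =
    dl / th ^+ k * (2 * k%:R / L) ^+ j * ((2 * k%:R) ^+ (k - j) / (k - j)`!%:R).
  have -> : 2 / (th * L / k%:R) = (2 * k%:R / L) / th by field; rewrite !gt_eqF.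
  rewrite [(_ / th) ^+ k]expr_div_n.
  have -> : (2 * k%:R / L) ^+ k =
      (2 * k%:R / L) ^+ j * ((2 * k%:R) ^+ (k - j) / L ^+ (k - j)).
    by rewrite -expr_div_n -exprD subnKC.
  by field; rewrite f0 !expf_neq0 ?gt_eqF.
have h1 : (2 * k%:R) ^+ (k - j) / (k - j)`!%:R <= 4 ^+ (k - j) * expR (k%:R / 2) :> R.
  have -> : k%:R / 2 = (2 * k%:R) / 4 :> R by field.
  by apply: exp_ge_monomial; rewrite mulr_ge0.
apply: ler_pM => //.
- by rewrite !mulr_ge0 ?invr_ge0 ?exprn_ge0 ?divr_ge0 ?mulr_ge0 ?(ltW L0) ?(ltW th0).
- apply: ler_wpM2r; first by rewrite exprn_ge0// divr_ge0 ?mulr_ge0 ?(ltW L0).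
  rewrite ler_wpM2l// lef_pV2 ?posrE ?exprn_gt0//.
  by rewrite ler_wiXn2l// ltW.
Qed.

Lemma expr4_le {R : realFieldType} (k j N : nat) : (j <= k <= N)%N ->
  4 ^+ (k - j) / 4 ^+ N <= (4 ^+ j)^-1 :> R.
Proof.
move=> /andP[jk kN]; rewrite ler_pdivrMr ?exprn_gt0// mulrC ler_pdivlMr ?exprn_gt0//.
by rewrite -exprD subnK// ler_weXn2l// ler1n.
Qed.

(** The smallness condition of [bang_nodes] for the constant weight [N / (2 e L)]. The powers of 2
    from [2 * k] and from the weight make up [4 ^ j], which [4 ^ N] absorbs together with
    [4 ^ (k - j)]; and [k / 2 - 2 N <= - N]. *)
Lemma exp_bound_cst {R : realType} (M0 L gam : R) (k j N : nat) :
  (0 < N)%N -> 0 < M0 -> 0 < L -> 0 <= gam -> (j <= k <= N)%N ->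
  M0 / (4 ^+ N * expR ((2 + gam) * N%:R)) * (2 * k%:R / L) ^+ j *
    (4 ^+ (k - j) * expR (k%:R / 2)) <=
  expR (j%:R - N%:R) * (M0 * (N%:R / (2 * expR 1 * L)) ^+ j).
Proof.
move=> N0 M00 L0 g0 /andP[jk kN]; have E0 := @expR_gt0 R 1.
have kN' : k%:R <= N%:R :> R by rewrite ler_nat.
have -> : N%:R / (2 * expR 1 * L) = (N%:R / L) / (2 * expR 1).
  by field; rewrite !gt_eqF.
have -> : 2 * k%:R / L = 2 * (k%:R / L) by rewrite mulrA.
rewrite [(_ / (2 * expR 1)) ^+ j]expr_div_n [(2 * (k%:R / L)) ^+ j]exprMn.
rewrite [(2 * expR 1) ^+ j]exprMn -expRM_natl mulr1 expRD.
have -> : expR j%:R * expR (- N%:R) * (M0 * ((N%:R / L) ^+ j / (2 ^+ j * expR j%:R))) =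
    M0 * ((N%:R / L) ^+ j * (2 ^+ j)^-1 * expR (- N%:R)).
  by field; rewrite !gt_eqF ?expR_gt0 ?exprn_gt0.
have -> : M0 / (4 ^+ N * expR ((2 + gam) * N%:R)) * (2 ^+ j * (k%:R / L) ^+ j) *
    (4 ^+ (k - j) * expR (k%:R / 2)) =
    M0 * ((k%:R / L) ^+ j * (2 ^+ j * (4 ^+ (k - j) / 4 ^+ N)) *
     expR (k%:R / 2 - (2 + gam) * N%:R)).
  by rewrite expRB; field; rewrite !gt_eqF ?expR_gt0 ?exprn_gt0.
have kL : 0 <= k%:R / L by rewrite divr_ge0// ltW.
rewrite ler_pM2l//; apply: ler_pM; rewrite ?mulr_ge0 ?expR_ge0 ?invr_ge0 ?exprn_ge0//.
- apply: ler_pM; rewrite ?mulr_ge0 ?invr_ge0 ?exprn_ge0//.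
    by apply: lerXn2r; rewrite ?nnegrE ?divr_ge0 ?(ltW L0)// ler_pM2r ?invr_gt0.
  have h4 : 4 ^+ (k - j) / 4 ^+ N <= (4 ^+ j)^-1 :> R by rewrite expr4_le ?jk.
  rewrite -ler_pdivlMl ?exprn_gt0//; apply: (le_trans h4).
  by rewrite -invfM -exprMn (_ : 2 * 2 = 4) -?natrM.
- rewrite ler_expR; have : 0 <= gam * N%:R by rewrite mulr_ge0.
  have : 0 <= N%:R :> R by []. lra.
Qed.

(** The smallness condition for [n + 1] nodes. The factor [expR (- (gam * N))] on the right is the
    loss in [weightM_growth]; it is paid for by [gam] in the denominator on the left. *)
Lemma exp_bound_growth {R : realType} (M0 L gam : R) (n j : nat) :
  0 < M0 -> 0 < L -> 0 <= gam -> (0 < n)%N -> (j <= n)%N ->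
  M0 / (4 ^+ (2 * n) * expR ((2 + gam) * (2 * n)%:R)) * (2 * n%:R / L) ^+ j *
    (4 ^+ (n - j) * expR (n%:R / 2)) <=
  expR (j%:R - n.+1%:R) *
    (M0 * ((2 * n)%:R / (2 * expR 1 * L)) ^+ j * expR (- (gam * (2 * n)%:R))).
Proof.
move=> M00 L0 g0 n0 jn; have E0 := @expR_gt0 R 1.
have -> : (2 * n)%:R / (2 * expR 1 * L) = (2 * n%:R / L) / (2 * expR 1).
  by rewrite natrM; field; rewrite !gt_eqF.
rewrite [(_ / (2 * expR 1)) ^+ j]expr_div_n [(2 * expR 1) ^+ j]exprMn.
rewrite -expRM_natl mulr1 expRB.
set X := (2 * n%:R / L) ^+ j; have X0 : 0 <= X.
  by rewrite exprn_ge0// divr_ge0 ?mulr_ge0// ltW.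
have -> : expR j%:R / expR n.+1%:R * (M0 * (X / (2 ^+ j * expR j%:R)) *
    expR (- (gam * (2 * n)%:R))) =
    M0 * X * ((2 ^+ j)^-1 * expR (- n.+1%:R - gam * (2 * n)%:R)).
  by rewrite expRB !expRN; field; rewrite !gt_eqF ?expR_gt0 ?exprn_gt0.
have -> : M0 / (4 ^+ (2 * n) * expR ((2 + gam) * (2 * n)%:R)) * X *
    (4 ^+ (n - j) * expR (n%:R / 2)) =
    M0 * X * ((4 ^+ (n - j) / 4 ^+ (2 * n)) * expR (n%:R / 2 - (2 + gam) * (2 * n)%:R)).
  by rewrite expRB; field; rewrite !gt_eqF ?expR_gt0 ?exprn_gt0.
apply: ler_wpM2l; first by rewrite mulr_ge0// ltW.
apply: ler_pM; rewrite ?expR_ge0 ?divr_ge0 ?exprn_ge0//.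
- have h4 : 4 ^+ (n - j) / 4 ^+ (2 * n) <= (4 ^+ j)^-1 :> R by apply: expr4_le; lia.
  apply: (le_trans h4).
  by rewrite lef_pV2 ?posrE ?exprn_gt0// lerXn2r ?nnegrE// ler_nat.
- have n1 : 1 <= n%:R :> R by rewrite ler1n.
  rewrite ler_expR natrM -[n.+1%:R]natr1.
  have : 0 <= gam * n%:R by rewrite mulr_ge0. lra.
Qed.

(* [prod_(i <= j) (i / N) = j! / N ^ j >= exp (- N)]. *)
Lemma weightM_growth {R : realType} (tau M0 gam : R) (j N : nat) :
  (0 < N)%N -> 0 < M0 -> 0 < tau -> 0 <= gam ->
  M0 * tau ^+ j * expR (- (gam * N%:R)) <=
  weightM (fun i => tau * (i%:R / N%:R) `^ gam) M0 j.
Proof.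
move=> N0 M00 t0 g0; have NR : 0 < N%:R :> R by rewrite ltr0n.
have -> : weightM (fun i => tau * (i%:R / N%:R) `^ gam) M0 j =
    M0 * tau ^+ j * (j`!%:R / N%:R ^+ j) `^ gam.
  elim: j => [|j IH].
    by rewrite /weightM big_geq// expr0 fact0 divr1 powR1 !mulr1.
  rewrite weightMS IH exprSr factS natrM exprSr.
  have -> : j.+1%:R * j`!%:R / (N%:R ^+ j * N%:R) =
      (j`!%:R / N%:R ^+ j) * (j.+1%:R / N%:R) :> R.
    by field; rewrite !gt_eqF ?exprn_gt0.
  by rewrite [(_ / _ * _) `^ gam]powRM ?divr_ge0 ?exprn_ge0//; ring.
rewrite ler_wpM2l ?mulr_ge0 ?exprn_ge0 ?(ltW M00) ?(ltW t0)//.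
have -> : expR (- (gam * N%:R)) = (expR (- N%:R)) `^ gam by rewrite -expRM; congr expR; ring.
rewrite ge0_ler_powR ?nnegrE ?expR_ge0 ?divr_ge0 ?exprn_ge0//.
rewrite expRN -[leRHS]invrK invf_div lef_pV2 ?posrE ?expR_gt0//; last first.
  by rewrite divr_gt0 ?exprn_gt0// ltr0n fact_gt0.
case: j => [|j]; first by rewrite expr0 fact0 divr1 expR_ge1.
by apply: le_trans (expR_ge1Dxn j (ltW NR)); rewrite lerDr.
Qed.

Ltac nlia :=
  repeat match goal with
  | H : is_true (leq _ _) |- _ => revert H
  | H : is_true (leq _ _ && leq _ _) |- _ => revert H
  | H : @eq nat _ _ |- _ => revert H
  end; clear; lia.

(* [E] behaves like a set of measure at least [m]; unlike the measure itself,
   the property is obviously invariant under [t |-> - t]. *)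
Definition spread {R : realType} (E : set R) (m : R) :=
  forall k s, 0 <= s -> k%:R * s < m ->
  exists y : nat -> R, (forall i, (i <= k)%N -> E (y i)) /\
    forall i, (i < k)%N -> y i + s <= y i.+1.

(** * Sublevel sets *)

Section remez.
Variables (R : realType) (h : nat -> R -> R) (w : nat -> R) (M0 al be : R).
Variables (n j0 : nat) (gam dl : R).
Local Notation N := (2 * n)%N.
Hypothesis n_gt0 : (0 < n)%N.
Hypothesis M0_gt0 : 0 < M0.
Hypothesis w_gt0 : forall j, (1 <= j <= N)%N -> 0 < w j.
Hypothesis w_le : forall i j, (1 <= i)%N -> (i <= j <= N)%N -> w i <= w j.
Hypothesis dh : forall j t, (j < N)%N -> al <= t <= be ->
  is_derive t 1 (h j) (h j.+1 t).
Hypothesis hM : forall j t, (j <= N)%N -> al <= t <= be ->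
  `|h j t| <= weightM w M0 j.
Hypothesis j0n : (j0 <= n)%N.
Hypothesis ab : al < be.
Hypothesis len : be - al <= \sum_(j0.+1 <= i < n.+2) (expR 1 * w i)^-1.
Hypothesis gam_ge0 : 0 <= gam.
Hypothesis w_growth : forall i, (1 <= i <= N)%N ->
  w N * (i%:R / N%:R) `^ gam <= w i.
Hypothesis dl_gt0 : 0 < dl.
Hypothesis h_al : expR (- j0%:R) * M0 < `|h 0%N al|.

(** In [theta ^ N] the factor [4 ^ N] absorbs the powers of 2 and 4 due to interpolation,
    [exp (2 N)] both the [exp (k / 2)] of [node_bound] and the [exp (- p)] of Bang's tolerance, and
    [exp (gam N)] the loss in [weightM_growth]. *)
Let theta := 4 * expR (2 + gam) * (dl / M0) `^ (N%:R^-1).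

Let N_gt0 : (0 < N)%N. Proof. by nlia. Qed.

Let theta_gt0 : 0 < theta.
Proof. by rewrite !mulr_gt0 ?expR_gt0 ?powR_gt0 ?divr_gt0. Qed.

Let thetaN : dl / theta ^+ N = M0 / (4 ^+ N * expR ((2 + gam) * N%:R)).
Proof.
rewrite !exprMn powR_invnK// ?divr_ge0 ?(ltW dl_gt0) ?(ltW M0_gt0)//.
rewrite -expRM_natr; field.
by rewrite !gt_eqF ?expR_gt0 ?exprn_gt0.
Qed.

(** Otherwise [E] contains, for each [k > 0], [k + 1] points with gaps [theta * L / k]. As
    [|h| <= dl] at these points, [bang_nodes] makes [|h|] at [al] at most [expR (- j0) * M0],
    against [h_al]. *)
Lemma remez_right (E : set R) (m : R) :
  E `<=` `[al, be] -> m <= be - al -> spread E m ->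
  (forall t, E t -> `|h 0%N t| <= dl) ->
  m <= theta * (be - al).
Proof.
move=> Eab mab mE Edl; rewrite leNgt; apply/negP => Eth.
have L0 : 0 < be - al by rewrite subr_gt0.
set L := be - al in Eth mab L0 *.
have th1 : theta < 1.
  rewrite ltNge; apply/negP => th1.
  by have := lt_le_trans Eth mab; rewrite ltNge ler_peMl// ltW.
have th01 : 0 < theta <= 1 by rewrite theta_gt0 ltW.
have NR : 0 < N%:R :> R by rewrite ltr0n.
have nR : 0 < n%:R :> R by rewrite ltr0n.
have nz := (gt_eqF nR, gt_eqF L0, gt_eqF (@expR_gt0 R 1)).
(* The constant for which [n] terms [1 / (e tau)] add up to exactly [L]; since [j0 <= n], Bang's sum
   over [j0 < i <= N] has at least [n] terms. *)
pose tau : R := N%:R / (2 * expR 1 * L).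
have tau0 : 0 < tau by rewrite divr_gt0// mulr_gt0// mulr_gt0// expR_gt0.
have nodes k : (0 < k)%N -> exists y : nat -> R,
    [/\ 0 < theta * L / k%:R, (forall i, (i < k)%N -> y i + theta * L / k%:R <= y i.+1),
      (forall i, (i <= k)%N -> `|h 0%N (y i)| <= dl) &
      (forall i, (i <= k)%N -> al <= y i <= be)].
  move=> k0; have kR : 0 < k%:R :> R by rewrite ltr0n.
  have s0 : 0 < theta * L / k%:R by rewrite divr_gt0// mulr_gt0.
  have [|y [Ey yy]] := mE k _ (ltW s0); first by rewrite mulrC divfK ?gt_eqF.
  exists y; split => // i ik; first exact: Edl (Ey i ik).
  by have := Eab _ (Ey i ik); rewrite /= in_itv.
(* If [w N <= tau], all weights may be replaced by the constant [tau], for which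
   [N] nodes are needed; otherwise [w_growth] bounds the weights from below and
   [n + 1] nodes suffice. *)
have [wtau|tauw] := leP (w N) tau.
- have [k kE] : exists k, N = k.+1 by exists N.-1; exact/esym/prednK.
  have k0 : (0 < k)%N by nlia.
  have [y [s0 yy ydl yab]] := nodes k k0.
  have kN : (0 < k <= N)%N by rewrite k0 kE leqnSn.
  have {th1} : `|h 0%N al| <= expR (- j0%:R) * M0.
    apply: (@bang_nodes R h (fun=> tau) y M0 al be k j0 M0_gt0 _ _ _ _ _ yab _
      dl (theta * L / k%:R) s0 yy ydl) => //.
    + by move=> j t jk; apply: dh; rewrite kE.
    + move=> j t jk tab; rewrite -kE in jk; apply: (le_trans (hM jk tab)).
      apply: weightM_le => [|i /andP[i1 ij]]; first exact: ltW.
      have iN : (i <= N)%N by exact: leq_trans jk.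
      rewrite (ltW (w_gt0 _)) ?i1//= (le_trans _ wtau)// w_le//.
      by rewrite iN leqnn.
    + nlia.
    + rewrite -/L sumr_const_nat -kE.
      have -> : (expR 1 * tau)^-1 = 2 * L / N%:R.
        by rewrite /tau; field; rewrite !nz.
      rewrite -[leRHS]mulr_natl -ler_pdivrMr ?divr_gt0 ?mulr_gt0//.
      have -> : L / (2 * L / N%:R) = n%:R by rewrite natrM; field; rewrite !nz.
      rewrite ler_nat; nlia.
    + move=> j jk; apply: (le_trans (node_bound (ltW dl_gt0) th01 L0 kN jk)).
      rewrite thetaN weightM_cst -kE; apply: (exp_bound_cst N_gt0) => //; nlia.
  by rewrite leNgt h_al.
- have nN : (0 < n <= N)%N by nlia.
  have [y [s0 yy ydl yab]] := nodes n n_gt0.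
  have {th1} : `|h 0%N al| <= expR (- j0%:R) * M0.
    apply: (@bang_nodes R h w y M0 al be n j0 M0_gt0 _ _ _ _ _ yab _
      dl (theta * L / n%:R) s0 yy ydl) => //.
    + by move=> j jn; apply: w_gt0; nlia.
    + by move=> i j i1 ij; apply: w_le => //; nlia.
    + by move=> j t jk; apply: dh; nlia.
    + by move=> j t jk; apply: hM; nlia.
    + nlia.
    + move=> j jk; apply: (le_trans (node_bound (ltW dl_gt0) th01 L0 nN jk)).
      rewrite thetaN.
      apply: le_trans (exp_bound_growth M0_gt0 L0 gam_ge0 n_gt0 jk) _.
      rewrite ler_wpM2l ?expR_ge0//.
      apply: (@le_trans _ _ (weightM (fun i => tau * (i%:R / N%:R) `^ gam) M0 j)).
        exact: weightM_growth.
      apply: weightM_le => [|i /andP[i1 ij]]; first exact: ltW.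
      rewrite mulr_ge0 ?(ltW tau0) ?powR_ge0//=.
      apply: le_trans (w_growth _); last by nlia.
      by rewrite ler_wpM2r ?powR_ge0// ltW.
  by rewrite leNgt h_al.
Qed.

End remez.

(** Otherwise [n + 1] distinct elements of [Z] can be picked one after the other, and sorting them
    gives a chain. *)
Lemma finite_of_no_chain {R : realDomainType} (Z : set R) (n : nat) :
  ~ (exists y : nat -> R, (forall i, (i <= n)%N -> Z (y i)) /\
      forall i, (i < n)%N -> y i < y i.+1) ->
  exists s : seq R, (size s <= n)%N /\ forall t, Z t -> t \in s.
Proof.
move=> noy; apply: contrapT => nos; apply: noy.
have [s [us ss sZ]] : exists s : seq R,
    [/\ uniq s, size s = n.+1 & forall t, t \in s -> Z t].
  have: (n.+1 <= n.+1)%N by [].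
  elim: {1 3}n.+1 => [|k IH] kn; first by exists [::].
  have [s [us ss sZ]] := IH (ltnW kn).
  have [t Zt ts] : exists2 t, Z t & t \notin s.
    apply: contrapT => no; apply: nos; exists s; split; first by rewrite ss.
    by move=> t Zt; apply: contrapT => /negP ts; apply: no; exists t.
  exists (t :: s); rewrite /= ts us ss; split=> // u; rewrite inE => /predU1P[->//|].
  exact: sZ.
exists (nth 0 (sort <=%O s)); split=> i ni.
  by apply: sZ; rewrite -(mem_sort <=%O) mem_nth// size_sort ss.
have : sorted <%O (sort <=%O s) by rewrite sort_lt_sorted.
by move=> /(sortedP 0); apply; rewrite size_sort ss.
Qed.

(** Reflection carries the estimates at a left endpoint over to right endpoints; the sign keeps the
    family closed under differentiation. *)
Lemma is_derive_mirror {R : realType} (h : nat -> R -> R) j (t : R) :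
  is_derive (- t) 1 (h j) (h j.+1 (- t)) ->
  is_derive t 1 (fun t => (-1) ^+ j * h j (- t)) ((-1) ^+ j.+1 * h j.+1 (- t)).
Proof.
move=> dh; rewrite exprSr -mulrA mulN1r; apply: is_deriveZ.
by rewrite -[X in is_derive _ _ _ X]mulrN1; apply: is_derive1_comp.
Qed.

Section line.
Variables (R : realType) (h : nat -> R -> R) (w : nat -> R) (M0 c d : R).
Variables (n j0 : nat).
Local Notation N := (2 * n)%N.
Hypothesis n_gt0 : (0 < n)%N.
Hypothesis M0_gt0 : 0 < M0.
Hypothesis w_gt0 : forall j, (1 <= j <= N)%N -> 0 < w j.
Hypothesis w_le : forall i j, (1 <= i)%N -> (i <= j <= N)%N -> w i <= w j.
Hypothesis dh : forall j t, (j < N)%N -> c <= t <= d ->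
  is_derive t 1 (h j) (h j.+1 t).
Hypothesis hM : forall j t, (j <= N)%N -> c <= t <= d ->
  `|h j t| <= weightM w M0 j.
Hypothesis j0n : (j0 <= n)%N.
Hypothesis len : d - c <= \sum_(j0.+1 <= i < n.+2) (expR 1 * w i)^-1.
Variable x : R.
Hypothesis x_cd : c <= x <= d.

Let hN j t := (-1) ^+ j * h j (- t).

Let hN_norm j t : `|hN j t| = `|h j (- t)|.
Proof. by rewrite /hN normrM normrX normrN1 expr1n mul1r. Qed.

Let dhN j t : (j < N)%N -> - d <= t <= - c -> is_derive t 1 (hN j) (hN j.+1 t).
Proof. by move=> jN tcd; apply: is_derive_mirror; apply: dh => //; lra. Qed.

(** The line is cut at [x]: [remez_right] applies to [[x, d]] and, after reflection, to [[c, x]].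
    Both bounds are linear in the length with the same factor, so they add up. *)
Lemma remez_line (gam dl : R) (E : set R) : 0 <= gam -> 0 < dl ->
  (forall i, (1 <= i <= N)%N -> w N * (i%:R / N%:R) `^ gam <= w i) ->
  expR (- j0%:R) * M0 < `|h 0%N x| ->
  measurable (E : set (measurableTypeR R)) -> E `<=` `[c, d] ->
  (forall t, E t -> `|h 0%N t| <= dl) ->
  (lebesgue_measure E <=
    (4 * expR (2 + gam) * (dl / M0) `^ (N%:R^-1) * (d - c))%:E)%E.
Proof.
move=> g0 dl0 wg hx mE Ecd Edl.
have /andP[cx xd] := x_cd.
set th := 4 * _ * _.
have part a b : a <= b -> c <= a -> b <= d ->
    (forall m, m <= b - a -> spread (E `&` `[a, b]) m -> a < b -> m <= th * (b - a)) ->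
    (lebesgue_measure (E `&` `[a, b]) <= (th * (b - a))%:E)%E.
  move=> ab ca bd H.
  have mEab : measurable ((E `&` `[a, b]) : set (measurableTypeR R)).
    by apply: measurableI => //; exact: measurable_itv.
  have sub : E `&` `[a, b] `<=` `[a, b] by move=> t [].
  have le1 := lebesgue_measure_subset_itv mEab sub ab.
  have /fineK mEE : lebesgue_measure (E `&` `[a, b]) \is a fin_num.
    by rewrite ge0_fin_numE// (le_lt_trans le1)// ltry.
  have sp : spread (E `&` `[a, b]) (fine (lebesgue_measure (E `&` `[a, b]))).
    move=> k s s0 ks; apply: (@separated_points R k _ a b) => //.
    by rewrite -mEE lte_fin.
  rewrite -mEE lee_fin; rewrite -mEE lee_fin in le1.
  have [ab'|ba] := ltP a b; first exact: H.
  have ba0 : b - a = 0 by apply/eqP; rewrite subr_eq0 eq_le ab ba.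
  by rewrite ba0 mulr0 (le_trans le1)// ba0.
have right : (lebesgue_measure (E `&` `[x, d]) <= (th * (d - x))%:E)%E.
  apply: part => // m mxd sp xd'.
  apply: (remez_right (w := w) (h := h) n_gt0 M0_gt0 w_gt0 w_le _ _ j0n xd' _
    g0 wg dl0 hx _ mxd sp) => //.
  - by move=> j t jN tx; apply: dh => //; lra.
  - by move=> j t jN tx; apply: hM => //; lra.
  - by apply: le_trans len; lra.
  - by move=> t [Et _]; exact: Edl.
have left : (lebesgue_measure (E `&` `[c, x]) <= (th * (x - c))%:E)%E.
  apply: part => // m mxd sp cx'.
  have -> : x - c = - c - - x by lra.
  apply: (@remez_right R hN w M0 (- x) (- c) n j0 gam dl n_gt0 M0_gt0 w_gt0 w_le
    _ _ j0n _ _ g0 wg dl0 _ [set t | E (- t) /\ (- t) \in `[c, x]]).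
  - by move=> j t jN tx; apply: dhN => //; lra.
  - by move=> j t jN tx; rewrite hN_norm; apply: hM => //; lra.
  - by lra.
  - by apply: le_trans len; lra.
  - by rewrite hN_norm opprK.
  - by move=> t [_]; rewrite /= !in_itv/= => ?; lra.
  - by lra.
  - move=> k s s0 ks; have [y [Ey yy]] := sp k s s0 ks.
    exists (fun i => - y (k - i)%N); split.
      by move=> i ik; rewrite /= opprK; apply: Ey; rewrite leq_subr.
    move=> i ik; have := yy (k - i.+1)%N; rewrite -subSn// subSS => H.
    by have := H (leq_subr _ _); lra.
  - by move=> t [Et _]; rewrite hN_norm; exact: Edl.
have EU : E `<=` (E `&` `[c, x]) `|` (E `&` `[x, d]).
  move=> t Et; have := Ecd _ Et; rewrite /= in_itv/= => tcd.
  by have [tx|tx] := leP t x; [left|right]; split=> //=; rewrite in_itv/=; lra.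
have mI a b : measurable ((E `&` `[a, b]) : set (measurableTypeR R)).
  by apply: measurableI => //; exact: measurable_itv.
apply: (@le_trans _ _ (lebesgue_measure ((E `&` `[c, x]) `|` (E `&` `[x, d])))).
  by apply: le_measure; rewrite ?inE//; exact: measurableU.
apply: (le_trans (measureU2 _ _ _)) => //.
apply: (le_trans (leeD left right)).
by rewrite -EFinD lee_fin; lra.
Qed.

(** Subtracting [v] changes only the derivative of order 0, so [h - v] obeys the bounds formed with
    [M0 + |v|]. By [bang_zeros] neither side of [x] carries [n + 1] solutions, which leaves at most
    [n] on each. *)
Lemma level_set_line (v : R) : expR (- j0%:R) * (M0 + `|v|) < `|h 0%N x - v| ->
  exists s : seq R, (size s <= N)%N /\
    forall t, c <= t <= d -> h 0%N t = v -> t \in s.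
Proof.
move=> hx; have /andP[cx xd] := x_cd.
pose A := M0 + `|v|; have A0 : 0 < A by rewrite ltr_pwDl.
pose hv j t := if j is 0 then h 0%N t - v else h j t.
have dhv j t : (j < N)%N -> c <= t <= d -> is_derive t 1 (hv j) (hv j.+1 t).
  case: j => [|j] jN tcd; last exact: dh.
  have d1 := dh jN tcd; rewrite /hv -[h 1%N t]subr0; exact: is_deriveB.
have hvM j t : (j <= N)%N -> c <= t <= d -> `|hv j t| <= weightM w A j.
  case: j => [|j] jN tcd.
    apply: (le_trans (ler_normB _ _)); rewrite /weightM big_geq// mulr1 lerD2r.
    by have := hM jN tcd; rewrite /weightM big_geq// mulr1.
  apply: (le_trans (hM jN tcd)); rewrite /weightM ler_wpM2r ?lerDl//.
  rewrite big_nat; apply: prodr_ge0 => i ij; apply/ltW/w_gt0; nlia.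
have kN : (n.+1 <= N)%N by nlia.
have j0n1 : (j0 <= n.+1)%N by nlia.
have [s1 [ss1 Hs1]] : exists s : seq R, (size s <= n)%N /\
    forall t, [set t | x <= t <= d /\ h 0%N t = v] t -> t \in s.
  apply: finite_of_no_chain => -[y [Hy yy]].
  have : `|hv 0%N x| <= expR (- j0%:R) * A.
    apply: (@bang_zeros R hv w y A x d n j0) => //.
    - by move=> j jn; apply: w_gt0; nlia.
    - by move=> i j i1 ij; apply: w_le => //; nlia.
    - by move=> j t jn tx; apply: dhv; [nlia|lra].
    - by move=> j t jn tx; apply: hvM; [nlia|lra].
    - by move=> i ik; have [] := Hy i ik.
    - by apply: le_trans len; lra.
    - by move=> i ik; have [_] := Hy i ik; rewrite /hv => ->; rewrite subrr.
  by rewrite leNgt hx.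
have [s2 [ss2 Hs2]] : exists s : seq R, (size s <= n)%N /\
    forall t, [set t | c <= t <= x /\ h 0%N t = v] t -> t \in s.
  apply: finite_of_no_chain => -[y [Hy yy]].
  have : `|(-1) ^+ 0 * hv 0%N (- - x)| <= expR (- j0%:R) * A.
    apply: (@bang_zeros R (fun j t => (-1) ^+ j * hv j (- t)) w
      (fun i => - y (n - i)%N) A (- x) (- c) n j0) => //.
    - by move=> j jn; apply: w_gt0; nlia.
    - by move=> i j i1 ij; apply: w_le => //; nlia.
    - by move=> j t jn tx; apply: is_derive_mirror; apply: dhv; [nlia|lra].
    - move=> j t jn tx; rewrite normrM normrX normrN1 expr1n mul1r.
      by apply: hvM; [nlia|lra].
    - by move=> i ik; have [|] := Hy (n - i)%N; [exact: leq_subr|lra].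
    - by apply: le_trans len; lra.
    - move=> i ik; rewrite ltrN2; have := yy (n - i.+1)%N.
      by rewrite -subSn// subSS; apply; exact: leq_subr.
    - move=> i ik; have [|_] := Hy (n - i)%N; first exact: leq_subr.
      by rewrite opprK /hv => ->; rewrite subrr mulr0.
  by rewrite opprK expr0 mul1r leNgt hx.
exists (s1 ++ s2); split; first by rewrite size_cat; nlia.
move=> t tcd tv; rewrite mem_cat; have [tx|tx] := leP t x.
  by rewrite (Hs2 t) ?orbT//=; split=> //; lra.
by rewrite (Hs1 t)//=; split=> //; lra.
Qed.

End line.

Lemma within_continuousM {R : realType} (A : set R) (f g : R -> R) :
  {within A, continuous f} -> {within A, continuous g} ->
  {within A, continuous (fun x => f x * g x)}.
Proof. by move=> cf cg x; exact: continuousM (cf x) (cg x). Qed.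

Lemma within_continuousB {R : realType} (A : set R) (f g : R -> R) :
  {within A, continuous f} -> {within A, continuous g} ->
  {within A, continuous (fun x => f x - g x)}.
Proof. by move=> cf cg x; exact: continuousB (cf x) (cg x). Qed.

Lemma is_derive_inv {R : realType} (f : R -> R) (x l : R) : f x != 0 ->
  is_derive x 1 f l -> is_derive x 1 (fun t => (f t)^-1) (- l / f x ^+ 2).
Proof.
move=> fx [df dfl].
have h : derivable (fun t => (f t)^-1) x 1 by exact: derivableV.
apply: DeriveDef => //.
by rewrite deriveV// dfl /GRing.scale/=; field.
Qed.

Lemma IVT_le {R : realType} (f : R -> R) (a b v : R) : a <= b ->
  {within `[a, b], continuous f} -> f a <= v <= f b ->
  exists2 c, a <= c <= b & f c = v.
Proof.
move=> ab cf /andP[fa fb].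
have mm : Num.min (f a) (f b) <= v <= Num.max (f a) (f b).
  by rewrite ge_min fa/= le_max fb orbT.
by have [c] := IVT ab cf mm; rewrite in_itv/=; exists c.
Qed.

Lemma no_crossing {R : realType} (f : R -> R) (a b v x y : R) :
  (forall t, a < t < b -> {for t, continuous f}) ->
  (forall t, a < t < b -> f t != v) ->
  a < x < b -> a < y < b -> v < f x -> v < f y.
Proof.
move=> cf fv xab yab vx; rewrite ltNge; apply/negP => fy.
have cw p q : a < p -> q < b -> {within `[p, q], continuous f}.
  move=> ap qb; apply: continuous_in_subspaceT => t; rewrite inE/= in_itv/= => tpq.
  by apply: cf; lra.
have [xy|/ltW xy] := leP x y.
- have cxy : {within `[x, y], continuous f} by apply: cw; lra.
  have mm : Num.min (f x) (f y) <= v <= Num.max (f x) (f y).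
    by rewrite ge_min fy orbT le_max (ltW vx).
  have [s + /eqP] := IVT xy cxy mm.
  by rewrite in_itv/= => st; apply/negP/fv; lra.
- have cyx : {within `[y, x], continuous f} by apply: cw; lra.
  have mm : f y <= v <= f x by rewrite fy (ltW vx).
  have [s st /eqP] := IVT_le xy cyx mm.
  by apply/negP/fv; lra.
Qed.

(** * Van der Corput estimates *)

(* [S] is an antiderivative of [cos psi * u] and [V] one of [|u1|]: increments of
   [S] and [V] stand for the integrals, which makes splitting trivial. *)
Section van_der_corput.
Variables (R : realType) (S V u u1 : R -> R) (c d G : R).
Hypothesis cS : {within `[c, d], continuous S}.
Hypothesis cV : {within `[c, d], continuous V}.
Hypothesis cu : {within `[c, d], continuous u}.
Hypothesis dV : forall t, c < t < d -> is_derive t 1 V `|u1 t|.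
Hypothesis du : forall t, c < t < d -> is_derive t 1 u (u1 t).
Hypothesis uG : forall t, c <= t <= d -> `|u t| <= G.

Let sub (f : R -> R) a b : {within `[c, d], continuous f} -> c <= a -> b <= d ->
  {within `[a, b], continuous f}.
Proof.
move=> cf ca bd; apply: continuous_subspaceW cf => t /=; rewrite !in_itv/=; lra.
Qed.

Let V_le a b : c <= a -> a <= b -> b <= d -> V a <= V b.
Proof.
move=> ca ab bd; apply: (ler_derive (f := fun t => `|u1 t|) ab) => //.
- by move=> t tab; apply: dV; lra.
- exact: sub.
Qed.

Section phase.
Variables psi psi1 psi2 : R -> R.
Hypothesis dpsi : forall t, c <= t <= d -> is_derive t 1 psi (psi1 t).
Hypothesis dpsi1 : forall t, c <= t <= d -> is_derive t 1 psi1 (psi2 t).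
Hypothesis dS : forall t, c < t < d -> is_derive t 1 S (cos (psi t) * u t).

Lemma normS_le a b : c <= a -> a <= b -> b <= d -> `|S b - S a| <= G * (b - a).
Proof.
move=> ca ab bd.
have dG (t : R) : is_derive t 1 (fun t => G * t) G.
  by rewrite -[X in is_derive _ _ _ X]mulr1; apply: is_deriveZ.
rewrite mulrBr; apply: (derive_dominated (f := fun t => cos (psi t) * u t)
  (h := fun=> G) (H := fun t => G * t) ab) => //.
- by move=> t tab; apply: dS; lra.
- move=> t tab; rewrite normrM -[leRHS]mul1r; apply: ler_pM => //.
    by rewrite ler_norml cos_geN1 cos_le1.
  by apply: uG; lra.
- exact: sub.
- by apply: (is_derive_within (f := fun=> G)) => t _; exact: dG.
Qed.

(** Integration by parts with boundary term [W]. Since [psi2 >= 0], the term [G * psi2 / psi1 ^ 2]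
    is the derivative of [- G / psi1], so the remaining integrand is dominated by the derivative of
    [H]. Both [W] and [G / psi1] are at most [G / eta] at the two ends, whence [4 * G]. *)
Lemma vdc_first a b eta : c <= a -> a <= b -> b <= d -> 0 < eta ->
  (forall t, a <= t <= b -> eta <= `|psi1 t|) ->
  (forall t, a < t < b -> 0 <= psi2 t) ->
  `|S b - S a| <= (4 * G + (V b - V a)) / eta.
Proof.
move=> ca ab bd eta0 eta_le psi2_ge0.
have p0 t : a <= t <= b -> psi1 t != 0.
  by move=> /eta_le h; rewrite -normr_gt0; exact: lt_le_trans h.
have ip t : a <= t <= b -> `|(psi1 t)^-1| <= eta^-1.
  by move=> tab; rewrite normfV lef_pV2 ?posrE ?normr_gt0 ?p0// eta_le.
have G0 : 0 <= G by apply: le_trans (uG (_ : c <= a <= d)) => //; lra.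
pose W t := sin (psi t) * u t * (psi1 t)^-1.
pose W' t := cos (psi t) * u t + sin (psi t) * u1 t / psi1 t
   - sin (psi t) * u t * psi2 t / psi1 t ^+ 2.
have dW t : a < t < b -> is_derive t 1 W (W' t).
  move=> tab; have tab' : a <= t <= b by lra.
  have tcd : c <= t <= d by lra. have tcd' : c < t < d by lra.
  have h1 := is_derive_inv (p0 _ tab') (dpsi1 tcd).
  have h2 : is_derive t 1 (fun t => sin (psi t)) (cos (psi t) * psi1 t).
    by apply: is_derive1_comp; exact: dpsi.
  have h3 := du tcd'.
  have h4 := is_deriveM (is_deriveM h2 h3) h1.
  apply: is_derive_eq h4 _; rewrite /GRing.scale/= !fctE /W'; field; exact: p0.
have cW : {within `[a, b], continuous W}.
  have cc : {within `[a, b], continuous (fun t => sin (psi t) * (psi1 t)^-1)}.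
    apply: (is_derive_within (f := fun t => sin (psi t) * (- psi2 t / psi1 t ^+ 2)
      + (psi1 t)^-1 * (cos (psi t) * psi1 t))) => t tab.
    have tcd : c <= t <= d by lra.
    have h1 := is_derive_inv (p0 _ tab) (dpsi1 tcd).
    have h2 : is_derive t 1 (fun t => sin (psi t)) (cos (psi t) * psi1 t).
      by apply: is_derive1_comp; exact: dpsi.
    exact: is_deriveM.
  have -> : W = (fun t => sin (psi t) * (psi1 t)^-1 * u t).
    by apply/funext => t; rewrite /W mulrAC.
  exact: within_continuousM cc (sub cu ca bd).
pose H t := V t / eta - G * (psi1 t)^-1.
have dH t : a < t < b -> is_derive t 1 H (`|u1 t| / eta + G * psi2 t / psi1 t ^+ 2).
  move=> tab; have tab' : a <= t <= b by lra.
  have tcd : c <= t <= d by lra. have tcd' : c < t < d by lra.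
  have h1 := is_derive_inv (p0 _ tab') (dpsi1 tcd).
  have h2 : is_derive t 1 (fun t => V t / eta) (`|u1 t| / eta).
    have -> : (fun t => V t / eta) = (fun t => eta^-1 * V t) by apply/funext => s; rewrite mulrC.
    by rewrite mulrC; apply: is_deriveZ; exact: dV.
  have h3 : is_derive t 1 (fun t => G * (psi1 t)^-1) (G * (- psi2 t / psi1 t ^+ 2)).
    exact: is_deriveZ.
  apply: is_derive_eq (is_deriveB h2 h3) _; ring.
have cH : {within `[a, b], continuous H}.
  have cc : {within `[a, b], continuous (fun t => G * (psi1 t)^-1)}.
    apply: (is_derive_within (f := fun t => G * (- psi2 t / psi1 t ^+ 2))) => t tab.
    have tcd : c <= t <= d by lra.
    have h1 := is_derive_inv (p0 _ tab) (dpsi1 tcd).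
    exact: is_deriveZ.
  have cc2 : {within `[a, b], continuous (fun t => V t / eta)}.
    apply: within_continuousM (sub cV ca bd) _ => t; exact: cst_continuous.
  exact: within_continuousB cc2 cc.
pose F t := S t - W t.
have dF t : a < t < b -> is_derive t 1 F (cos (psi t) * u t - W' t).
  move=> tab; have h1 := dW _ tab; have h2 : is_derive t 1 S (cos (psi t) * u t).
    by apply: dS; lra.
  exact: is_deriveB.
have cF : {within `[a, b], continuous F}.
  exact: within_continuousB (sub cS ca bd) cW.
have sin1 t : `|sin (psi t)| <= 1 by rewrite ler_norml sin_geN1 sin_le1.
have main : `|F b - F a| <= H b - H a.
  apply: (derive_dominated ab dF dH _ cF cH) => t tab.
  have tab' : a <= t <= b by lra.
  have -> : cos (psi t) * u t - W' t = - (sin (psi t) * (u1 t / psi1 t))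
    + sin (psi t) * (u t * (psi2 t / psi1 t ^+ 2)) by rewrite /W'; ring.
  apply: (le_trans (ler_normD _ _)); rewrite normrN; apply: lerD.
    rewrite normrM -[leRHS]mul1r; apply: ler_pM => //.
    by rewrite normrM; apply: ler_pM => //; exact: ip.
  rewrite normrM -[leRHS]mul1r; apply: ler_pM => //.
  have q0 : 0 <= psi2 t / psi1 t ^+ 2 by rewrite divr_ge0 ?psi2_ge0// sqr_ge0.
  rewrite normrM -mulrA (ger0_norm q0) ler_wpM2r//; apply: uG; lra.
have Wle t : a <= t <= b -> `|W t| <= G / eta.
  move=> tab; rewrite /W normrM; apply: ler_pM => //; last exact: ip.
  by rewrite normrM -[leRHS]mul1r; apply: ler_pM => //; apply: uG; lra.
have Gle t : a <= t <= b -> `|G * (psi1 t)^-1| <= G / eta.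
  by move=> tab; rewrite normrM (ger0_norm G0) ler_wpM2l// ip.
have aab : a <= a <= b by rewrite lexx. have bab : a <= b <= b by rewrite lexx ab.
have := Wle a aab; have := Wle b bab; have := Gle a aab; have := Gle b bab.
move: main; rewrite /F /H mulrDl mulrBl.
rewrite !ler_norml => /andP[m1 m2] /andP[? ?] /andP[? ?] /andP[? ?] /andP[? ?].
by apply/andP; split; lra.
Qed.

(** As [psi1] grows at rate at least [kap], it stays within [[- eta, eta]] on an interval of length
    at most [2 * eta / kap], where the trivial bound is used. On each side of it [vdc_first] costs
    [4 * G / eta] and that side's share of the variation [V]. *)
Lemma vdc_second_pos a b eta kap : c <= a -> a < b -> b <= d -> 0 < eta -> 0 < kap ->
  (forall t, a < t < b -> kap <= psi2 t) ->
  `|S b - S a| <= (8 * G + (V b - V a)) / eta + 2 * G * eta / kap.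
Proof.
move=> ca ab bd eta0 kap0 kap_le.
have G0 : 0 <= G by apply: le_trans (uG (_ : c <= a <= d)) => //; lra.
have psi1E s t : a <= s -> s <= t -> t <= b -> kap * (t - s) <= psi1 t - psi1 s.
  move=> as_ st tb.
  have dk (x : R) : a <= x <= b ->
      is_derive x 1 (fun x => psi1 x - kap * x) (psi2 x - kap).
    move=> xab; have h1 : is_derive x 1 psi1 (psi2 x) by apply: dpsi1; lra.
    have h2 : is_derive x 1 (fun x => kap * x) kap.
      by rewrite -[X in is_derive _ _ _ X]mulr1; apply: is_deriveZ.
    exact: is_deriveB.
  have : psi1 s - kap * s <= psi1 t - kap * t.
    apply: (ler_derive (F := fun x => psi1 x - kap * x) (f := fun x => psi2 x - kap) st).
    - by move=> x xst; apply: dk; lra.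
    - by move=> x xst; rewrite subr_ge0; apply: kap_le; lra.
    - by apply: (is_derive_within (f := fun x => psi2 x - kap)) => x xst; apply: dk; lra.
  lra.
have psi2_ge0 s t : a <= s -> t <= b -> forall x, s < x < t -> 0 <= psi2 x.
  by move=> as_ tb x xst; apply/ltW/(lt_le_trans kap0)/kap_le; lra.
have psi1_le s t : a <= s -> s <= t -> t <= b -> psi1 s <= psi1 t.
  move=> h1 h2 h3; have := psi1E _ _ h1 h2 h3.
  have : 0 <= kap * (t - s) by rewrite mulr_ge0 ?subr_ge0// ltW.
  lra.
have cpsi1 : {within `[a, b], continuous psi1}.
  by apply: (is_derive_within (f := psi2)) => t tab; apply: dpsi1; lra.
have Vab := V_le ca (ltW ab) bd.
have q0 : 0 <= 2 * G * eta / kap by rewrite divr_ge0 ?mulr_ge0 ?(ltW eta0) ?(ltW kap0).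
have g0 : 0 <= 4 * G / eta by rewrite divr_ge0 ?mulr_ge0 ?(ltW eta0) ?(ltW kap0).
have [ea|ea] := leP eta (psi1 a).
  apply: (le_trans (vdc_first ca (ltW ab) bd eta0 _ (psi2_ge0 _ _ (lexx a) (lexx b)))).
    move=> t /andP[t1 t2]; apply: le_trans (ler_norm _); apply: (le_trans ea).
    exact: psi1_le.
  rewrite !mulrDl; lra.
have [eb|eb] := leP (psi1 b) (- eta).
  apply: (le_trans (vdc_first ca (ltW ab) bd eta0 _ (psi2_ge0 _ _ (lexx a) (lexx b)))).
    move=> t /andP[t1 t2]; rewrite ler_normr; apply/orP; right.
    by rewrite lerNr; apply: le_trans eb; exact: psi1_le.
  rewrite !mulrDl; lra.
(* [p] is either the left end or a crossing of [- eta], and [q] below is the right end or a crossing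
   of [eta]. The disjunctions are kept because [p <= q] is derived from them. *)
have [p [ap pb pe pS]] : exists p, [/\ a <= p, p <= b, p = a /\ - eta <= psi1 p \/ psi1 p = - eta
    & `|S p - S a| <= 4 * G / eta + (V p - V a) / eta].
  have [ea'|ea'] := leP (- eta) (psi1 a).
    exists a; split; rewrite ?lexx ?(ltW ab)//; first by left.
    by rewrite !subrr normr0 mul0r addr0.
  have [|p /andP[ap pb] pe] := IVT_le (v := - eta) (ltW ab) cpsi1.
    by rewrite !ltW.
  exists p; split => //; first by right.
  rewrite -mulrDl; apply: vdc_first => //; first exact: le_trans pb bd.
    move=> t /andP[t1 t2]; rewrite ler_normr; apply/orP; right.
    by rewrite lerNr -pe; apply: psi1_le.
  exact: psi2_ge0.
have [q [aq qb qe qS]] : exists q, [/\ a <= q, q <= b, q = b /\ psi1 q <= eta \/ psi1 q = eta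
    & `|S b - S q| <= 4 * G / eta + (V b - V q) / eta].
  have [eb'|eb'] := leP (psi1 b) eta.
    exists b; split; rewrite ?lexx ?(ltW ab)//; first by left.
    by rewrite !subrr normr0 mul0r addr0.
  have [|q /andP[aq qb] qe] := IVT_le (v := eta) (ltW ab) cpsi1.
    by rewrite !ltW.
  exists q; split => //; first by right.
  rewrite -mulrDl; apply: vdc_first => //; first exact: le_trans ca aq.
    by move=> t /andP[t1 t2]; rewrite ler_normr -{1}qe psi1_le.
  exact: psi2_ge0.
have pq : p <= q.
  rewrite leNgt; apply/negP => qp.
  have := psi1_le _ _ aq (ltW qp) pb.
  case: pe => [[pa _]|->]; first by lra.
  by case: qe => [[qb' _]|->]; lra.
have mid : `|S q - S p| <= 2 * G * eta / kap.
  have h : G * (q - p) <= 2 * G * eta / kap.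
    rewrite ler_pdivlMr// (_ : 2 * G * eta = G * (2 * eta)); last by ring.
    rewrite -mulrA ler_wpM2l// mulrC.
    apply: (le_trans (psi1E _ _ ap pq qb)).
    have : - eta <= psi1 p by case: pe => [[_ //]|->].
    have : psi1 q <= eta by case: qe => [[_ //]|->].
    lra.
  by apply: le_trans h; apply: normS_le => //; lra.
have Vpq : V p <= V q by apply: V_le => //; lra.
have -> : S b - S a = (S b - S q) + (S q - S p) + (S p - S a) by ring.
apply: (le_trans (ler_normD _ _)); apply: (le_trans (lerD (ler_normD _ _) (lexx _))).
have : (V p - V a) / eta + (V b - V q) / eta <= (V b - V a) / eta.
  rewrite -mulrDl ler_wpM2r ?invr_ge0 ?(ltW eta0)//; lra.
rewrite [(8 * G + _) / eta]mulrDl (_ : 8 * G / eta = 4 * G / eta + 4 * G / eta); last by ring.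
lra.
Qed.

End phase.
End van_der_corput.

(** Strict because [x] is in neither class: cutting at a root uses it up, so [m] roots produce at
    most [m + 1] pieces. *)
Lemma count_lt_gt {R : realDomainType} (s : seq R) (x : R) : x \in s ->
  (count (fun t => (t < x)%R) s + count (fun t => (x < t)%R) s < size s)%N.
Proof.
have le (r : seq R) : (count (fun t => (t < x)%R) r + count (fun t => (x < t)%R) r <= size r)%N.
  by elim: r => //= y r IH; case: (ltgtP y x) => _; lia.
elim: s => // y s IH; rewrite inE /= => /predU1P[<-|/IH].
  by rewrite !(@ltxx _ R) /= !add0n ltnS le.
by case: (ltgtP y x) => _ H; rewrite /= ?add1n ?addSn ?addnS ?ltnS ?add0n// ltnW.
Qed.

(** * Cutting a line at the level points of the second derivative *)

Section pieces.
Variables (R : realType) (S V u u1 psi psi1 psi2 : R -> R) (c d G : R).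
Hypothesis cS : {within `[c, d], continuous S}.
Hypothesis cV : {within `[c, d], continuous V}.
Hypothesis cu : {within `[c, d], continuous u}.
Hypothesis dV : forall t, c < t < d -> is_derive t 1 V `|u1 t|.
Hypothesis du : forall t, c < t < d -> is_derive t 1 u (u1 t).
Hypothesis uG : forall t, c <= t <= d -> `|u t| <= G.
Hypothesis dpsi : forall t, c <= t <= d -> is_derive t 1 psi (psi1 t).
Hypothesis dpsi1 : forall t, c <= t <= d -> is_derive t 1 psi1 (psi2 t).
Hypothesis cpsi2 : forall t, c <= t <= d -> {for t, continuous psi2}.
Hypothesis dS : forall t, c < t < d -> is_derive t 1 S (cos (psi t) * u t).
Variables (eta kap K : R) (E : set R).
Hypothesis eta_gt0 : 0 < eta.
Hypothesis kap_gt0 : 0 < kap.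
Hypothesis K1 : eta^-1 <= K.
Hypothesis K2 : 8 / eta + 2 * eta / kap <= K.
Hypothesis mE : measurable (E : set (measurableTypeR R)).
Hypothesis psi2E : forall t, c <= t <= d -> `|psi2 t| <= kap -> E t.

Let V_le a b : c <= a -> a <= b -> b <= d -> V a <= V b.
Proof.
move=> ca ab bd; apply: (ler_derive (f := fun t => `|u1 t|) ab) => //.
- by move=> t tab; apply: dV; lra.
- apply: continuous_subspaceW cV => t /=; rewrite !in_itv/=; lra.
Qed.

(** Negative [psi2] is reduced to positive by replacing [psi] with [- psi], which leaves the cosine
    unchanged. [K2] handles the terms with [G], [K1] the variation. *)
Lemma vdc_second a b : c <= a -> a < b -> b <= d ->
  (forall t, a < t < b -> kap <= psi2 t) \/ (forall t, a < t < b -> psi2 t <= - kap) ->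
  `|S b - S a| <= K * (G + (V b - V a)).
Proof.
move=> ca ab bd H.
have G0 : 0 <= G by apply: le_trans (uG (_ : c <= a <= d)) => //; lra.
have Vab := V_le ca (ltW ab) bd.
suff h : `|S b - S a| <= (8 * G + (V b - V a)) / eta + 2 * G * eta / kap.
  apply: (le_trans h); have -> : (8 * G + (V b - V a)) / eta + 2 * G * eta / kap =
    (8 / eta + 2 * eta / kap) * G + eta^-1 * (V b - V a) by ring.
  by rewrite [leRHS]mulrDr; apply: lerD; rewrite ler_wpM2r// subr_ge0.
case: H => H; first exact: (vdc_second_pos cS cV cu dV du uG dpsi dpsi1 dS).
apply: (vdc_second_pos cS cV cu dV du uG (psi := fun t => - psi t)
  (psi1 := fun t => - psi1 t) (psi2 := fun t => - psi2 t)) => //.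
- by move=> t tcd; have := dpsi tcd => h; exact: is_deriveN.
- by move=> t tcd; have := dpsi1 tcd => h; exact: is_deriveN.
- by move=> t tcd; rewrite cosN; exact: dS.
- by move=> t tab; rewrite lerNr; exact: H.
Qed.

(** Half-open intervals make this exactly additive when an interval is cut at a point. *)
Let mu a b := fine (lebesgue_measure (E `&` `]a, b])).

Let mEab a b : measurable ((E `&` `]a, b]) : set (measurableTypeR R)).
Proof. by apply: measurableI => //; exact: measurable_itv. Qed.

Let muE a b : (mu a b)%:E = lebesgue_measure (E `&` `]a, b]).
Proof.
have [ab|ba] := leP a b; last first.
  rewrite /mu (_ : `]a, b]%classic = set0) ?setI0 ?measure0//.
  by rewrite -subset0 => t /=; rewrite in_itv/=; lra.
have h : (lebesgue_measure (E `&` `]a, b]) <= (b - a)%:E)%E.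
  apply: lebesgue_measure_subset_itv => // t [_] /=; rewrite !in_itv/=; lra.
by rewrite /mu fineK// ge0_fin_numE// (le_lt_trans h)// ltry.
Qed.

Let mu_ge0 a b : 0 <= mu a b.
Proof. by rewrite -lee_fin muE. Qed.

Let mu_split a x b : a <= x <= b -> mu a b = mu a x + mu x b.
Proof.
move=> axb; apply: EFin_inj; rewrite EFinD !muE -measureU//; last first.
  by rewrite -subset0 => t /= [[_]] + [_]; rewrite !in_itv/=; lra.
rewrite -setIUr; congr (lebesgue_measure (E `&` _)).
apply/seteqP; split=> t /=; rewrite !in_itv/=.
  by move=> ?; have [tx|tx] := leP t x; [left|right]; lra.
by case; lra.
Qed.

Let mu_full a b : a <= b -> (forall t, a < t < b -> E t) -> b - a <= mu a b.
Proof.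
move=> ab Et; rewrite -lee_fin muE.
have -> : (b - a)%:E = lebesgue_measure (`]a, b[ : set R).
  rewrite lebesgue_measure_itv/= lte_fin; case: ltP => // ba.
  by have -> : b - a = 0 by lra.
apply: le_measure; rewrite ?inE//.
by move=> t /=; rewrite !in_itv/= => tab; split; [exact: Et|lra].
Qed.

(** Induction on the roots of [|psi2| = kap]. Without roots, continuity leaves three cases:
    [psi2 > kap] or [psi2 < - kap] throughout, where [vdc_second] applies, or [|psi2| <= kap]
    throughout, where the piece lies in [E] and the trivial bound goes into the measure term. *)
Lemma vdc_pieces (s : seq R) a b : c <= a -> a <= b -> b <= d ->
  (forall t, a < t < b -> `|psi2 t| = kap -> t \in s) ->
  `|S b - S a| <= G * mu a b + (size s).+1%:R * K * (G + (V b - V a)).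
Proof.
have [n sn] := ubnP (size s); elim: n => // n IH in s a b sn *.
move=> ca ab bd Hs.
have G0 : 0 <= G by apply: le_trans (uG (_ : c <= a <= d)) => //; lra.
have K0 : 0 <= K by apply: le_trans K1; rewrite invr_ge0 ltW.
have Vab := V_le ca ab bd.
have [[x xs xab]|noroot] := pselect (exists2 x, x \in s & a < x < b).
  pose s1 := [seq t <- s | t < x]; pose s2 := [seq t <- s | x < t].
  have size12 : (size s1 + size s2 < size s)%N.
    by rewrite !size_filter count_lt_gt.
  have cx : c <= x by lra.
  have xd : x <= d by lra.
  have ax : a <= x by lra.
  have xb : x <= b by lra.
  have IH1 := IH s1 a x _ ca ax xd _; have IH2 := IH s2 x b _ cx xb bd _.
  have {}IH1 : `|S x - S a| <= G * mu a x + (size s1).+1%:R * K * (G + (V x - V a)).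
    apply: IH1; first by rewrite -ltnS (leq_trans _ sn)// ltnS (leq_ltn_trans _ size12)// leq_addr.
    move=> t tax tk; rewrite mem_filter; have -> : t < x by lra.
    by apply: Hs => //; lra.
  have {}IH2 : `|S b - S x| <= G * mu x b + (size s2).+1%:R * K * (G + (V b - V x)).
    apply: IH2; first by rewrite -ltnS (leq_trans _ sn)// ltnS (leq_ltn_trans _ size12)// leq_addl.
    move=> t tax tk; rewrite mem_filter; have -> : x < t by lra.
    by apply: Hs => //; lra.
  have Vax := V_le ca ax xd; have Vxb := V_le cx xb bd.
  have -> : S b - S a = (S b - S x) + (S x - S a) by ring.
  apply: (le_trans (ler_normD _ _)).
  rewrite (@mu_split a x b); last by lra.
  (* Each part is charged the whole variation [V b - V a]; the numbers of pieces add up because the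
     root [x] is in neither [s1] nor [s2]. *)
  have h1 : (size s1).+1%:R * K * (G + (V x - V a)) <= (size s1).+1%:R * K * (G + (V b - V a)).
    by rewrite ler_wpM2l ?mulr_ge0//; lra.
  have h2 : (size s2).+1%:R * K * (G + (V b - V x)) <= (size s2).+1%:R * K * (G + (V b - V a)).
    by rewrite ler_wpM2l ?mulr_ge0//; lra.
  have h3 : (size s1).+1%:R * K * (G + (V b - V a)) + (size s2).+1%:R * K * (G + (V b - V a))
      <= (size s).+1%:R * K * (G + (V b - V a)).
    rewrite -!mulrDl -natrD ler_wpM2r//; first by lra.
    by rewrite ler_wpM2r// ler_nat addSn addnS !ltnS.
  lra.
have GV : 0 <= G + (V b - V a) by lra.
have KS : K * (G + (V b - V a)) <= (size s).+1%:R * K * (G + (V b - V a)).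
  by rewrite -mulrA ler_peMl ?mulr_ge0// ler1n.
have Gmu : 0 <= G * mu a b by rewrite mulr_ge0.
have [ab'|ba] := ltP a b; last first.
  have -> : b = a by lra.
  rewrite subrr normr0 addr_ge0 ?mulr_ge0//; lra.
have nolev t : a < t < b -> `|psi2 t| != kap.
  by move=> tab; apply/eqP => /(Hs _ tab) ts; apply: noroot; exists t.
have cp t : a < t < b -> {for t, continuous psi2} by move=> tab; apply: cpsi2; lra.
pose x := (a + b) / 2; have xab : a < x < b by rewrite /x; lra.
have neqk t : a < t < b -> psi2 t != kap.
  by move=> /nolev; apply: contra => /eqP ->; rewrite gtr0_norm.
have neqNk t : a < t < b -> - psi2 t != kap.
  by move=> /nolev; apply: contra => /eqP h; rewrite -normrN h gtr0_norm.
have cNp t : a < t < b -> {for t, continuous (fun t => - psi2 t)}.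
  by move=> /cp h; exact: continuousN.
have [kx|xk] := ltP kap (psi2 x).
  apply: (@le_trans _ _ (K * (G + (V b - V a)))); last by lra.
  apply: vdc_second => //; left => t tab; apply/ltW.
  exact: (no_crossing cp neqk xab tab kx).
have [kx|xNk] := ltP kap (- psi2 x).
  apply: (@le_trans _ _ (K * (G + (V b - V a)))); last by lra.
  apply: vdc_second => //; right => t tab; rewrite lerNr; apply/ltW.
  exact: (no_crossing cNp neqNk xab tab kx).
have Et t : a < t < b -> E t.
  move=> tab; apply: psi2E; first by lra.
  rewrite ler_norml; apply/andP; split.
    rewrite lerNl leNgt; apply/negP => h.
    by have := no_crossing cNp neqNk tab xab h; rewrite ltNge xNk.
  rewrite leNgt; apply/negP => h.
  by have := no_crossing cp neqk tab xab h; rewrite ltNge xk.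
apply: (@le_trans _ _ (G * (b - a))).
  exact: (normS_le cS uG dS).
by apply: ler_wpDr; [rewrite !mulr_ge0|rewrite ler_wpM2l// mu_full].
Qed.

End pieces.

(** * Integration over a cube along lines *)

Section tonelli.
Variable R : realType.
Local Notation mR := (measurableTypeR R).
Local Notation leb := (@lebesgue_measure R).

(** The measure is built by prepending coordinates, while the lines run in an arbitrary coordinate
    direction; hence insertion at position [i]. *)
Definition tins n (i : 'I_n.+1) (p : mR * n.-tuple mR) : n.+1.-tuple mR :=
  [tuple (if unlift i j is Some k then tnth p.2 k else p.1) | j < n.+1].

Lemma measurable_tins n (i : 'I_n.+1) :
  measurable_fun [set: mR * n.-tuple mR] (tins i).
Proof.
apply/measurable_fun_tnthP => j.
have [k jk|ji] := unliftP i j.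
  rewrite (_ : _ \o _ = (fun t : n.-tuple mR => tnth t k) \o snd); last first.
    by apply/funext => p /=; rewrite tnth_mktuple jk liftK.
  apply: measurableT_comp; last exact: measurable_snd.
  exact: measurable_tnth.
rewrite (_ : _ \o _ = fst); first exact: measurable_fst.
by apply/funext => p /=; rewrite tnth_mktuple ji unlift_none.
Qed.

Lemma tins0 n (p : mR * n.-tuple mR) : tins ord0 p = tcons p.
Proof.
apply: eq_from_tnth => j; rewrite tnth_mktuple.
have [k ->|->] := unliftP ord0 j.
  by rewrite !(tnth_nth 0).
by rewrite (tnth_nth 0).
Qed.

(** Insertion at a later position commutes with prepending: the inductive step of [tonelli_tins]. *)
Lemma tins_lift n (i : 'I_n.+1) (s r : mR) (t : n.-tuple mR) :
  tins (lift ord0 i) (s, tcons (r, t)) = tcons (r, tins i (s, t)).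
Proof.
apply: eq_from_tnth => j; rewrite tnth_mktuple /=.
have [k ->|->] := unliftP ord0 j.
  have -> : tnth (tcons (r, tins i (s, t))) (lift ord0 k) = tnth (tins i (s, t)) k.
    by rewrite !(tnth_nth 0).
  rewrite tnth_mktuple /=.
  have [l ->|->] := unliftP i k.
    rewrite (_ : lift ord0 (lift i l) = lift (lift ord0 i) (lift ord0 l)).
      by rewrite liftK !(tnth_nth 0).
    by apply/val_inj; rewrite /= /bump !leq0n !add1n ltnS addnS.
  by rewrite unlift_none.
rewrite (_ : ord0 = lift (lift ord0 i) ord0).
  by rewrite liftK !(tnth_nth 0).
by apply/val_inj.
Qed.

Lemma lebesgue_nS_integral n (F : n.+1.-tuple mR -> \bar R) :
  measurable_fun [set: n.+1.-tuple mR] F -> (forall t, 0 <= F t)%E ->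
  (\int[lebesgue_n R n.+1]_t F t =
   \int[(leb \x lebesgue_n R n)%E]_p F (tcons p))%E.
Proof.
move=> mF F0.
have := @ge0_integral_pushforward _ _ _ _ R (@tcons R n) (@measurable_tcons R n)
  (leb \x lebesgue_n R n)%E setT F measurableT.
by rewrite preimage_setT => <-.
Qed.

(** Induction on the dimension. Position 0 is the construction of the measure. For a later position
    the first coordinate [r] is split off on both sides, and the induction hypothesis applies for
    fixed [r]. *)
Lemma tonelli_tins n (i : 'I_n.+1) (F : n.+1.-tuple mR -> \bar R) :
  measurable_fun [set: n.+1.-tuple mR] F -> (forall t, 0 <= F t)%E ->
  (\int[lebesgue_n R n.+1]_t F t =
   \int[lebesgue_n R n]_t \int[leb]_s F (tins i (s, t)))%E.
Proof.
have base m (G : m.+1.-tuple mR -> \bar R) : measurable_fun [set: m.+1.-tuple mR] G ->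
    (forall t, 0 <= G t)%E ->
    (\int[lebesgue_n R m.+1]_t G t =
     \int[lebesgue_n R m]_t \int[leb]_s G (tins ord0 (s, t)))%E.
  move=> mG G0; rewrite lebesgue_nS_integral// fubini_tonelli2//; last first.
    exact: measurableT_comp mG (@measurable_tcons R m).
  apply: eq_integral => t _; apply: eq_integral => s _; by rewrite tins0.
elim: n i F => [|n IH] i F mF F0; first by rewrite ord1 base.
have [k ->|->] := unliftP ord0 i; last by rewrite base.
have mFt (j : 'I_n.+2) : measurable_fun setT (F \o tins j).
  exact: measurableT_comp mF (measurable_tins j).
rewrite lebesgue_nS_integral// fubini_tonelli1//; last first.
  exact: measurableT_comp mF (@measurable_tcons R n.+1).
pose G (t : n.+1.-tuple mR) : \bar R := (\int[leb]_s F (tins (lift ord0 k) (s, t)))%E.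
have mG : measurable_fun [set: n.+1.-tuple mR] G.
  apply: (@measurable_fun_fubini_tonelli_G _ _ mR (n.+1.-tuple mR) R leb
    (F \o tins (lift ord0 k))) => //.
  by move=> x; exact: F0.
have G0 t : (0 <= G t)%E by apply: integral_ge0.
rewrite -/G [RHS](lebesgue_nS_integral mG G0) fubini_tonelli1//; last first.
  exact: measurableT_comp mG (@measurable_tcons R n).
apply: eq_integral => r _; rewrite /fubini_F (IH k)//; last first.
  exact: measurableT_comp (measurableT_comp mF (@measurable_tcons R n.+1)) (measurable_pair1 r).
apply: eq_integral => t _; apply: eq_integral => s _.
by rewrite tins_lift.
Qed.

End tonelli.

Section rowt_measurable.
Variable R : realType.
Local Notation mR := (measurableTypeR R).

(** Row vectors carry the topology and tuples the sigma-algebra. [U] is a countable union of balls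
    with rational centres and radii [1 / (k + 1)], and a ball is a finite intersection of conditions
    on single coordinates. *)
Lemma measurable_rowt_open n (U : set 'rV[R]_n) : open U ->
  measurable (@rowt R n @^-1` U : set (n.-tuple mR)).
Proof.
move=> oU.
pose B (p : 'rV[rat]_n * nat) : set 'rV[R]_n := ball (map_mx ratr p.1 : 'rV[R]_n) (p.2.+1%:R^-1).
have UE : U = \bigcup_(p in [set p | B p `<=` U]) B p.
  apply/seteqP; split => [x Ux|x [p /= pU px]]; last exact: pU.
  have /nbhs_ballP[e /= e0 eU] : nbhs x U by exact: open_nbhs_nbhs.
  (* With radius below [e / 2], a rational ball that contains [x] lies within [e] of [x], hence in
     [U]. *)
  have [k ke] : exists k : nat, k.+1%:R^-1 < e / 2.
    exists (Num.truncn (e / 2)^-1); rewrite invf_plt ?posrE ?divr_gt0//.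
    by rewrite -natr1; apply: truncnS_gt.
  have k0 : 0 < k.+1%:R^-1 :> R by rewrite invr_gt0.
  have [r rE] : exists r : R, r = k.+1%:R^-1 by exists k.+1%:R^-1.
  rewrite -rE in ke k0.
  have /choice[q Hq] : forall i, exists q : rat, `|ratr q - x 0 i| < r.
    move=> i; have : x 0 i - r < x 0 i + r by lra.
    move=> /rat_in_itvoo[q]; rewrite in_itv/= => /andP[q1 q2].
    by exists q; rewrite ltr_norml; lra.
  have xB : B (\row_i q i, k) x.
    by rewrite /B/= -rE; split => // i j; rewrite !mxE /ball/= ord1; exact: Hq.
  exists (\row_i q i, k) => //= y; rewrite /B/= -rE => -[_ qy]; apply: eU; split => // i j.
  have := qy i j; move: xB; rewrite /B/= -rE => -[_ qx]; have := qx i j.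
  rewrite /ball /= => h1 h2.
  have -> : x i j - y i j = - ((map_mx ratr (\row_i q i)) i j - x i j)
     + ((map_mx ratr (\row_i q i)) i j - y i j) by ring.
  apply: le_lt_trans (ler_normD _ _) _; rewrite normrN; lra.
rewrite UE preimage_bigcup bigcup_mkcond; apply: countable_bigcupT_measurable.
  exact: countableP.
move=> p; case: ifPn => // _.
rewrite (_ : _ @^-1` _ = \bigcap_(i in [set: 'I_n])
    ((fun t : n.-tuple mR => tnth t i) @^-1` (ball (ratr (p.1 0 i) : R) (p.2.+1%:R^-1)))).
  apply: fin_bigcap_measurable; first exact: finite_finset.
  move=> i _; rewrite -[X in measurable X]setTI; apply: (@measurable_tnth _ mR n i) => //.
  by apply: open_measurable; exact: ball_open.
apply/seteqP; split => [t [_ tp] i _|t tp]; first by have := tp 0 i; rewrite !mxE.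
split => [|i j]; first by rewrite invr_gt0.
by rewrite ord1 !mxE; exact: tp.
Qed.

Lemma measurable_rowt_closed n (F : set 'rV[R]_n) : closed F ->
  measurable (@rowt R n @^-1` F : set (n.-tuple mR)).
Proof.
move=> /closed_openC/measurable_rowt_open; rewrite preimage_setC => /measurableC.
by rewrite setCK.
Qed.

Lemma cube_closed n (c d : R) : closed (cube c d : set 'rV[R]_n).
Proof.
rewrite (_ : cube c d = \bigcap_(i in [set: 'I_n])
    ((fun x : 'rV[R]_n => x 0 i) @^-1` `[c, d])).
  apply: closed_bigI => i _; apply: preimage_closed; last exact: interval_closed.
  by move=> x _; exact: coord_continuous.
by apply/seteqP; split => [x xcd i _|x xcd i]; have := xcd i; rewrite /= in_itv/=; auto.
Qed.

Lemma measurable_cube n (c d : R) :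
  measurable (@rowt R n @^-1` (cube c d) : set (n.-tuple mR)).
Proof. by apply: measurable_rowt_closed; exact: cube_closed. Qed.

Lemma measurable_fun_rowt n (c d : R) (h : 'rV[R]_n -> R) :
  {within cube c d, continuous h} ->
  measurable_fun (@rowt R n @^-1` (cube c d) : set (n.-tuple mR)) (h \o @rowt R n).
Proof.
move=> /continuousP ch; apply: (measurability _ (RGenOpens.measurableE R)).
move=> _ [_ [a [b ->] <-]].
have oab : open (`]a, b[%classic : set R) by exact: interval_open.
have /open_subspaceP[V oV VE] := ch _ oab.
rewrite (_ : _ `&` _ = @rowt R n @^-1` (V `&` cube c d)); last first.
  by rewrite VE; apply/seteqP; split=> t [].
rewrite preimage_setI; apply: measurableI; first exact: measurable_rowt_open.
exact: measurable_cube.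
Qed.

End rowt_measurable.

Lemma within_continuous_comp {T U V : topologicalType} (A : set T) (B : set U)
    (f : U -> V) (g : T -> U) : {within B, continuous f} -> continuous g ->
  (forall x, A x -> B (g x)) -> {within A, continuous (f \o g)}.
Proof.
move=> /continuousP cf /continuousP cg AB; apply/continuousP => O oO.
have /open_subspaceP[W oW WE] := cf O oO.
apply/open_subspaceP; exists (g @^-1` W); first exact: cg.
apply/seteqP; split=> x [h1 Ax]; split=> //.
  have : (W `&` B) (g x) by split=> //; exact: AB.
  by rewrite WE => -[].
have : (f @^-1` O `&` B) (g x) by split=> //; exact: AB.
by rewrite (_ : _ `&` _ = W `&` B) => [[]|].
Qed.

(** * Lines in a cube and comparison of integrals *)

Section cube_integral.
Variable R : realType.
Local Notation mR := (measurableTypeR R).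
Local Notation leb := (@lebesgue_measure R).

Definition cube_dom n (c d : R) : set (n.-tuple mR) := @rowt R n @^-1` (cube c d).

Lemma cube_domP n c d (t : n.-tuple mR) :
  cube_dom c d t <-> forall j, c <= tnth t j <= d.
Proof. by split=> h j; have := h j; rewrite mxE. Qed.

Lemma cube_dom_tins n c d (i : 'I_n.+1) (s : mR) (t : n.-tuple mR) :
  cube_dom c d (tins i (s, t)) <-> c <= s <= d /\ cube_dom c d t.
Proof.
rewrite !cube_domP; split => [h|[h1 h2] j]; last first.
  by rewrite tnth_mktuple; case: unliftP => [k|] _; [exact: h2|exact: h1].
split => [|k]; first by have := h i; rewrite tnth_mktuple unlift_none.
by have := h (lift i k); rewrite tnth_mktuple liftK.
Qed.

Lemma cube_compact n c d : compact (cube c d : set 'rV[R]_n).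
Proof.
have := @rV_compact R n (fun=> `[c, d]%classic) (fun=> @segment_compact R c d).
by congr compact; apply/seteqP; split=> x xcd i; have := xcd i; rewrite /= in_itv.
Qed.

Lemma cube_bounded n c d (h : 'rV[R]_n -> R) : {within cube c d, continuous h} ->
  exists M, 0 <= M /\ forall x, cube c d x -> `|h x| <= M.
Proof.
move=> ch; have [M [_ HM]] := compact_bounded (continuous_compact ch (@cube_compact n c d)).
exists (`|M| + 1); split; first by rewrite addr_ge0.
have h1 : M < `|M| + 1 by rewrite (le_lt_trans (ler_norm _))// ltrDl.
by move=> x xcd; apply: (HM _ h1); exists x.
Qed.

Lemma lebesgue_n_cube n c d : c <= d ->
  lebesgue_n R n (cube_dom c d) = ((d - c) ^+ n)%:E.
Proof.
move=> cd; elim: n => [|n IH].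
  rewrite /= expr0 diracE mem_set//.
  by apply/cube_domP => -[].
have -> : lebesgue_n R n.+1 (cube_dom c d) =
    (leb \x lebesgue_n R n)%E (`[c, d] `*` cube_dom c d).
  rewrite /= /lebesgue_step /pushforward; congr (product_measure1 _ _ _).
  apply/seteqP; split=> -[s t]; rewrite /= -tins0 in_itv/=.
    by move=> /cube_dom_tins.
  by move=> h; apply/cube_dom_tins.
rewrite product_measure1E//; last exact: measurable_cube.
by rewrite IH exprS EFinM; congr (_ * _)%E; exact: lebesgue_measure_itvcc.
Qed.

Lemma cube_integrable n c d (h : 'rV[R]_n -> R) : c <= d ->
  {within cube c d, continuous h} ->
  (lebesgue_n R n).-integrable (cube_dom c d) (EFin \o (h \o @rowt R n)).
Proof.
move=> cd ch; apply: measurable_bounded_integrable.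
- exact: measurable_cube.
- by rewrite /= lebesgue_n_cube// ltry.
- exact: measurable_fun_rowt.
have [M [M0 HM]] := cube_bounded ch.
exists M; split; first exact: num_real.
by move=> x Mx t tcd /=; apply: le_trans (ltW Mx); exact: HM.
Qed.

(** The parameter [s] is the [i]-th coordinate itself, so all lines that meet the cube have the
    parameter interval [[c, d]]. *)
Definition cube_lpt n (i : 'I_n.+1) (t : n.-tuple mR) (s : R) : 'rV[R]_n.+1 :=
  rowt (tins i (s, t)).

Lemma cube_lptE n (i : 'I_n.+1) t s : cube_lpt i t s = cube_lpt i t 0 + s *: stdvec R i.
Proof.
apply/rowP => j; rewrite !mxE !tnth_mktuple eqxx/=.
have [k ->|->] := unliftP i j.
  by rewrite eq_sym (negbTE (neq_lift i k)) mulr0 addr0.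
by rewrite eqxx mulr1 add0r.
Qed.

Lemma continuous_cube_lpt n (i : 'I_n.+1) t : continuous (cube_lpt i t).
Proof.
rewrite (_ : cube_lpt i t = fun s => cube_lpt i t 0 + s *: stdvec R i); last first.
  by apply/funext => s; exact: cube_lptE.
by move=> s; apply: cvgD; [exact: cvg_cst|exact: scalel_continuous].
Qed.

Lemma cube_cube_lpt n c d (i : 'I_n.+1) t s : cube_dom c d t ->
  cube c d (cube_lpt i t s) <-> c <= s <= d.
Proof.
move=> tcd; have := @cube_dom_tins n c d i s t; rewrite /cube_dom/= => ->.
by split=> [[]|].
Qed.

Lemma within_cube_lpt n c d (i : 'I_n.+1) t (h : 'rV[R]_n.+1 -> R) :
  cube_dom c d t -> {within cube c d, continuous h} ->
  {within `[c, d], continuous (h \o cube_lpt i t)}.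
Proof.
move=> tcd ch; apply: (within_continuous_comp ch (@continuous_cube_lpt n i t)).
by move=> s /=; rewrite in_itv/= => scd; apply/cube_cube_lpt.
Qed.

(** Tonelli's theorem for the extensions by 0: on a line these live on [[c, d]] if the other
    coordinates are in the cube, and vanish identically otherwise. *)
Lemma int_Rn_le_lines n c d (i : 'I_n.+1) (P1 P2 : 'rV[R]_n.+1 -> R) : c <= d ->
  {within cube c d, continuous P1} -> {within cube c d, continuous P2} ->
  (forall x, cube c d x -> 0 <= P1 x) -> (forall x, cube c d x -> 0 <= P2 x) ->
  (forall t, cube_dom c d t ->
    \int[leb]_(s in `[c, d]) P1 (cube_lpt i t s) <=
    \int[leb]_(s in `[c, d]) P2 (cube_lpt i t s)) ->
  int_Rn (cube c d) P1 <= int_Rn (cube c d) P2.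
Proof.
move=> cd c1 c2 p1 p2 H; rewrite /int_Rn.
have i1 := cube_integrable cd c1; have i2 := cube_integrable cd c2.
rewrite -lee_fin /Rintegral !fineK; last 2 first.
- by apply: integrable_fin_num i2; exact: measurable_cube.
- by apply: integrable_fin_num i1; exact: measurable_cube.
pose F (P : 'rV[R]_n.+1 -> R) (t : n.+1.-tuple mR) : \bar R :=
  ((EFin \o (P \o @rowt R n.+1)) \_ (cube_dom c d)) t.
have F0 (P : 'rV[R]_n.+1 -> R) : (forall x, cube c d x -> 0 <= P x) -> forall t, (0 <= F P t)%E.
  move=> P0 t; rewrite /F patchE; case: ifPn => // /set_mem tcd.
  by rewrite lee_fin P0.
have mF (P : 'rV[R]_n.+1 -> R) : {within cube c d, continuous P} -> measurable_fun [set: n.+1.-tuple mR] (F P).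
  move=> cP; apply/(measurable_restrictT _ (@measurable_cube R n.+1 c d)).
  by apply/measurable_EFinP; exact: measurable_fun_rowt.
have FE (P : 'rV[R]_n.+1 -> R) : (forall x, cube c d x -> 0 <= P x) -> {within cube c d, continuous P} ->
    (\int[lebesgue_n R n.+1]_(t in cube_dom c d) (P (rowt t))%:E =
     \int[lebesgue_n R n]_t \int[leb]_s F P (tins i (s, t)))%E.
  move=> P0 cP; rewrite integral_mkcond (@tonelli_tins _ n i (F P))//.
    exact: mF.
  exact: F0.
have mG (P : 'rV[R]_n.+1 -> R) : (forall x, cube c d x -> 0 <= P x) -> {within cube c d, continuous P} ->
    measurable_fun [set: n.-tuple mR] (fun t => \int[leb]_s F P (tins i (s, t)))%E.
  move=> P0 cP.
  apply: (@measurable_fun_fubini_tonelli_G _ _ mR (n.-tuple mR) R leb (F P \o tins i)).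
    exact: measurableT_comp (mF _ cP) (@measurable_tins R n i).
  by move=> p; exact: F0.
have line (P : 'rV[R]_n.+1 -> R) t : cube_dom c d t -> {within cube c d, continuous P} ->
    (\int[leb]_s F P (tins i (s, t)) =
     (\int[leb]_(s in `[c, d]) P (cube_lpt i t s))%:E)%E.
  move=> tcd cP; rewrite /Rintegral fineK; last first.
    apply: integrable_fin_num; first exact: measurable_itv.
    apply: continuous_compact_integrable; first exact: segment_compact.
    exact: within_cube_lpt.
  rewrite [RHS]integral_mkcond; apply: eq_integral => s _.
  rewrite /F !patchE; congr (if _ then _ else _).
  by apply/idP/idP => /set_mem h; apply/mem_set; move: h;
    rewrite /= in_itv/= => /(cube_cube_lpt i s tcd).
rewrite !FE//; apply: ge0_le_integral => //.
- by move=> t _; apply: integral_ge0 => s _; exact: F0.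
- exact: mG.
- exact: mG.
- move=> t _; have [tcd|tcd] := pselect (cube_dom c d t).
    by rewrite !line// lee_fin; exact: H.
  have F00 P s : F P (tins i (s, t)) = 0%E.
    rewrite /F patchE memNset//; apply: contra_not tcd.
    by move=> /cube_dom_tins[].
  by rewrite !integral0_eq.
Qed.

Lemma int_Rn_affine n c d (al be : R) (P : 'rV[R]_n -> R) : c <= d ->
  {within cube c d, continuous P} ->
  int_Rn (cube c d) (fun x => al + be * P x) =
    al * (d - c) ^+ n + be * int_Rn (cube c d) P.
Proof.
move=> cd cP; rewrite /int_Rn.
have iP := cube_integrable cd cP.
have cst_cont (r : R) : {within cube c d, continuous (fun _ : 'rV[R]_n => r)}.
  by move=> x; exact: cst_continuous.
have ial := cube_integrable cd (cst_cont al).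
have mD := @measurable_cube R n c d.
rewrite (@RintegralD _ _ _ _ _ (fun=> al) (fun t => be * P (rowt t)))//.
  rewrite Rintegral_cst// RintegralZl//; congr (_ * _ + _).
  by rewrite [X in fine X](_ : _ = ((d - c) ^+ n)%:E)//; exact: lebesgue_n_cube.
exact: (@integrableZl _ _ _ _ _ mD be _ iP).
Qed.

(** [be] is the integral of the constant [be / (d - c)] along a line; over the cube this constant
    integrates to [(d - c) ^ n * be], the volume of the set of lines times [be]. *)
Lemma int_Rn_line_bound n c d (i : 'I_n.+1) (Phi A : 'rV[R]_n.+1 -> R) (be K : R) :
  c < d -> {within cube c d, continuous Phi} -> {within cube c d, continuous A} ->
  (forall x, cube c d x -> 0 <= A x) -> 0 <= be -> 0 <= K ->
  (forall t, cube_dom c d t ->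
    \int[leb]_(s in `[c, d]) Phi (cube_lpt i t s) <=
    be + K * \int[leb]_(s in `[c, d]) A (cube_lpt i t s)) ->
  int_Rn (cube c d) Phi <= (d - c) ^+ n * be + K * int_Rn (cube c d) A.
Proof.
move=> cd cPhi cA A0 be0 K0 H.
have dc0 : 0 < d - c by rewrite subr_gt0.
(* Adding a bound [B] of [Phi] makes both sides nonnegative, as Tonelli requires. *)
have [B [B0 HB]] := cube_bounded cPhi.
have := @int_Rn_le_lines n c d i (fun x => B + 1 * Phi x)
  (fun x => (B + be / (d - c)) + K * A x) (ltW cd).
have aff (al k : R) (P : 'rV[R]_n.+1 -> R) : {within cube c d, continuous P} ->
    {within cube c d, continuous (fun x => al + k * P x)}.
  move=> cP x; apply: cvgD; first exact: cvg_cst.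
  by apply: cvgM; [exact: cvg_cst|exact: cP].
have line (al k : R) (P : 'rV[R]_n.+1 -> R) t : cube_dom c d t ->
    {within cube c d, continuous P} ->
    \int[leb]_(s in `[c, d]) (al + k * P (cube_lpt i t s)) =
    al * (d - c) + k * \int[leb]_(s in `[c, d]) P (cube_lpt i t s).
  move=> tcd cP.
  have iP : leb.-integrable `[c, d] (EFin \o (P \o cube_lpt i t)).
    apply: continuous_compact_integrable; first exact: segment_compact.
    exact: within_cube_lpt.
  have ial : leb.-integrable `[c, d] (EFin \o (fun=> al)).
    apply: continuous_compact_integrable; first exact: segment_compact.
    by move=> x; exact: cst_continuous.
  have mD : measurable (`[c, d]%classic : set mR) by exact: measurable_itv.
  have ik : leb.-integrable `[c, d] (EFin \o (fun s => k * P (cube_lpt i t s))).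
    exact: (@integrableZl _ _ _ _ _ mD k _ iP).
  apply: (etrans (RintegralD mD ial ik)); congr (_ + _); last exact: RintegralZl.
  rewrite Rintegral_cst//; congr (_ * _).
  exact: (congr1 fine (lebesgue_measure_itvcc (ltW cd))).
move=> /(_ (aff _ _ _ cPhi) (aff _ _ _ cA)).
rewrite !int_Rn_affine ?(ltW cd)// mul1r.
have -> : (B + be / (d - c)) * (d - c) ^+ n.+1 = B * (d - c) ^+ n.+1 + (d - c) ^+ n * be.
  by rewrite exprS; field; rewrite gt_eqF.
move=> h; suff : B * (d - c) ^+ n.+1 + int_Rn (cube c d) Phi <=
  B * (d - c) ^+ n.+1 + (d - c) ^+ n * be + K * int_Rn (cube c d) A by lra.
apply: h.
- by move=> x /HB; rewrite ler_norml => /andP[? _]; lra.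
- by move=> x xcd; rewrite !addr_ge0 ?divr_ge0 ?mulr_ge0 ?A0// ltW.
- move=> t tcd; rewrite !line// mul1r.
  by rewrite mulrDl divfK ?gt_eqF// -addrA lerD2l; exact: H.
Qed.

End cube_integral.

(** * Degree and growth of the weight *)

Lemma admissible_weight_gt0 {R : realType} (mu : nat -> R) (j : nat) :
  admissible_weight mu -> (1 <= j)%N -> 0 < mu j.
Proof.
move=> [mu1 muS]; elim: j => // -[_ _|j IH _]; first exact: mu1.
exact: lt_le_trans (IH isT) (muS j.+1 isT).
Qed.

Lemma admissible_weight_le {R : realType} (mu : nat -> R) (j k : nat) :
  admissible_weight mu -> (1 <= j)%N -> (j <= k)%N -> mu j <= mu k.
Proof.
move=> [_ muS] j1; elim: k => [|k IH]; first by case: j j1.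
rewrite leq_eqVlt ltnS => /predU1P[->//|jk].
by apply: le_trans (IH jk) (muS _ _); exact: leq_trans jk.
Qed.

Lemma supremum_nat_max (A : set nat) (m : nat) : A m ->
  (forall k, A k -> (k <= m)%N) -> supremum 0%N A = m.
Proof.
move=> Am ub; rewrite /supremum; case: ifPn => [/eqP A0|_]; first by move: Am; rewrite A0.
have sm : supremums A m by split => [k /ub|k /(_ _ Am)].
by case: xgetP => [k _ sk|/(_ m)/(_ sm)//]; exact: (is_subset1_supremums sk sm).
Qed.

Lemma infimum_nat_min (A : set nat) (m : nat) : A m ->
  (forall k, A k -> (m <= k)%N) -> infimum 0%N A = m.
Proof.
move=> Am lb; rewrite /infimum; case: ifPn => [/eqP A0|_]; first by move: Am; rewrite A0.
have im : infimums A m by split => [k /lb|k /(_ _ Am)].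
by case: xgetP => [k _ ik|/(_ m)/(_ im)//]; exact: (is_subset1_infimums ik im).
Qed.

Lemma degree_j0_ge {R : realType} (A b : R) : ln (A / b) <= (degree_j0 A b)%:R.
Proof.
pose P : pred nat := fun j => ln (A / b) <= j%:R.
have exP : exists j, P j.
  exists (Num.truncn (ln (A / b))).+1; rewrite /P ltW//.
  exact: truncnS_gt.
have := ex_minnP exP; case=> m Pm minm.
by rewrite /degree_j0 (@infimum_nat_min _ m).
Qed.

(** [n] is the largest [k] with partial sum below [e], which exists since the whole series exceeds
    [e]. The sum up to [n + 1] thus reaches [e]: this is the length condition of Bang's theorem for
    [n + 1] points. The sum up to [j0] is empty, whence [j0 <= n], and the last claim is
    [j0 >= ln (A / b)]. *)
Lemma degreeN_spec {R : realType} (lam : nat -> R) (A a b : R) :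
  admissible_tuple lam A a b -> exists n : nat,
  [/\ degreeN lam A a b = (2 * n)%N, (degree_j0 A b <= n)%N,
      a <= \sum_((degree_j0 A b).+1 <= i < n.+2) (expR 1 * lam i)^-1 &
      expR (- (degree_j0 A b)%:R) * A <= b].
Proof.
move=> [wlam A0 a0 b0 sum_gt]; set j0 := degree_j0 A b in sum_gt *.
have lam_gt0 j : (1 <= j)%N -> 0 < lam j by exact: admissible_weight_gt0.
have E0 := @expR_gt0 R 1.
pose s k := \sum_(j0.+1 <= j < k.+1) (a * lam j)^-1.
have s_le k l : (k <= l)%N -> s k <= s l.
  move=> kl; have [jk|kj] := leqP j0 k; last first.
    rewrite /s (big_geq (n := k.+1))//; last by rewrite ltnS ltnW.
    rewrite big_nat sumr_ge0// => i /andP[i1 _].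
    by rewrite invr_ge0 mulr_ge0 ?ltW ?lam_gt0// (leq_trans _ i1).
  rewrite /s (big_cat_nat (n := k.+1) _ (p := l.+1))//= lerDl big_nat sumr_ge0// => i /andP[i1 _].
  by rewrite invr_ge0 mulr_ge0 ?ltW ?lam_gt0// (leq_trans _ i1).
have [K sK] : exists K, expR 1 <= s K.
  apply: contrapT => noK; move: sum_gt; rewrite ltNge => /negP; apply.
  apply: lime_le.
    apply: is_cvg_nneseries => n n1 _; rewrite lee_fin invr_ge0 ltW// lam_gt0//.
    exact: leq_trans n1.
  apply: nearW => -[|k].
    by rewrite big_geq// lee_fin mulr_ge0 ?ltW.
  rewrite sumEFin lee_fin -ler_pdivrMl// mulr_sumr.
  under eq_bigr do rewrite -invfM.
  rewrite leNgt; apply/negP => h; apply: noK; exists k; rewrite ltW//.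
have sj0 : s j0 < expR 1 by rewrite /s big_geq.
pose P : pred nat := fun k => s k < expR 1.
have exP : exists k, P k by exists j0.
have ubP k : P k -> (k <= K)%N.
  move=> Pk; rewrite leqNgt; apply/negP => Kk; move: Pk; rewrite /P ltNge.
  by rewrite (le_trans sK (s_le _ _ (ltnW Kk))).
have := ex_maxnP exP ubP; case=> n Pn maxn.
exists n; split.
- by rewrite /degreeN (@supremum_nat_max _ n).
- exact: maxn.
- have : expR 1 <= s n.+1.
    rewrite leNgt; apply/negP => h; have := maxn _ h; by rewrite ltnn.
  rewrite /s; under eq_bigr do rewrite invfM.
  under [X in _ -> _ <= X]eq_bigr do rewrite invfM.
  by rewrite -!mulr_sumr ler_pdivlMl// ler_pdivlMl// mulrC.
- have := degree_j0_ge A b; rewrite -/j0 -ler_expR lnK ?posrE ?divr_gt0// => h.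
  by rewrite expRN mulrC ler_pdivrMr ?expR_gt0// mulrC -ler_pdivrMr.
Qed.

Lemma derivable_quotient_cvg {R : realType} (k : R -> R) (s : R) : derivable k s 1 ->
  (fun u : R => u^-1 * (k (s + u) - k s)) @ 0^' --> derive1 k s.
Proof.
move=> dk; rewrite derive1E.
have -> : (fun u : R => u^-1 * (k (s + u) - k s)) =
    (fun u => u^-1 *: (k (u *: 1 + s) - k s)).
  by apply/funext => u; rewrite /GRing.scale/= mulr1 (addrC s).
exact: dk.
Qed.

(** Stated for a filter to serve both cases of [deriv1oo]. Here [k] is a C^1 function that agrees
    with one piece of [h]. *)
Lemma lim_quotient {R : realType} (F : set_system R) {FF : ProperFilter F}
    (h k : R -> R) (s : R) : F --> 0^' ->
  (\forall u \near F, h (s + u) = k (s + u)) -> h s = k s -> derivable k s 1 ->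
  lim ((fun u => u^-1 * (h (s + u) - h s)) @ F) = derive1 k s.
Proof.
move=> F0 hk hs dk; apply: cvg_lim => //.
have c1 : (fun u : R => u^-1 * (k (s + u) - k s)) @ F --> derive1 k s.
  apply: cvg_trans (derivable_quotient_cvg dk).
  exact: cvg_app.
apply: cvg_trans c1; apply: near_eq_cvg.
by apply: filterS hk => u hu; rewrite hs hu.
Qed.

Lemma at_left_dnbhs {R : realType} (x : R) : x^'- --> x^'.
Proof.
move=> P; apply: (@filterS _ (nbhs x) _ (fun u => u != x -> P u) (fun u => u < x -> P u)).
by move=> u h ux; apply: h; rewrite lt_eqF.
Qed.

Lemma at_right_dnbhs {R : realType} (x : R) : x^'+ --> x^'.
Proof.
move=> P; apply: (@filterS _ (nbhs x) _ (fun u => u != x -> P u) (fun u => x < u -> P u)).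
by move=> u h ux; apply: h; rewrite gt_eqF.
Qed.

Section gamma.
Variables (R : realType) (mu : nat -> R) (h : R -> R) (N : nat).
Hypothesis N1 : (1 < N)%N.
Hypothesis wi : weight_interpolation mu h.

Local Notation gam := (gamma_weight h N%:R).

Let N1R : 1 < N%:R :> R. Proof. by rewrite ltr1n. Qed.

Let t_ge1 (t : nat -> R) : t 0%N = 1 -> (forall i, t i < t i.+1) -> forall i, 1 <= t i.
Proof. by move=> t0 tS; elim=> [|i IH]; [rewrite t0|exact: le_trans IH (ltW (tS i))]. Qed.

(** What the interpolating function provides for the sublevel estimate: a lower bound of power type
    for the weights in terms of the last one. *)
Lemma gamma_weight_spec : 0 <= gam /\
  forall i, (1 <= i <= N)%N -> mu N * (i%:R / N%:R) `^ gam <= mu i.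
Proof.
have [hh ch [t [t0 tS toy /choice[k kP]]] h0 hmu] := wi.
have t1 := t_ge1 t0 tS.
have h1 s : 1 <= s -> h 1 <= h s.
  by move=> s1; apply: hh => //; rewrite in_itv/= ?lexx ?s1.
have h10 : 0 < h 1 by exact: h0.
have dk i s : derivable (k i) s 1 by have [+ _ _] := kP i; exact.
have ck i : continuous (derive1 (k i)) by have [_ + _] := kP i.
have hk i s : t i <= s <= t i.+1 -> h s = k i s.
  by have [_ _ +] := kP i => + si; apply; rewrite in_itv.
(* At a breakpoint the left derivative belongs to the piece that ends there, hence the intervals
   open on the left. *)
have derivE i s : t i < s <= t i.+1 -> deriv1oo h s = derive1 (k i) s.
  move=> /andP[s1 s2]; rewrite /deriv1oo (le_lt_trans (t1 i) s1).
  apply: lim_quotient => //; [exact: at_left_dnbhs| |by apply: hk; lra].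
  near=> u; apply: hk.
  have u0 : u < 0 by near: u; exact: nbhs_left_lt.
  have : t i - s < u by near: u; apply: nbhs_left_gt; lra.
  lra.
have derivE1 : deriv1oo h 1 = derive1 (k 0%N) 1.
  have := tS 0%N; rewrite t0 => t01.
  rewrite /deriv1oo ltxx; apply: lim_quotient => //; [exact: at_right_dnbhs| |].
    near=> u; apply: hk; rewrite t0.
    have u0 : 0 < u by near: u; exact: nbhs_right_gt.
    have : u < t 1%N - 1 by near: u; apply: nbhs_right_lt; lra.
    lra.
  by apply: hk; rewrite t0; lra.
have [m Nm] : exists m, N%:R <= t m.
  have /cvgryPge/(_ N%:R)[m _ Hm] := toy.
  by exists m; apply: Hm => /=.
have loc m' s : 1 < s -> s <= t m' -> exists2 i, (i < m')%N & t i < s <= t i.+1.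
  elim: m' => [|j IH] s1 sj; first by move: sj; rewrite t0 leNgt s1.
  have [sj'|js] := leP s (t j); last by exists j; rewrite ?ltnSn ?js.
  by have [i ij si] := IH s1 sj'; exists i => //; exact: ltnW.
have bnd i : exists C, 0 <= C /\ forall s, t i <= s <= t i.+1 -> `|derive1 (k i) s| <= C.
  have cki : {within `[t i, t i.+1], continuous derive1 (k i)}.
    exact: continuous_subspaceT.
  have [M [_ HM]] := compact_bounded (continuous_compact cki (@segment_compact _ _ _)).
  exists (`|M| + 1); split; first by rewrite addr_ge0.
  have M1 : M < `|M| + 1 by rewrite (le_lt_trans (ler_norm _))// ltrDl.
  by move=> s si; apply: (HM _ M1); exists s => //; rewrite /= in_itv.
have /choice[C HC] := bnd.
pose T := [set s * deriv1oo h s / h s | s in `[1, N%:R]].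
(* An unbounded set would have the default [sup] 0. Finitely many pieces cover [[1, N]], the
   derivative is bounded on each by compactness, and [h >= h 1 > 0]. *)
have ubT : has_ubound T.
  exists (N%:R * (\sum_(i < m.+1) C i) / h 1) => _ [s + <-]; rewrite /= in_itv/= => /andP[s1 sN].
  have hs : h 1 <= h s by exact: h1.
  have hs0 : 0 < h s by exact: lt_le_trans hs.
  have [i im dC] : exists2 i, (i < m.+1)%N & deriv1oo h s <= C i.
    move: s1; rewrite le_eqVlt => /predU1P[<-|s1].
      exists 0%N => //; rewrite derivE1; apply: le_trans (ler_norm _) _.
      by have [_] := HC 0%N; apply; rewrite t0 lexx -t0 ltW.
    have [i im si] := loc m s s1 (le_trans sN Nm).
    exists i; first exact: ltnW.
    rewrite (derivE _ _ si); apply: le_trans (ler_norm _) _.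
    by have [_] := HC i; apply; have /andP[? ?] := si; lra.
  have CS : C i <= \sum_(j < m.+1) C j.
    rewrite (bigD1 (Ordinal im))//= lerDl sumr_ge0// => j _.
    by have [] := HC j.
  have S0 : 0 <= \sum_(j < m.+1) C j by apply: sumr_ge0 => j _; have [] := HC j.
  rewrite ler_pdivrMr// mulrAC ler_pdivlMr//.
  apply: (@le_trans _ _ (N%:R * (\sum_(j < m.+1) C j) * h 1)).
    rewrite ler_wpM2r ?(ltW h10)//.
    apply: (@le_trans _ _ (s * (\sum_(j < m.+1) C j))).
      by rewrite ler_wpM2l ?(le_trans ler01 s1)// (le_trans dC).
    by rewrite ler_wpM2r.
  by rewrite ler_wpM2l// mulr_ge0.
have gub s : 1 <= s <= N%:R -> s * deriv1oo h s / h s <= gam.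
  by move=> sN; apply: ub_le_sup => //; exists s => //; rewrite /= in_itv.
(* [gam] bounds the logarithmic derivative of [h] in [ln s], so that [G] is
   nondecreasing on [1, N]. *)
pose G s := gam * ln s - ln (h s).
have piece i x y : t i <= x -> x <= y -> y <= t i.+1 -> y <= N%:R -> G x <= G y.
  move=> ix xy yi yN.
  have kpos s : x <= s <= y -> 0 < k i s.
    by move=> sxy; rewrite -hk; [apply: h0; have := t1 i; lra|lra].
  have dG s : x <= s <= y -> is_derive s 1 (fun s => gam * ln s - ln (k i s))
      (gam * s^-1 - (k i s)^-1 * derive1 (k i) s).
    move=> sxy; have s0 : 0 < s by have := t1 i; lra.
    have d1 : is_derive s 1 (fun s => gam * ln s) (gam * s^-1).
      by apply: is_deriveZ; exact: is_derive1_ln.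
    have d2 : is_derive s 1 (k i) (derive1 (k i) s) by rewrite derive1E; exact/derivableP.
    have d3 : is_derive s 1 (fun s => ln (k i s)) ((k i s)^-1 * derive1 (k i) s).
      by apply: is_derive1_comp; apply: is_derive1_ln; exact: kpos.
    exact: is_deriveB.
  rewrite /G (hk i x) ?(hk i y); [|lra|lra].
  apply: (ler_derive (F := fun s => gam * ln s - ln (k i s)) xy _ _ (is_derive_within dG)).
    by move=> s sxy; apply: dG; lra.
  move=> s sxy; have s1 : 1 < s by have := t1 i; lra.
  have := @gub s; rewrite (derivE i s) -?(hk i s); [|lra|lra].
  have hs0 : 0 < h s by apply: h0; lra.
  move=> /(_ _); have sN : 1 <= s <= N%:R by lra.
  move=> /(_ sN) H; rewrite subr_ge0.
  rewrite (_ : _ * _ = s * derive1 (k i) s / h s / s); last first.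
    by field; rewrite !gt_eqF//; lra.
  by rewrite ler_wpM2r// invr_ge0; lra.
have mono x y : 1 <= x -> x <= y -> y <= N%:R -> G x <= G y.
  move=> x1 xy yN; have := le_trans yN Nm.
  elim: m {Nm ubT} x y x1 xy yN => [|j IH] x y x1 xy yN ym.
    by rewrite t0 in ym; have -> : x = y by lra.
  have [yj|jy] := leP y (t j); first exact: IH.
  have [jx|xj] := leP (t j) x; first exact: (piece j).
  apply: (@le_trans _ _ (G (t j))).
    by apply: IH => //; lra.
  by apply: (piece j) => //; lra.
have lnh x : 1 <= x -> expR (ln (h x)) = h x by move=> x1; rewrite lnK// posrE h0.
(* [G 1 <= G N] with [h] nondecreasing gives [gam * ln N >= 0], and [ln N > 0] because [N > 1]. *)
have gam0 : 0 <= gam.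
  have := mono 1 N%:R (lexx _) (ltW N1R) (lexx _); rewrite /G ln1 mulr0 sub0r.
  have lnN : 0 < ln N%:R :> R by rewrite ln_gt0.
  have : ln (h 1) <= ln (h N%:R) by rewrite ler_ln ?posrE ?h0 ?h1// ltW.
  move=> H1 H2; have : 0 <= gam * ln N%:R by lra.
  by rewrite pmulr_lge0.
split=> // i /andP[i1 iN].
have i1R : 1 <= i%:R :> R by rewrite ler1n.
have iNR : i%:R <= N%:R :> R by rewrite ler_nat.
have := mono i%:R N%:R i1R iNR (lexx _).
rewrite -!hmu//; last exact: ltnW.
rewrite /G => H; have i0 : 0 < i%:R :> R by lra. have N0 : 0 < N%:R :> R by lra.
rewrite -(lnh N%:R) ?(ltW N1R)// -(lnh i%:R)// /powR ifF; last first.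
  by rewrite mulf_eq0 invr_eq0 !gt_eqF.
rewrite -expRD ler_expR ln_div ?posrE//; lra.
Unshelve. all: by end_near. Qed.

End gamma.

(** * The oscillatory integral *)

Lemma antiderivative_within {R : realType} (f : R -> R) (c d : R) : c < d ->
  {within `[c, d], continuous f} ->
  exists S : R -> R, [/\ {within `[c, d], continuous S},
    forall t, c < t < d -> is_derive t 1 S (f t) &
    S d - S c = \int[@lebesgue_measure R]_(t in `[c, d]) f t].
Proof.
move=> cd cf.
have fi : (@lebesgue_measure R).-integrable `[c, d] (EFin \o f).
  by apply: continuous_compact_integrable => //; exact: segment_compact.
exists (fun x => \int[@lebesgue_measure R]_(t in `[c, x]) f t); split.
- exact: (parameterized_integral_continuous (ltW cd) fi).
- move=> t /andP[ct td].
  have cft : {for t, continuous f}.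
    by apply: (within_continuous_continuous cd cf); rewrite in_itv/= ct.
  have [ds dE] := continuous_FTC1_closed td fi ct cft.
  by apply: DeriveDef => //; rewrite -derive1E.
- by rewrite set_itv1 Rintegral_set1 subr0.
Qed.

Section line_oscillation.
Variables (R : realType) (phi : nat -> R -> R) (w : nat -> R) (M2 b2 c d : R).
Variables (n j0 : nat) (gam Lam G th : R) (u u1 : R -> R).
Local Notation N := (2 * n)%N.
Local Notation leb := (@lebesgue_measure R).
Hypothesis n_gt0 : (0 < n)%N.
Hypothesis M2_gt0 : 0 < M2.
Hypothesis b2_gt0 : 0 < b2.
Hypothesis w_gt0 : forall j, (1 <= j <= N)%N -> 0 < w j.
Hypothesis w_le : forall i j, (1 <= i)%N -> (i <= j <= N)%N -> w i <= w j.
Hypothesis dphi : forall j t, (j < N + 2)%N -> c <= t <= d ->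
  is_derive t 1 (phi j) (phi j.+1 t).
Hypothesis phiM : forall j t, (j <= N)%N -> c <= t <= d ->
  `|phi j.+2 t| <= weightM w M2 j.
Hypothesis j0n : (j0 <= n)%N.
Hypothesis cd : c < d.
Hypothesis len : d - c <= \sum_(j0.+1 <= i < n.+2) (expR 1 * w i)^-1.
Hypothesis j0b : expR (- j0%:R) * (M2 + b2 / 2) <= b2 / 2.
Hypothesis gam_ge0 : 0 <= gam.
Hypothesis w_growth : forall i, (1 <= i <= N)%N ->
  w N * (i%:R / N%:R) `^ gam <= w i.
Hypothesis phi2_large : exists2 x, c <= x <= d & 7 / 8 * b2 < `|phi 2%N x|.
Hypothesis Lam_gt0 : 0 < Lam.
Hypothesis Lam_le : Lam ^+ N <= b2 / 2.
Hypothesis cu : {within `[c, d], continuous u}.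
Hypothesis cu1 : {within `[c, d], continuous u1}.
Hypothesis du : forall t, c < t < d -> is_derive t 1 u (u1 t).
Hypothesis uG : forall t, c <= t <= d -> `|u t| <= G.

(** The phase shift [th] lets one estimate serve both cosine and sine. The first term is the trivial
    bound on the sublevel set, the second comes from at most [2 N + 1] pieces, [N] cuts for each of
    the levels [eps] and [- eps]. *)
Lemma line_oscillation :
  `|\int[leb]_(t in `[c, d]) (cos ((Lam ^+ (N + 2))^-1 * phi 0%N t + th) * u t)| <=
  G * (4 * expR (2 + gam) * (Lam ^+ N / 2 / M2) `^ (N%:R^-1) * (d - c)) +
  (2 * N).+1%:R * (18 * Lam) * (G + \int[leb]_(t in `[c, d]) `|u1 t|).
Proof.
have b20 := b2_gt0; have M20 := M2_gt0; have Lle := Lam_le; have j0b' := j0b.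
pose lam := (Lam ^+ (N + 2))^-1.
have lam0 : 0 < lam by rewrite invr_gt0 exprn_gt0.
pose eps := Lam ^+ N / 2.
have eps0 : 0 < eps by rewrite divr_gt0 ?exprn_gt0.
have [x xcd phix] := phi2_large.
pose psi t := lam * phi 0%N t + th.
have dpsi t : c <= t <= d -> is_derive t 1 psi (lam * phi 1%N t).
  move=> tcd; have h := dphi (_ : 0 < N + 2)%N tcd.
  have h1 : is_derive t 1 (phi 0%N) (phi 1%N t) by apply: h; rewrite addn2.
  have h2 : is_derive t 1 (fun t => lam * phi 0%N t) (lam * phi 1%N t) by exact: is_deriveZ.
  have h3 : is_derive t 1 (fun _ : R => th) 0 by exact: is_derive_cst.
  by rewrite -[X in is_derive _ _ _ X]addr0; exact: is_deriveD.
have dpsi1 t : c <= t <= d -> is_derive t 1 (fun t => lam * phi 1%N t) (lam * phi 2%N t).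
  move=> tcd; have h1 : is_derive t 1 (phi 1%N) (phi 2%N t) by apply: dphi; rewrite ?addn2.
  exact: is_deriveZ.
have cphi2 t : c <= t <= d -> {for t, continuous (phi 2%N)}.
  move=> tcd; apply: (@is_derive_continuous _ _ _ (phi 3%N t)); apply: dphi => //.
  by rewrite addn2 !ltnS muln_gt0.
have cpsi2 t : c <= t <= d -> {for t, continuous (fun t => lam * phi 2%N t)}.
  by move=> /cphi2 h; apply: cvgM; [exact: cvg_cst|exact: h].
have ccos : {within `[c, d], continuous (fun t => cos (psi t))}.
  apply: (is_derive_within (f := fun t => - sin (psi t) * (lam * phi 1%N t))) => t tcd.
  by apply: is_derive1_comp; exact: dpsi.
have [S [cS dS SE]] := antiderivative_within cd (within_continuousM ccos cu).
have cu1n : {within `[c, d], continuous (fun t => `|u1 t|)}.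
  by move=> t; apply: cvg_norm; exact: cu1.
have [V [cV dV VE]] := antiderivative_within cd cu1n.
rewrite -SE -VE.
pose E : set R := [set` `[c, d]] `&` (phi 2%N) @^-1` [set` `[- eps, eps]].
have mE : measurable (E : set (measurableTypeR R)).
  have cw : {within `[c, d], continuous (phi 2%N)}.
    apply: continuous_in_subspaceT => t; rewrite inE/= in_itv/=; exact: cphi2.
  have := subspace_continuous_measurable_fun (measurable_itv _) cw.
  by apply; exact: measurable_itv.
have EP t : E t <-> c <= t <= d /\ `|phi 2%N t| <= eps.
  by rewrite /E /= !in_itv/= ler_norml.
(* Here [kap = 1 / (2 Lam ^ 2)]; with [eta = 1 / (2 Lam)] the two terms in [K2] are [16 Lam] and
   [2 Lam], which is the origin of 18. *)
pose kap := lam * eps; pose eta := (2 * Lam)^-1.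
have eta0 : 0 < eta by rewrite invr_gt0 mulr_gt0.
have kap0 : 0 < kap by rewrite mulr_gt0.
have LN0 : Lam ^+ N != 0 by rewrite gt_eqF ?exprn_gt0.
have K1 : eta^-1 <= 18 * Lam by rewrite /eta invrK ler_pM2r// ler_nat.
have K2 : 8 / eta + 2 * eta / kap <= 18 * Lam.
  rewrite le_eqVlt; apply/orP; left; apply/eqP.
  rewrite /eta /kap /lam /eps exprD; field.
  by rewrite LN0 gt_eqF.
have psi2E t : c <= t <= d -> `|lam * phi 2%N t| <= kap -> E t.
  move=> tcd; rewrite normrM (gtr0_norm lam0) /kap ler_pM2l// => h.
  exact/EP.
(* Since [eps <= b2 / 4], [|phi 2 x - v|] exceeds [7/8 b2 - b2 / 4 > b2 / 2], while
   [expR (- j0) * (M2 + eps) <= b2 / 2] by [j0b]. *)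
have lev v : `|v| = eps -> exists s : seq R, (size s <= N)%N /\
    forall t, c <= t <= d -> phi 2%N t = v -> t \in s.
  move=> v_eps.
  apply: (level_set_line (h := fun j => phi j.+2) n_gt0 M2_gt0 w_gt0 w_le _ phiM j0n len xcd).
    by move=> j t jN tcd; apply: dphi => //; rewrite addn2 !ltnS.
  rewrite v_eps; have e2 : eps <= b2 / 4 by rewrite /eps; lra.
  have h1 : expR (- j0%:R) * (M2 + eps) <= expR (- j0%:R) * (M2 + b2 / 2).
    by rewrite ler_wpM2l ?expR_ge0//; lra.
  have h2 : `|phi 2%N x| - `|v| <= `|phi 2%N x - v| by exact: lerB_dist.
  rewrite v_eps in h2; lra.
have [s1 [ss1 Hs1]] := lev eps (gtr0_norm eps0).
have [|s2 [ss2 Hs2]] := lev (- eps); first by rewrite normrN gtr0_norm.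
have Hs t : c < t < d -> `|lam * phi 2%N t| = kap -> t \in s1 ++ s2.
  move=> tcd; rewrite normrM (gtr0_norm lam0) /kap => h.
  have {}h : `|phi 2%N t| = eps by apply: (mulfI (lt0r_neq0 lam0)).
  have tcd' : c <= t <= d by lra.
  rewrite mem_cat; have [p0|p0] := leP 0 (phi 2%N t).
    by rewrite Hs1//; rewrite ger0_norm in h.
  by rewrite (Hs2 t) ?orbT// -h ltr0_norm// opprK.
have dS' t : c < t < d -> is_derive t 1 S (cos (psi t) * u t) by exact: dS.
have := vdc_pieces cS cV cu dV du uG dpsi dpsi1 cpsi2 dS' eta0 kap0 K1 K2 mE psi2E
  (lexx c) (ltW cd) (lexx d) Hs.
move=> h; apply: (le_trans h).
have G0 : 0 <= G by apply: le_trans (uG xcd).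
have Vcd : 0 <= V d - V c.
  by rewrite VE; apply: Rintegral_ge0.
apply: lerD; last first.
  apply: ler_wpM2r; first by rewrite addr_ge0.
  apply: ler_wpM2r; first by rewrite mulr_ge0 ?(ltW Lam_gt0).
  rewrite ler_nat ltnS size_cat.
  by rewrite mul2n -addnn leq_add.
rewrite ler_wpM2l//.
have hx : expR (- j0%:R) * M2 < `|phi 2%N x|.
  have h1 : expR (- j0%:R) * M2 <= expR (- j0%:R) * (M2 + b2 / 2).
    by rewrite ler_wpM2l ?expR_ge0//; lra.
  lra.
have := @remez_line R (fun j => phi j.+2) w M2 c d n j0 n_gt0 M2_gt0 w_gt0 w_le _ phiM
  j0n len x xcd gam eps E gam_ge0 eps0 w_growth hx mE _ _.
move=> /(_ _)/(_ _)/(_ _) rem.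
have {}rem : (leb E <= (4 * expR (2 + gam) * (eps / M2) `^ (N%:R^-1) * (d - c))%:E)%E.
  apply: rem.
  - by move=> j t jN tcd; apply: dphi => //; rewrite addn2 !ltnS.
  - by move=> t [].
  - by move=> t /EP[].
rewrite -/eps -lee_fin.
have leE : (leb (E `&` `]c, d]) <= leb E)%E.
  by apply: le_measure; rewrite ?inE//; apply: measurableI => //; exact: measurable_itv.
rewrite fineK; first exact: le_trans leE rem.
by rewrite ge0_fin_numE// (le_lt_trans (le_trans leE rem))// ltry.
Qed.

End line_oscillation.

(** * Restricting [f] and [g] to lines *)

Lemma flatten_nseq_single {T : eqType} (x : T) (j : nat) (s : seq T) : uniq s -> x \in s ->
  flatten [seq nseq (if i == x then j else 0%N) i | i <- s] = nseq j x.
Proof.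
have none (r : seq T) : x \notin r ->
    flatten [seq nseq (if i == x then j else 0%N) i | i <- r] = [::].
  elim: r => //= y r IH; rewrite inE negb_or eq_sym => /andP[/negbTE -> xr].
  exact: IH.
elim: s => //= y s IH /andP[ys us]; rewrite inE => /predU1P[xy|xs].
  by rewrite -xy eqxx none ?cats0// xy.
by rewrite ifF ?IH//; apply/negbTE; apply: contra ys => /eqP ->.
Qed.

(** The multi-index concentrated at [i] has coefficient [j! / j! = 1], and the other summands are
    nonnegative. *)
Lemma norm_partials_le_jet {R : realType} n (i : 'I_n) (j : nat) (f : 'rV[R]_n -> R) x :
  `|partials (nseq j i) f x| <= jet_norm j f x.
Proof.
pose al : {ffun 'I_n -> 'I_j.+1} := [ffun k => if k == i then ord_max else ord0].
have alE k : al k = (if k == i then j else 0%N) :> nat by rewrite ffunE; case: eqP.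
rewrite /jet_norm (bigD1 al)/=; last first.
  rewrite (bigD1 i)//= alE eqxx big1 ?addn0// => k ki.
  by rewrite alE (negbTE ki).
have -> : (\prod_k (al k)`!)%N = j`!.
  rewrite (bigD1 i)//= alE eqxx big1 ?muln1// => k ki.
  by rewrite alE (negbTE ki).
have -> : partial_multi (fun k => al k : nat) f x = partials (nseq j i) f x.
  rewrite /partial_multi; congr partials.
  rewrite -[RHS](flatten_nseq_single j (enum_uniq 'I_n) (mem_enum _ i)).
  by congr flatten; apply: eq_map => k; rewrite alE.
rewrite divff ?mul1r ?lerDl; last by rewrite pnatr_eq0 -lt0n fact_gt0.
by apply: sumr_ge0 => a _; rewrite mulr_ge0// divr_ge0.
Qed.

(** Turns the bounds on [f] of order [j + 2] into bounds of order [j] on its second derivative, in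
    terms of the shifted weight. *)
Lemma weightM_shift2 {R : realType} (mu : nat -> R) (M0 : R) j :
  weightM (shift2 mu) (weightM mu M0 2) j = weightM mu M0 j.+2.
Proof.
elim: j => [|j IH]; first by rewrite [LHS]/weightM big_geq// mulr1.
by rewrite weightMS IH [RHS]weightMS.
Qed.

Lemma is_derive_line {R : realType} n (F : 'rV[R]_n -> R) (p e : 'rV[R]_n) (s : R) :
  derivable F (p + s *: e) e ->
  is_derive s 1 (fun s => F (p + s *: e)) ('D_e F (p + s *: e)).
Proof.
have E : (fun h : R => h^-1 *: (F (p + (h *: 1 + s) *: e) - F (p + s *: e))) =
    (fun h : R => h^-1 *: (F (h *: e + (p + s *: e)) - F (p + s *: e))).
  apply/funext => h; congr (_ *: (F _ - _)).
  have -> : (h *: (1 : R) : R) = h by exact: mulr1.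
  by rewrite scalerDl addrCA.
move=> dF; apply: DeriveDef; first by rewrite /derivable E.
by rewrite /derive E.
Qed.

(** The point may lie on a face of the cube in the other coordinates. Only increments in direction
    [i] count, and [c < s < d] leaves them unrestricted near 0. *)
Lemma is_derive_dpartial_line {R : realType} n (c d : R) (i : 'I_n.+1)
    (a : 'rV[R]_n.+1 -> R) t (s : R) :
  C1_within (cube c d) a -> cube_dom c d t -> c < s < d ->
  is_derive s 1 (a \o cube_lpt i t) (dpartial (cube c d) i a (cube_lpt i t s)).
Proof.
move=> [_ /(_ i)[hd _]] tcd scd.
have xE : cube c d (cube_lpt i t s) by apply/cube_cube_lpt => //; lra.
have lptD (u : R) : cube_lpt i t s + u *: stdvec R i = cube_lpt i t (s + u).
  by rewrite [RHS]cube_lptE scalerDl addrA -cube_lptE.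
have := hd _ xE; rewrite /has_dpartial /dpartial.
set q := (fun u : R => _); set D := [set u | _] => cq.
have Dnear : \forall u \near 0^', D u.
  have h : \forall u \near (0 : R), u \in `]c - s, d - s[.
    by apply: near_in_itvoo; rewrite in_itv/=; lra.
  apply: nbhs_dnbhs; apply: filterS h => u; rewrite in_itv/= => us.
  by rewrite /D/= lptD; apply/cube_cube_lpt => //; lra.
have qlim : q @ 0^' --> lim (q @ within D 0^').
  apply: cvg_trans cq; apply: cvg_app => P PD.
  by apply: filterS2 Dnear PD => u Du; exact.
have E : (fun h : R => h^-1 *: ((a \o cube_lpt i t) (h *: 1 + s) -
    (a \o cube_lpt i t) s)) = q.
  apply/funext => h; rewrite /q lptD /=.
  have -> : (h *: (1 : R) : R) = h by exact: mulr1.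
  by rewrite [h + s]addrC.
apply: DeriveDef; first by rewrite /derivable E; apply: cvgP qlim.
by rewrite /derive E; apply: cvg_lim.
Qed.

Lemma cmod_ge {R : realType} (z : R[i]) :
  `|complex.Re z| <= cmod z /\ `|complex.Im z| <= cmod z.
Proof.
case: z => a b; rewrite /cmod /Normc.normc/=; split.
  by rewrite -sqrtr_sqr ler_sqrt ?addr_ge0 ?sqr_ge0// lerDl sqr_ge0.
by rewrite -sqrtr_sqr ler_sqrt ?addr_ge0 ?sqr_ge0// lerDr sqr_ge0.
Qed.

Lemma cmod_le {R : realType} (a b : R) : cmod (Complex a b) <= `|a| + `|b|.
Proof.
rewrite /cmod /Normc.normc -(ger0_norm (addr_ge0 (normr_ge0 a) (normr_ge0 b))).
rewrite -sqrtr_sqr ler_sqrt ?sqr_ge0// sqrrD !real_normK ?num_real//.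
by rewrite addrAC lerDl mulrn_wge0// mulr_ge0.
Qed.

Lemma cmod_ge0 {R : realType} (z : R[i]) : 0 <= cmod z.
Proof. by case: z => a b; exact: sqrtr_ge0. Qed.

Lemma within_continuous_cmod {R : realType} {T : topologicalType} (A : set T)
    (h : T -> R[i]) : {within A, continuous (fun x => complex.Re (h x))} ->
  {within A, continuous (fun x => complex.Im (h x))} ->
  {within A, continuous (fun x => cmod (h x))}.
Proof.
move=> c1 c2.
have -> : (fun x => cmod (h x)) =
    (fun x => Num.sqrt (complex.Re (h x) * complex.Re (h x) +
                        complex.Im (h x) * complex.Im (h x))).
  by apply/funext => x; case: (h x) => a b; rewrite /cmod/= !expr2.
move=> x; apply: continuous_comp; last exact: sqrt_continuous.
by apply: cvgD; apply: cvgM; (exact: c1 || exact: c2).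
Qed.

Lemma le_supnorm {R : realType} n (c d : R) (h : 'rV[R]_n -> R) x :
  {within cube c d, continuous h} -> cube c d x -> `|h x| <= supnorm (cube c d) h.
Proof.
move=> ch Ex; have [M [_ hM]] := cube_bounded ch.
apply: ub_le_sup; last by exists x.
by exists M => _ [y Ey <-]; exact: hM.
Qed.

Lemma int_Rn_le {R : realType} n (c d : R) (a b : 'rV[R]_n -> R) : c <= d ->
  {within cube c d, continuous a} -> {within cube c d, continuous b} ->
  (forall x, cube c d x -> a x <= b x) -> int_Rn (cube c d) a <= int_Rn (cube c d) b.
Proof.
move=> cd ca cb ab.
apply: le_Rintegral; [exact: measurable_cube|exact: cube_integrable|exact: cube_integrable|].
by move=> t tE; exact: ab.
Qed.

Lemma int_RnD {R : realType} n (c d : R) (a b : 'rV[R]_n -> R) : c <= d ->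
  {within cube c d, continuous a} -> {within cube c d, continuous b} ->
  int_Rn (cube c d) (fun x => a x + b x) = int_Rn (cube c d) a + int_Rn (cube c d) b.
Proof.
move=> cd ca cb; rewrite /int_Rn.
have ia := cube_integrable cd ca; have ib := cube_integrable cd cb.
exact: (RintegralD (@measurable_cube R n c d) ia ib).
Qed.

(** * From lines to the cube *)

Section cube_oscillation.
Variables (R : realType) (n : nat) (c d : R) (mu : nat -> R).
Variables (M0 b2 : R) (i : 'I_n.+1) (m j0 : nat) (gam Lam : R) (f : 'rV[R]_n.+1 -> R).
Local Notation N := (2 * m)%N.
Local Notation leb := (@lebesgue_measure R).
Local Notation E := (cube c d : set 'rV[R]_n.+1).
Local Notation M2 := (weightM mu M0 2).
Local Notation lam := (shift2 mu).
Hypothesis cd : c < d.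
Hypothesis m_gt0 : (0 < m)%N.
Hypothesis M2_gt0 : 0 < M2.
Hypothesis b2_gt0 : 0 < b2.
Hypothesis lam_gt0 : forall j, (1 <= j <= N)%N -> 0 < lam j.
Hypothesis lam_le : forall j k, (1 <= j)%N -> (j <= k <= N)%N -> lam j <= lam k.
Hypothesis j0m : (j0 <= m)%N.
Hypothesis len : d - c <= \sum_(j0.+1 <= k < m.+2) (expR 1 * lam k)^-1.
Hypothesis j0b : expR (- j0%:R) * (M2 + b2 / 2) <= b2 / 2.
Hypothesis gam_ge0 : 0 <= gam.
Hypothesis lam_growth : forall k, (1 <= k <= N)%N ->
  lam N * (k%:R / N%:R) `^ gam <= lam k.
Hypothesis Lam_gt0 : 0 < Lam.
Hypothesis Lam_le : Lam ^+ N <= b2 / 2.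
Hypothesis fsmooth : mu_smooth mu (N + 2)%N M0 E f.
Hypothesis f2_large : forall x, E x ->
  b2 <= supnorm (cube_line c d i x) (partials [:: i; i] f).

Lemma smooth_within : {within E, continuous f}.
Proof.
have [[U [oU EU CU]] _] := fsmooth.
apply: continuous_in_subspaceT => x; rewrite inE => Ex.
by have [+ _] := CU [::] isT; apply; exact: EU.
Qed.

Let phi t j s := partials (nseq j i) f (cube_lpt i t s).

Lemma line_derive t j s : cube_dom c d t -> (j < N + 2)%N -> c <= s <= d ->
  is_derive s 1 (phi t j) (phi t j.+1 s).
Proof.
move=> tcd jN scd; have [[U [oU EU CU]] _] := fsmooth.
have Ux : U (cube_lpt i t s) by apply: EU; apply/cube_cube_lpt.
have [|_] := CU (nseq j i); first by rewrite size_nseq ltnW.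
rewrite size_nseq => /(_ jN i _ Ux) dF.
have := @is_derive_line R n.+1 (partials (nseq j i) f) (cube_lpt i t 0) (stdvec R i) s.
rewrite -cube_lptE => /(_ dF).
have -> : phi t j = fun u => partials (nseq j i) f (cube_lpt i t 0 + u *: stdvec R i).
  by apply/funext => u; rewrite /phi cube_lptE.
exact.
Qed.

Lemma line_bound t j s : cube_dom c d t -> (j <= N)%N -> c <= s <= d ->
  `|phi t j.+2 s| <= weightM lam M2 j.
Proof.
move=> tcd jN scd; have [_ H] := fsmooth.
rewrite weightM_shift2; apply: le_trans (norm_partials_le_jet _ _ _ _) _.
by apply: H; [rewrite addn2 !ltnS|apply/cube_cube_lpt].
Qed.

(** A near-maximizer of the supremum on the line is enough; the factor 7/8 must exceed 3/4, so that
    subtracting a level of size at most [b2 / 4] leaves more than [b2 / 2]. *)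
Lemma line_large t : cube_dom c d t ->
  exists2 s, c <= s <= d & 7 / 8 * b2 < `|phi t 2%N s|.
Proof.
move=> tcd; have b20 := b2_gt0.
have Ex : E (cube_lpt i t c) by apply/cube_cube_lpt; rewrite // lexx ltW.
have := f2_large Ex; rewrite /supnorm; set T := [set _ | _ in _] => bT.
(* A set without a supremum has [sup] equal to 0, which [0 < b2 <= sup T] excludes. *)
have hT : has_sup T.
  by apply: contrapT => nT; move: bT; rewrite sup_out// leNgt b20.
have [|_ [y [Ey [r _ ry]] <-] yT] := @sup_adherent _ T (b2 / 8) _ hT; first by lra.
exists (c + r); last first.
  rewrite /phi cube_lptE scalerDl addrA -cube_lptE ry; lra.
by apply/(cube_cube_lpt i _ tcd); rewrite cube_lptE scalerDl addrA -cube_lptE ry.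
Qed.

(** [int_Rn_line_bound] is one-sided, so it is applied to the integrand and to its negative, written
    as [0 + -1 * Phi] to fit [int_Rn_affine]. *)
Lemma real_cube_oscillation (a : 'rV[R]_n.+1 -> R) (G th : R) :
  C1_within E a -> (forall x, E x -> `|a x| <= G) ->
  `|int_Rn E (fun x => cos ((Lam ^+ (N + 2))^-1 * f x + th) * a x)| <=
  (d - c) ^+ n *
    (G * (4 * expR (2 + gam) * (Lam ^+ N / 2 / M2) `^ (N%:R^-1) * (d - c)) +
      (2 * N).+1%:R * (18 * Lam) * G) +
  (2 * N).+1%:R * (18 * Lam) * int_Rn E (fun x => `|dpartial E i a x|).
Proof.
move=> Ca aG; have [ca /(_ i)[_ cda]] := Ca.
set K := (2 * N).+1%:R * (18 * Lam).
set th' := 4 * expR (2 + gam) * _ * (d - c).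
have K0 : 0 <= K by rewrite !mulr_ge0// ltW.
have th0 : 0 <= th'.
  by rewrite !mulr_ge0 ?expR_ge0 ?powR_ge0// subr_ge0 ltW.
pose Phi x := cos ((Lam ^+ (N + 2))^-1 * f x + th) * a x.
have cPhi : {within E, continuous Phi}.
  move=> x; apply: cvgM; last exact: ca.
  apply: continuous_comp; last exact: continuous_cos.
  by apply: cvgD; [apply: cvgM; [exact: cvg_cst|exact: smooth_within]|exact: cvg_cst].
have cA : {within E, continuous (fun x => `|dpartial E i a x|)}.
  by move=> x; apply: cvg_norm; exact: cda.
have A0 x : E x -> 0 <= `|dpartial E i a x| by [].
have [x0 Ex0] : exists x, E x.
  by exists (\row__ c) => k; rewrite mxE lexx ltW.
have G0 : 0 <= G by apply: le_trans (aG _ Ex0).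
have be0 : 0 <= G * th' + K * G by apply: addr_ge0; apply: mulr_ge0.
have line t : cube_dom c d t ->
    `|\int[leb]_(s in `[c, d]) Phi (cube_lpt i t s)| <=
    (G * th' + K * G) + K * \int[leb]_(s in `[c, d]) `|dpartial E i a (cube_lpt i t s)|.
  move=> tcd; rewrite -addrA -mulrDr.
  have dphi j s := @line_derive t j s tcd.
  have phiM j s := @line_bound t j s tcd.
  have ct := within_cube_lpt (i := i) tcd ca; have cdt := within_cube_lpt (i := i) tcd cda.
  have du s : c < s < d -> is_derive s 1 (a \o cube_lpt i t)
      ((dpartial E i a \o cube_lpt i t) s).
    by move=> scd; exact: is_derive_dpartial_line.
  have aGt s : c <= s <= d -> `|(a \o cube_lpt i t) s| <= G.
    by move=> scd; apply: aG; apply/cube_cube_lpt.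
  have := line_oscillation th m_gt0 M2_gt0 b2_gt0 lam_gt0 lam_le dphi phiM j0m cd len
    j0b gam_ge0 lam_growth (line_large tcd) Lam_gt0 Lam_le ct cdt du aGt.
  exact.
have up : int_Rn E Phi <= (d - c) ^+ n * (G * th' + K * G) +
    K * int_Rn E (fun x => `|dpartial E i a x|).
  apply: (int_Rn_line_bound cd cPhi cA A0 be0 K0) => t tcd.
  exact: le_trans (ler_norm _) (line t tcd).
have cPhiN : {within E, continuous (fun x => 0 + -1 * Phi x)}.
  move=> x; apply: cvgD; first exact: cvg_cst.
  by apply: cvgM; [exact: cvg_cst|exact: cPhi].
have dn : - int_Rn E Phi <= (d - c) ^+ n * (G * th' + K * G) +
    K * int_Rn E (fun x => `|dpartial E i a x|).
  have := int_Rn_affine 0 (-1) (ltW cd) cPhi; rewrite mul0r add0r mulN1r => <-.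
  apply: (int_Rn_line_bound cd cPhiN cA A0 be0 K0) => t tcd.
  apply: le_trans (line t tcd); rewrite -normrN; apply: le_trans (ler_norm _).
  have iP : leb.-integrable `[c, d] (EFin \o (Phi \o cube_lpt i t)).
    apply: continuous_compact_integrable; first exact: segment_compact.
    exact: within_cube_lpt.
  have mcd : measurable (`[c, d] : set (measurableTypeR R)) by exact: measurable_itv.
  have := RintegralZl (-1) mcd iP; rewrite mulN1r => <-.
  by rewrite le_eqVlt; apply/orP; left; apply/eqP/eq_Rintegral => s _; rewrite add0r.
by rewrite ler_norml; apply/andP; split; [rewrite lerNl|].
Qed.

(** The factor 4 counts the real integrals: cosine and sine against the real and imaginary parts of
    [g]. Sines are cosines shifted by [pi / 2]. *)
Lemma cube_oscillation (g : 'rV[R]_n.+1 -> R[i]) : C1_withinC E g ->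
  cmod (int_Cn E (fun x => expi ((Lam ^+ (N + 2))^-1 * f x) * g x)) <=
  4 * ((d - c) ^+ n *
    (supnorm E (fun x => cmod (g x)) *
        (4 * expR (2 + gam) * (Lam ^+ N / 2 / M2) `^ (N%:R^-1) * (d - c)) +
      (2 * N).+1%:R * (18 * Lam) * supnorm E (fun x => cmod (g x))) +
    (2 * N).+1%:R * (18 * Lam) * int_Rn E (fun x => cmod (dpartialC E i g x))).
Proof.
move=> [C1 C2]; set G := supnorm _ _; set J := int_Rn E (fun x => cmod _).
set B := (X in _ <= 4 * X).
have [[c1 /(_ i)[_ cd1]] [c2 /(_ i)[_ cd2]]] := (C1, C2).
have gG x : E x -> cmod (g x) <= G.
  move=> Ex; have <- : `|cmod (g x)| = cmod (g x) by rewrite ger0_norm// cmod_ge0.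
  by apply: le_supnorm Ex; exact: within_continuous_cmod.
pose X th a := int_Rn E (fun x => cos ((Lam ^+ (N + 2))^-1 * f x + th) * a x).
have XB th a : C1_within E a -> (forall x, E x -> `|a x| <= cmod (g x)) ->
    (forall x, E x -> `|dpartial E i a x| <= cmod (dpartialC E i g x)) -> `|X th a| <= B.
  move=> Ca ag dag; have aG x : E x -> `|a x| <= G.
    by move=> Ex; apply: le_trans (gG _ Ex); exact: ag.
  apply: le_trans (real_cube_oscillation th Ca aG) _; rewrite lerD2l.
  apply: ler_wpM2l; first by rewrite !mulr_ge0// ltW.
  apply: int_Rn_le => //; first exact: ltW.
  - by move=> x; apply: cvg_norm; have [_ /(_ i)[_ +]] := Ca; apply.
  - exact: within_continuous_cmod.
have cX th a : {within E, continuous a} ->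
    {within E, continuous (fun x => cos ((Lam ^+ (N + 2))^-1 * f x + th) * a x)}.
  move=> ca x; apply: cvgM; last exact: ca.
  apply: continuous_comp; last exact: continuous_cos.
  by apply: cvgD; [apply: cvgM; [exact: cvg_cst|exact: smooth_within]|exact: cvg_cst].
have B1 th : `|X th (fun x => complex.Re (g x))| <= B.
  by apply: XB => // x _; [have [] := cmod_ge (g x)|have [] := cmod_ge (dpartialC E i g x)].
have B2 th : `|X th (fun x => complex.Im (g x))| <= B.
  by apply: XB => // x _; [have [] := cmod_ge (g x)|have [] := cmod_ge (dpartialC E i g x)].
apply: le_trans (cmod_le _ _) _.
have -> : int_Rn E (fun x => complex.Re (expi ((Lam ^+ (N + 2))^-1 * f x) * g x)) =
    X 0 (fun x => complex.Re (g x)) + X (pi / 2) (fun x => complex.Im (g x)).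
  rewrite /X -int_RnD ?ltW//; [|exact: cX|exact: cX].
  congr int_Rn; apply/funext => x; case: (g x) => a b /=.
  by rewrite addr0 cosDpihalf mulNr.
have -> : int_Rn E (fun x => complex.Im (expi ((Lam ^+ (N + 2))^-1 * f x) * g x)) =
    X 0 (fun x => complex.Im (g x)) + X (- (pi / 2)) (fun x => complex.Re (g x)).
  rewrite /X -int_RnD ?ltW//; [|exact: cX|exact: cX].
  congr int_Rn; apply/funext => x; case: (g x) => a b /=.
  by rewrite addr0 cosBpihalf.
have := B1 0; have := B1 (- (pi / 2)); have := B2 0; have := B2 (pi / 2).
move=> h1 h2 h3 h4.
have := ler_normD (X 0 (fun x => complex.Re (g x))) (X (pi / 2) (fun x => complex.Im (g x))).
have := ler_normD (X 0 (fun x => complex.Im (g x))) (X (- (pi / 2)) (fun x => complex.Re (g x))).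
lra.
Qed.

End cube_oscillation.

Lemma powR_exprK {R : realType} (x : R) (N : nat) : 0 <= x -> (0 < N)%N ->
  (x ^+ N) `^ (N%:R^-1) = x.
Proof.
move=> x0 N0; rewrite -powR_mulrn// -powRrM mulfV ?powRr1//.
by rewrite pnatr_eq0 -lt0n.
Qed.

(** [Lam ^ N] is the power [- N / (N + 2)] of [lam], and [(1 + 2 / N) * (N / (N + 2)) = 1]; so the
    threshold for [lam] is precisely the condition on [Lam ^ N]. *)
Lemma frequency_scale {R : realType} (b lam : R) (N : nat) : 0 < b -> (0 < N)%N ->
  (2 / b) `^ (1 + 2 / N%:R) <= lam ->
  let Lam := lam `^ (- (N%:R + 2)^-1) in
  [/\ 0 < Lam, (Lam ^+ (N + 2))^-1 = lam & Lam ^+ N <= b / 2].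
Proof.
move=> b0 N0 lamge Lam.
have N0R : 0 < N%:R :> R by rewrite ltr0n.
have b2 : 0 < 2 / b by rewrite divr_gt0.
have lam0 : 0 < lam by apply: lt_le_trans lamge; exact: powR_gt0.
have N2 : N%:R + 2 != 0 :> R by rewrite gt_eqF// addr_gt0.
have LE k : Lam ^+ k = (lam `^ (k%:R / (N%:R + 2)))^-1.
  by rewrite -powR_mulrn ?powR_ge0// -powRrM -powRN mulNr mulrC.
split; first exact: powR_gt0.
  by rewrite LE invrK natrD mulfV ?powRr1// ltW.
rewrite LE -[b / 2]invrK lef_pV2 ?posrE ?powR_gt0 ?invr_gt0 ?divr_gt0//.
rewrite invf_div; apply: (@le_trans _ _ (((2 / b) `^ (1 + 2 / N%:R)) `^ (N%:R / (N%:R + 2)))).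
  have e1 : (1 + 2 / N%:R) * (N%:R / (N%:R + 2)) = 1 :> R by field; rewrite N2 gt_eqF.
  by rewrite -powRrM e1 powRr1// ltW.
by apply: ge0_ler_powR => //; rewrite ?nnegrE ?powR_ge0 ?divr_ge0 ?addr_ge0// ltW.
Qed.

(** The lower bound makes the sup norm a legitimate denominator; the upper bound allows it to
    replace [M2] in the sublevel estimate. *)
Lemma supnorm_line_bounds {R : realType} n (c d b M : R) (i : 'I_n) (h : 'rV[R]_n -> R) :
  c <= d -> (forall x, cube c d x -> `|h x| <= M) ->
  (forall x, cube c d x -> b <= supnorm (cube_line c d i x) h) ->
  b <= supnorm (cube c d) h <= M.
Proof.
move=> cd hM hb.
have Ex : cube c d (\row__ c : 'rV[R]_n) by move=> k; rewrite mxE lexx.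
apply/andP; split; last first.
  apply: ge_sup; first by exists `|h (\row__ c)|, (\row__ c).
  by move=> _ [y Ey <-]; exact: hM.
apply: le_trans (hb _ Ex) _; apply: ge_sup.
  exists `|h (\row__ c)|, (\row__ c) => //; split => //.
  by exists 0 => //; rewrite scale0r addr0.
move=> _ [y [Ey _] <-]; apply: ub_le_sup; last by exists y.
by exists M => _ [z Ez <-]; exact: hM.
Qed.

(* [4 <= e^2] absorbs the factor [4] coming from the four real integrals. *)
Lemma oscillation_bound_le {R : realType} (n N : nat) (D G J gam Lam Q H : R) :
  (0 < n)%N -> 0 <= D -> 0 <= G -> 0 <= J -> 0 < Lam -> 0 < H -> Q <= Lam / H ->
  4 * (D ^+ n.-1 * (G * (4 * expR (2 + gam) * Q * D) +
      (2 * N).+1%:R * (18 * Lam) * G) + (2 * N).+1%:R * (18 * Lam) * J) <=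
  (4 * expR (4 + gam) * n%:R * D ^+ n * G / H +
    2 * 72 * (N%:R + 1) * (D ^+ n.-1 * G + J)) * Lam.
Proof.
move=> n0 D0 G0 J0 L0 H0 QH.
have P0 : 0 <= D ^+ n.-1 * G by rewrite mulr_ge0 ?exprn_ge0.
have DE : D ^+ n = D ^+ n.-1 * D by rewrite -exprSr prednK.
have n1 : 1 <= n%:R :> R by rewrite ler1n.
have E2 : 4 * expR (2 + gam) <= expR (4 + gam) * n%:R.
  apply: (@le_trans _ _ (expR (4 + gam))); last first.
    by rewrite ler_peMr// expR_ge0.
  rewrite (_ : 4 + gam = 1 + 1 + (2 + gam)); last by ring.
  rewrite [X in _ <= X]expRD; apply: ler_wpM2r; first exact: expR_ge0.
  by rewrite expRD; have := @expR_ge1Dx R 1; nra.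
have h1 : 4 * expR (2 + gam) * Q <= expR (4 + gam) * n%:R * (Lam / H).
  apply: (@le_trans _ _ (4 * expR (2 + gam) * (Lam / H))).
    by apply: ler_wpM2l => //; rewrite mulr_ge0 ?expR_ge0.
  by apply: ler_wpM2r => //; rewrite divr_ge0// ltW.
have h2 := ler_wpM2r (mulr_ge0 P0 D0) h1.
have h3 : (2 * N).+1%:R * 18 * 4 <= 2 * 72 * (N%:R + 1) :> R.
  by rewrite -natr1 natrM; have := ler0n R N; lra.
have h4 := ler_wpM2r (mulr_ge0 (ltW L0) (addr_ge0 P0 J0)) h3.
rewrite DE; set P := D ^+ n.-1 in P0 h2 h4 *.
have -> : 4 * expR (4 + gam) * n%:R * (P * D) * G / H =
    4 * (expR (4 + gam) * n%:R * H^-1 * (P * G * D)) by ring.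
lra.
Qed.

Unset Implicit Arguments.

Theorem theorem11p3 (R : realType) :
  exists C : R, 0 < C /\
  forall (n : nat) (c d : R) (mu : nat -> R) (M0 b2 : R) (i0 : 'I_n)
         (N : nat) (mut : R -> R)
         (f : 'rV[R]_n -> R) (g : 'rV[R]_n -> R[i]) (lam : R),
    c <= d ->
    admissible_weight mu ->
    0 < M0 ->
    0 < b2 ->
    b2 <= weightM mu M0 2 ->
    admissible_tuple (shift2 mu) (weightM mu M0 2 + b2 / 2)
      (Num.sqrt n%:R * (d - c)) (b2 / 2) ->
    N = degreeN (shift2 mu) (weightM mu M0 2 + b2 / 2)
          (Num.sqrt n%:R * (d - c)) (b2 / 2) ->
    weight_interpolation (shift2 mu) mut ->
    mu_smooth mu (N + 2)%N M0 (cube c d) f ->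
    (forall x, cube c d x ->
       b2 <= supnorm (cube_line c d i0 x) (partials [:: i0; i0] f)) ->
    C1_withinC (cube c d) g ->
    (2 / b2) `^ (1 + 2 / N%:R) <= lam ->
    cmod (int_Cn (cube c d) (fun x => expi (lam * f x) * g x))
      <= boundB C (constC mut N) N c d i0 (partials [:: i0; i0] f) g
         * lam `^ (- (N%:R + 2)^-1).
Proof.
(* [72 = 4 * 18]: four real integrals and the constant 18 of the second derivative test; moreover
   [2 N + 1 <= 2 (N + 1)]. *)
exists 72; split => //.
case=> [|n] c d mu M0 b2 i0 N mut f g lam cd adm M00 b20 b2M tup NE wi fs f2 Cg lamge.
  by have := ltn_ord i0.
have [m [Nm]] := degreeN_spec tup.
set j0 := degree_j0 _ _ => j0m len j0b.
have {}NE : N = (2 * m)%N by rewrite NE.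
subst N.
have [wlam A0 a0 _ _] := tup.
set M2 := weightM mu M0 2 in b2M len j0b A0 *.
have M20 : 0 < M2 by exact: lt_le_trans b2M.
(* Lines in a coordinate direction have length [d - c], at most the [sqrt n * (d - c)] for which the
   tuple is admissible. *)
have s1 : 1 <= Num.sqrt n.+1%:R :> R by rewrite -[leLHS]sqrtr1 ler_sqrt ?ler1n ?ler0n.
have dc0 : 0 < d - c.
  by rewrite -(pmulr_rgt0 _ (lt_le_trans ltr01 s1)).
have {}len : d - c <= \sum_(j0.+1 <= k < m.+2) (expR 1 * shift2 mu k)^-1.
  by apply: le_trans len; rewrite ler_peMl// ltW.
(* If [m = 0] then [j0 = 0], and [j0b] would read [M2 + b2 / 2 <= b2 / 2]. *)
have m0 : (0 < m)%N.
  rewrite lt0n; apply/eqP => m00; move: j0m j0b; rewrite m00 leqn0 => /eqP ->.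
  by rewrite oppr0 expR0 mul1r; lra.
have N1 : (1 < 2 * m)%N by exact: (leq_mul (leqnn 2) m0).
have N0 : (0 < 2 * m)%N by exact: ltnW.
have [gam0 growth] := gamma_weight_spec N1 wi.
set gam := gamma_weight mut (2 * m)%:R in gam0 growth.
have [L0 LE LN] := frequency_scale b20 N0 lamge.
set Lam := lam `^ _ in L0 LE LN *.
have f2M x : cube c d x -> `|partials [:: i0; i0] f x| <= M2.
  move=> Ex; have [_ fj] := fs.
  apply: le_trans (norm_partials_le_jet i0 2 f x) _.
  by apply: fj => //; rewrite addn2.
have cd' : c < d by rewrite -subr_gt0.
have /andP[bH HM] := supnorm_line_bounds cd f2M f2.
have E0 : 0 <= 4 * expR (4 + gam) by rewrite mulr_ge0 ?expR_ge0.
rewrite /boundB /constC -/gam powR_exprK//.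
set H := supnorm _ _ in bH HM *.
have H0 : 0 < H by exact: lt_le_trans bH.
rewrite -LE.
have lg j : (1 <= j <= 2 * m)%N -> 0 < shift2 mu j.
  by case/andP => + _; exact: admissible_weight_gt0.
have ll j k : (1 <= j)%N -> (j <= k <= 2 * m)%N -> shift2 mu j <= shift2 mu k.
  by move=> j1 /andP[jk _]; exact: admissible_weight_le.
apply: le_trans (cube_oscillation cd' m0 M20 b20 lg ll j0m len j0b gam0 growth L0 LN fs f2 Cg) _.
have [[cg1 /(_ i0)[_ cd1]] [cg2 /(_ i0)[_ cd2]]] := Cg.
apply: (@oscillation_bound_le _ n.+1) => //.
- exact: ltW.
- have Ex : cube c d (\row__ c : 'rV[R]_n.+1) by move=> k; rewrite mxE lexx.
  apply: le_trans (le_supnorm _ Ex); last exact: within_continuous_cmod.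
  exact: normr_ge0.
- by apply: Rintegral_ge0 => t _; exact: cmod_ge0.
- exact: powR_gt0.
(* Under the [N]-th root, [Lam ^ N / 2 / M2 <= Lam ^ N / H] because [H <= M2]. *)
- have -> : Lam / H `^ (2 * m)%:R^-1 = (Lam ^+ (2 * m) / H) `^ (2 * m)%:R^-1.
    rewrite powRM ?exprn_ge0 ?invr_ge0 ?ltW// powR_exprK ?ltW//.
    by rewrite -[H^-1]powR_inv1 ?ltW// -powRrM mulN1r powRN.
  have H1 := ltW H0; have M1 := ltW M20; have L1 := ltW L0.
  apply: ge0_ler_powR; rewrite ?nnegrE ?invr_ge0 ?divr_ge0 ?exprn_ge0//.
  have LN0 : 0 <= Lam ^+ (2 * m) by rewrite exprn_ge0.
  apply: ler_pM; rewrite ?divr_ge0 ?invr_ge0//.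
    by rewrite ler_piMr// invf_le1 ?ler1n.
  by rewrite lef_pV2.
Qed.
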